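(* For any infinite, locally finite, transient, unimodular, transitive graph $\mathcal{G}$, \[\lim_{t\to\infty}tP_t=\frac{1}{\alpha_\infty}.\]
   Context: On the graph each particle performs a continuous-time simple random walk jumping across each incident edge at rate $1$. Coalescing random walks: initially one particle per vertex; particles move independently and when one jumps onto the location of another they merge into one walk. $P_t$ is the probability that a given vertex is occupied at time $t$ (independent of the vertex by transitivity). For a vertex $x$, $r(x)$ is its degree, $\nu_x$ the uniform distribution on its neighbours, and $\alpha_\infty:=r(x)\mathbb{P}(\tau_{\mathrm{meet}}=\infty)$ where $\tau_{\mathrm{meet}}$ is the first meeting time of two independent walks started at $x$ and at a $\nu_x$-distributed vertex. Unimodular: the graph satisfies the mass-transport principle. *)

(* Defs.v *)
From HB Require Import structures.
From mathcomp Require Import all_boot all_order all_algebra.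
From mathcomp Require Import all_classical all_reals all_analysis.
Set Implicit Arguments. Unset Strict Implicit. Unset Printing Implicit Defensive.
Import Order.TTheory GRing.Theory Num.Theory.
Import numFieldNormedType.Exports.
Local Open Scope classical_set_scope.
Local Open Scope ring_scope.

(** * Graphs.  A locally finite graph on a countable vertex type [V] is given
    by its (finite) neighbour lists [nb x]. *)
Section Graph.
Variable V : countType.
Variable nb : V -> seq V.

Definition simple_graph : Prop :=
  [/\ forall x y, (y \in nb x) = (x \in nb y),
      forall x, x \notin nb x &
      forall x, uniq (nb x)].

Definition graph_connected : Prop :=
  forall x y, exists p : seq V,
    path (fun a b => b \in nb a) x p && (last x p == y).

Definition is_aut (phi : V -> V) : Prop :=
  bijective phi /\ forall x y, (phi y \in nb (phi x)) = (y \in nb x).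

Definition vertex_transitive : Prop :=
  forall x y, exists phi, is_aut phi /\ phi x = y.

(** unimodular: the mass-transport principle holds for every nonnegative
    diagonally-invariant function. *)
Definition unimodular (R : realType) : Prop :=
  forall f : V -> V -> \bar R,
    (forall x y, (0 <= f x y)%E) ->
    (forall phi, is_aut phi -> forall x y, f (phi x) (phi y) = f x y) ->
    forall x, (\esum_(y in [set: V]) f x y)%E = (\esum_(y in [set: V]) f y x)%E.

(** particle configurations: a finite list of positions *)
(** independent walks: every particle jumps across each incident edge at rate 1 *)
Fixpoint indep_moves (xi : seq V) : seq (seq V) :=
  match xi with
  | [::] => [::]
  | v :: xi' => [seq w :: xi' | w <- nb v] ++ [seq v :: m | m <- indep_moves xi']
  end.

(** coalescing walks: all particles sitting on a site move together; each
    occupied site u moves across each incident edge uw at rate 1 *)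
Definition coal_moves (xi : seq V) : seq (seq V) :=
  flatten [seq [seq map (fun v => if v == u then w else v) xi | w <- nb u]
          | u <- undup xi].
End Graph.

(** * Continuous-time Markov chains with given jump rates
    (rate from s to s' = multiplicity of s' in [moves s]), via
    uniformization with a rate [Lam] bounding the total jump rates. *)
Section CTMC.
Variable R : realType.
Variable S : eqType.
Variable moves : S -> seq S.
Variable Lam : R.

Fixpoint Qn (n : nat) (s s' : S) : R :=
  match n with
  | 0 => (s == s')%:R
  | n'.+1 => \sum_(m <- moves s) Qn n' m s' / Lam
             + (1 - (size (moves s))%:R / Lam) * Qn n' s s'
  end.

Definition heat (t : R) (s s' : S) : R :=
  limn (series (fun n => expR (- (Lam * t)) * (Lam * t) ^+ n / (n`!)%:R * Qn n s s')).

Fixpoint chain_prob (t0 : R) (s0 : S) (ts : seq (R * S)) : R :=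
  match ts with
  | [::] => 1
  | (t, s) :: ts' => heat (t - t0) s0 s * chain_prob t s ts'
  end.

Definition is_ctmc (d : measure_display) (Omega : measurableType d)
    (P : probability Omega R) (init : seq S) (Y : R -> Omega -> S) : Prop :=
  [/\ forall t s, measurable [set w | Y t w = s],
      forall w t, 0 <= t -> exists2 e : R, 0 < e &
          forall u, t <= u < t + e -> Y u w = Y t w &
      forall ts : seq (R * S),
        sorted (fun a b => a.1 < b.1) ts -> all (fun a => 0 <= a.1) ts ->
        P [set w | all (fun a => Y a.1 w == a.2) ts] =
        ((size init)%:R^-1 * \sum_(s0 <- init) chain_prob 0 s0 ts)%:E].
End CTMC.

(** * Coalescing random walks started from one particle per vertex:
    [X y t] is the position at time t of the particle started at y.
    Every finite subfamily evolves as the coalescing system. *)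
Definition coalescing_rw (R : realType) (V : countType) (nb : V -> seq V)
    (deg : nat) (d : measure_display) (Omega : measurableType d)
    (P : probability Omega R) (X : V -> R -> Omega -> V) : Prop :=
  forall F : seq V, uniq F ->
    is_ctmc (coal_moves nb) ((size F * deg)%:R) P [:: F]
            (fun t w => map (fun y => X y t w) F).

(* Main.v *)
(** Let p be the density and h the sum over the neighbours y of o of the
    probability that o and y are both occupied; then p' = - h, and occupation
    events are negatively correlated.

    Dropping the three-point terms in the equation for the pair densities bounds
    the pair density at time t + s by p(t)^2 times the probability that two walks
    do not meet during a time s. Hence h <= (alpha + e) p^2 for large t, and
    Y = 1/p grows at a rate at most alpha + e.

    Conversely, integrate the pair density over the positions of two independent
    walks started at o and killed when they have run for a time of order S, that
    is, against a truncated Green function. The result Psi lies between 0 and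
    S p^2, and
      Psi' >= (1 - e) p^2 - p pi_S - (1/alpha + 2 S p) h,
    where pi_S is the probability that the two walks are together at time S: the
    first term comes from E[(sum_x q_S(o,x) 1_x)^2] >= p^2 minus the diagonal, the
    coefficient 1/alpha is the Green function of the pair walk at the diagonal
    divided by r, by the last-exit decomposition, and three-point probabilities
    are at most p h. As pi_S is summable in S by transience, S can be chosen of
    order eta Y with S pi_S <= eta^2; then (Psi Y^2 + Y/alpha)' >= 1 - O(eta),
    so that Y grows at a rate at least alpha - e. *)

Require Import Defs.
From HB Require Import structures.
From mathcomp Require Import all_boot all_order all_algebra.
From mathcomp Require Import all_classical all_reals all_analysis.
From mathcomp Require Import ring lra zify.
Set Implicit Arguments. Unset Strict Implicit. Unset Printing Implicit Defensive.
Import Order.TTheory GRing.Theory Num.Theory.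
Import numFieldNormedType.Exports.
Local Open Scope classical_set_scope.
Local Open Scope ring_scope.

(** * Poisson averages and real-variable lemmas *)

(** The infinite system is accessible only through finite subfamilies, whose semigroups are Poisson
    averages over a jump chain. The generator of an occupation indicator is bounded uniformly in the
    number of particles, so the equations for the densities survive the limit. The three-point terms
    call for negative correlation between one site and a pair; it is proved by comparing families
    driven by common jumps with independent ones. Counting jumps instead of time makes the Green
    function a plain series; $\alpha$ appears as $r$ times the limit of [renewal], and the
    continuous-time event of never meeting is reached through dyadic grids. Transience, an almost
    sure statement about one walk, is turned into summable return probabilities, which give both
    $\alpha>0$ and the decay of $\pi_S$. Two obstacles remain at the end. The estimates only bite
    once $p\to 0$, which needs a coarser inequality for Psi. And summability does not make $S\pi_S$
    small for every $S$, only for some $S$ in each late block $[n,2n)$; since $Y'\le r$, a single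
    such $S$ serves on a whole window of length $Y/r$. *)

Lemma cvg_bigsum (R : realType) (T : Type) (I : eqType) (F : set_system T)
    (FF : Filter F) (s : seq I) (u : I -> T -> R) (l : I -> R) :
  (forall i, i \in s -> u i x @[x --> F] --> l i) ->
  \sum_(i <- s) u i x @[x --> F] --> \sum_(i <- s) l i.
Proof.
elim: s => [|i s IH] ul.
  by under eq_fun do rewrite big_nil; rewrite big_nil; exact: cvg_cst.
under eq_fun do rewrite big_cons.
rewrite big_cons; apply: cvgD; first by apply: ul; rewrite mem_head.
by apply: IH => k ks; apply: ul; rewrite inE ks orbT.
Qed.

Section PoissonMean.
Variable R : realType.
Implicit Types (l M c x : R) (a b : nat -> R).

Definition pois l n : R := expR (- l) * l ^+ n / n`!%:R.
Definition pmean l a : R := limn (series (fun n => pois l n * a n)).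

(** Boundedness would not do: [sum_pair_diag_bounded] averages partial Green sums before they are
    known to be bounded. The factorial in [pois] beats any geometric rate. *)
Definition exp_growth a := exists M, forall n, `|a n| <= M * 2 ^+ n.

Lemma pois_ge0 l n : 0 <= l -> 0 <= pois l n.
Proof.
by move=> l0; rewrite /pois divr_ge0 ?mulr_ge0 ?expR_ge0 ?exprn_ge0.
Qed.

Lemma bounded_growth M a : (forall n, `|a n| <= M) -> exp_growth a.
Proof.
move=> aM; exists M => n; rewrite (le_trans (aM n))// ler_peMr//.
  exact: le_trans (normr_ge0 _) (aM 0%N).
by rewrite exprn_ege1// ler1n.
Qed.

Lemma unit_growth a : (forall n, 0 <= a n <= 1) -> exp_growth a.
Proof.
move=> a01; apply: (bounded_growth (M := 1)) => n.
by have /andP[a0 a1] := a01 n; rewrite ger0_norm.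
Qed.

Lemma geometric_growth : exp_growth (fun n => 2 ^- n).
Proof.
apply: unit_growth => n; rewrite invr_ge0 exprn_ge0//=.
by rewrite invf_le1 ?exprn_gt0// exprn_ege1// ler1n.
Qed.

Lemma shift_growth a : exp_growth a -> exp_growth (fun n => a n.+1).
Proof. by move=> [M aM]; exists (M * 2) => n; rewrite -mulrA -exprS. Qed.

Lemma lin_growth a b c :
  exp_growth a -> exp_growth b -> exp_growth (fun n => a n + c * b n).
Proof.
move=> [M aM] [N bN]; exists (M + `|c| * N) => n.
rewrite (le_trans (ler_normD _ _))// mulrDl lerD// normrM -mulrA.
by rewrite ler_wpM2l.
Qed.

Lemma cst_growth c : exp_growth (fun=> c).
Proof. exact: (@bounded_growth `|c|). Qed.

Lemma sum_growth (I : Type) (s : seq I) (a : I -> nat -> R) :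
  (forall i, exp_growth (a i)) -> exp_growth (fun n => \sum_(i <- s) a i n).
Proof.
move=> ag; elim: s => [|i s IH].
  by under eq_fun do rewrite big_nil; exact: cst_growth.
under eq_fun do rewrite big_cons -[X in _ + X]mul1r.
exact: lin_growth.
Qed.

Let eseq a n : R := a n / n`!%:R.

Let is_cvg_eseq a x : exp_growth a -> cvgn (pseries (eseq a) x).
Proof.
move=> [M aM]; apply: normed_cvg.
have M0 : 0 <= M by rewrite -[M]mulr1 -(expr0 2); exact: le_trans (aM 0%N).
apply: (@series_le_cvg _ _ (fun n => M * exp_coeff (2 * `|x|) n)).
- by move=> n /=.
- by move=> n; rewrite mulr_ge0// /exp_coeff /= divr_ge0// exprn_ge0// mulr_ge0.
- move=> n /=; rewrite /eseq /exp_coeff /= !normrM normrX normfV normr_nat.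
  rewrite exprMn [leRHS]mulrA mulrA -[leLHS]mulrA [_^-1 * _]mulrC mulrA.
  by rewrite ler_wpM2r ?invr_ge0 ?ler0n// ler_wpM2r// exprn_ge0.
- rewrite (_ : (fun n => _) = M *: exp_coeff (2 * `|x|)); last by apply/funext.
  exact/is_cvg_seriesZ/is_cvg_series_exp_coeff.
Qed.

Let cvg_pmeanE a l : exp_growth a ->
  series (fun n => pois l n * a n) @ \oo -->
    expR (- l) * limn (pseries (eseq a) l).
Proof.
move=> ag; rewrite (_ : series _ = fun n => expR (- l) * pseries (eseq a) l n).
  exact: cvgM (cvg_cst _) (is_cvg_eseq ag).
apply/funext => n; rewrite /pseries /series /= mulr_sumr.
by apply: eq_bigr => i _; rewrite /pois /eseq; ring.
Qed.

Lemma is_cvg_pmean a l : exp_growth a ->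
  cvgn (series (fun n => pois l n * a n)).
Proof. by move=> ag; apply/cvg_ex; eexists; exact: cvg_pmeanE. Qed.

Lemma cvg_pmean a l : exp_growth a ->
  series (fun n => pois l n * a n) @ \oo --> pmean l a.
Proof. exact: is_cvg_pmean. Qed.

Let pmeanE a l : exp_growth a ->
  pmean l a = expR (- l) * limn (pseries (eseq a) l).
Proof. by move=> ag; apply: cvg_lim => //; exact: cvg_pmeanE. Qed.

Let pseries_diffs_eseq a :
  pseries_diffs (eseq a) = eseq (fun n => a n.+1).
Proof.
apply/funext => n; rewrite /pseries_diffs /eseq factS natrM invfM.
by rewrite mulrCA mulVKf// pnatr_eq0.
Qed.

(** The average is $e^{-l}$ times the exponential generating series of [a], and differentiating that
    series shifts [a]. Every evolution equation of a semigroup below comes from this. *)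
Lemma is_derive_pmean a l : exp_growth a ->
  is_derive l 1 (pmean^~ a) (pmean l (fun n => a n.+1) - pmean l a).
Proof.
move=> ag; have ag1 := shift_growth ag.
rewrite (_ : pmean^~ a =
  (fun x => expR (- x)) * (fun x => limn (pseries (eseq a) x))); last first.
  by apply/funext => x; rewrite pmeanE.
have D1 : is_derive l 1 (fun x => limn (pseries (eseq a) x))
                      (limn (pseries (eseq (fun n => a n.+1)) l)).
  rewrite -pseries_diffs_eseq; apply: (@pseries_snd_diffs _ _ (`|l| + 1)).
  - exact: is_cvg_eseq.
  - by rewrite pseries_diffs_eseq; exact: is_cvg_eseq.
  - by rewrite !pseries_diffs_eseq; exact: is_cvg_eseq (shift_growth ag1).
  - by rewrite [ltRHS]ger0_norm ?addr_ge0// ltrDl.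
apply: is_derive_eq; rewrite /GRing.scale /= !pmeanE//.
by rewrite mulrN1 mulrN [X in _ - X = _]mulrC.
Qed.


Lemma pmeanDM a b c l : exp_growth a -> exp_growth b ->
  pmean l (fun n => a n + c * b n) = pmean l a + c * pmean l b.
Proof.
move=> ag bg; apply: cvg_lim => //.
rewrite (_ : series _ = (fun n => series (fun n => pois l n * a n) n +
                         c * series (fun n => pois l n * b n) n)).
  exact: cvgD (cvg_pmean ag) (cvgM (cvg_cst _) (cvg_pmean bg)).
apply/funext => n; rewrite /series /= mulr_sumr -big_split /=.
by apply: eq_bigr => i _; ring.
Qed.

Lemma pmean0 a : pmean 0 a = a 0%N.
Proof.
apply: cvg_lim => //; rewrite -cvg_shiftS /=.
rewrite (_ : (fun n => _) = fun=> a 0%N); first exact: cvg_cst.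
apply/funext => n; rewrite /series /= big_nat_recl// big1 ?addr0.
  by rewrite /pois oppr0 expR0 expr0 fact0 !mul1r invr1 mul1r.
by move=> i _; rewrite /pois expr0n/= mulr0 !mul0r.
Qed.

Lemma pmean_cst l c : pmean l (fun=> c) = c.
Proof.
rewrite pmeanE; last exact: cst_growth.
rewrite (_ : pseries _ l = fun n => c * series (exp_coeff l) n); last first.
  apply/funext => n; rewrite /pseries /series /= mulr_sumr.
  by apply: eq_bigr => i _; rewrite /eseq /exp_coeff /=; ring.
have -> : limn (fun n => c * series (exp_coeff l) n) = c * expR l.
  by apply: cvg_lim => //; apply: cvgM (cvg_cst _) (is_cvg_series_exp_coeff l).
by rewrite mulrCA -expRD addNr expR0 mulr1.
Qed.

Lemma pmean_const_mul a c l : exp_growth a ->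
  pmean l (fun n => c * a n) = c * pmean l a.
Proof.
move=> ag; rewrite -[RHS]add0r -[in RHS](pmean_cst l 0) -pmeanDM//.
  by congr pmean; apply/funext => n; rewrite add0r.
exact: cst_growth.
Qed.

Lemma pmeanD a b l : exp_growth a -> exp_growth b ->
  pmean l (fun n => a n + b n) = pmean l a + pmean l b.
Proof.
move=> ag bg; rewrite -[pmean l b]mul1r -pmeanDM//.
by congr pmean; apply/funext => n; rewrite mul1r.
Qed.

Lemma pmean_sum (I : Type) (s : seq I) (a : I -> nat -> R) l :
  (forall i, exp_growth (a i)) ->
  pmean l (fun n => \sum_(i <- s) a i n) = \sum_(i <- s) pmean l (a i).
Proof.
move=> ag; elim: s => [|i s IH].
  by rewrite big_nil; under eq_fun do rewrite big_nil; exact: pmean_cst.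
rewrite big_cons -IH -pmeanD//; last exact: sum_growth.
by congr pmean; apply/funext => n; rewrite big_cons.
Qed.

Lemma ler_pmean a b l : 0 <= l -> exp_growth a -> exp_growth b ->
  (forall n, a n <= b n) -> pmean l a <= pmean l b.
Proof.
move=> l0 ag bg ab; apply: ler_lim; [exact: is_cvg_pmean..|].
near=> n; apply: ler_sum => i _.
by rewrite ler_wpM2l// pois_ge0.
Unshelve. all: by end_near. Qed.

Lemma pmean_ge0 a l : 0 <= l -> exp_growth a -> (forall n, 0 <= a n) -> 0 <= pmean l a.
Proof.
move=> l0 ag a0; rewrite -(pmean_cst l 0); apply: ler_pmean => //; exact: cst_growth.
Qed.

Lemma pmean_le a l M : 0 <= l -> (forall n, `|a n| <= M) -> `|pmean l a| <= M.
Proof.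
move=> l0 aM; have ag := bounded_growth aM; rewrite ler_norml; apply/andP; split.
  rewrite -(pmean_cst l (- M)); apply: ler_pmean => //; first exact: cst_growth.
  by move=> n; have := aM n; rewrite ler_norml => /andP[].
rewrite -[leRHS](pmean_cst l); apply: ler_pmean => //; first exact: cst_growth.
by move=> n; have := aM n; rewrite ler_norml => /andP[].
Qed.

Lemma pmean_ge_sum a l N : 0 <= l -> exp_growth a -> (forall n, 0 <= a n) ->
  \sum_(n < N) pois l n * a n <= pmean l a.
Proof.
move=> l0 ag a0; apply: limr_ge; first exact: is_cvg_pmean.
near=> n; rewrite /series /= big_mkord.
rewrite -!(big_mkord xpredT (fun n => pois l n * a n)).
rewrite (@big_cat_nat _ _ _ N 0 n)//=; last by near: n; exact: nbhs_infty_ge.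
rewrite lerDl sumr_ge0// => i _.
by rewrite mulr_ge0// pois_ge0.
Unshelve. all: by end_near. Qed.

Lemma sum_pois_le1 l N : 0 <= l -> \sum_(n < N) pois l n <= 1.
Proof.
move=> l0; rewrite -(pmean_cst l 1).
apply: le_trans (pmean_ge_sum N l0 (cst_growth 1) _); last by [].
by under [leRHS]eq_bigr do rewrite mulr1.
Qed.

Lemma cvg_sum_pois l : (fun N => \sum_(n < N) pois l n) @ \oo --> (1 : R).
Proof.
have := cvg_pmean (l := l) (cst_growth 1); rewrite pmean_cst.
rewrite (_ : series _ = fun N => \sum_(n < N) pois l n)//.
apply/funext => n; rewrite /series /= big_mkord.
by apply: eq_bigr => i _; rewrite mulr1.
Qed.

Lemma pmean_sub_sum a l M N : 0 <= l -> (forall n, `|a n| <= M) ->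
  `|pmean l a - \sum_(n < N) pois l n * a n| <=
    M * (1 - \sum_(n < N) pois l n).
Proof.
move=> l0 aM; have ag := bounded_growth aM.
(* Entries below [N] are set to 0. The remainder is then the average of [t a], dominated by [M]
   times the average of [t 1], which is the Poisson tail. *)
pose t (c : nat -> R) n : R := if (n < N)%N then 0 else c n.
have tM (c : nat -> R) B : 0 <= B -> (forall n, `|c n| <= B) -> forall n, `|t c n| <= B.
  by move=> B0 cB n; rewrite /t; case: ifP => _; rewrite ?normr0.
have M0 : 0 <= M := le_trans (normr_ge0 _) (aM 0%N).
have tE (c : nat -> R) B : (forall n, `|c n| <= B) ->
    pmean l c - \sum_(n < N) pois l n * c n = pmean l (t c).
  move=> cB; have cg := bounded_growth cB.
  have tcg : exp_growth (t c).
    by apply: (@bounded_growth B); apply: tM => //; exact: le_trans (cB 0%N).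
  apply/esym; apply: cvg_lim => //.
  have H : (fun n => series (fun n => pois l n * c n) n -
     \sum_(n < N) pois l n * c n) @ \oo -->
     pmean l c - \sum_(n < N) pois l n * c n.
    by apply: cvgB; [exact: cvg_pmean|exact: cvg_cst].
  apply: cvg_trans H; apply: near_eq_cvg; near=> n.
  have Nn : (N <= n)%N by near: n; exact: nbhs_infty_ge.
  rewrite /series /= !(@big_cat_nat _ _ _ N 0 n)//= big_mkord addrAC subrr add0r.
  rewrite [in RHS]big_nat_cond [X in _ = X + _]big1 ?add0r; last first.
    by move=> i /andP[/andP[_ iN] _]; rewrite /t iN mulr0.
  rewrite big_nat_cond [RHS]big_nat_cond; apply: eq_bigr => i.
  by rewrite andbT => /andP[Ni _]; rewrite /t ltnNge Ni.
have -> : 1 - \sum_(n < N) pois l n = pmean l (t (fun=> 1)).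
  rewrite -(tE _ 1) => [|n]; last by rewrite normr1.
  by rewrite pmean_cst; congr (_ - _); apply: eq_bigr => i _; rewrite mulr1.
rewrite (tE _ M)//.
have tg1 : exp_growth (t (fun=> 1)).
  by apply: (@bounded_growth 1); apply: tM => // n; rewrite normr1.
have tga : exp_growth (t a) by apply: (@bounded_growth M); exact: tM.
rewrite -pmean_const_mul//.
have Mg : exp_growth (fun n => M * t (fun=> 1) n).
  apply: (@bounded_growth M) => n; rewrite normrM ger0_norm// ler_piMr//.
  by apply: tM => // ?; rewrite normr1.
have tle n : `|t a n| <= M * t (fun=> 1) n.
  by rewrite /t; case: ifP => _; rewrite ?normr0 ?mulr0 ?mulr1.
rewrite ler_norml; apply/andP; split.
  rewrite -mulN1r -pmean_const_mul//; apply: ler_pmean => //.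
    apply: (@bounded_growth M) => n; rewrite mulN1r normrN normrM ger0_norm//.
    by rewrite ler_piMr//; apply: tM => // ?; rewrite normr1.
  by move=> n; have := tle n; rewrite ler_norml mulN1r => /andP[].
by apply: ler_pmean => // n; have := tle n; rewrite ler_norml => /andP[].
Unshelve. all: by end_near. Qed.

Lemma pmean_dominated (A : nat -> nat -> R) a l M : 0 <= l ->
  (forall k n, `|A k n| <= M) -> (forall n, A ^~ n @ \oo --> a n) ->
  (fun k => pmean l (A k)) @ \oo --> pmean l a.
Proof.
move=> l0 AM Aa.
have aM n : `|a n| <= M.
  have H : `|A k n| @[k --> \oo] --> `|a n| by apply: cvg_norm; exact: Aa.
  rewrite -(cvg_lim _ H)//.
  apply: limr_le; first by apply/cvg_ex; eexists; exact: H.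
  by near=> k; exact: AM.
have M0 : 0 <= M := le_trans (normr_ge0 _) (aM 0%N).
apply/cvgrPdist_lt => e e0.
have e4 : 0 < e / (4 * (M + 1)) by rewrite divr_gt0// mulr_gt0// ltr_wpDl.
have [N HN] : exists N, 1 - \sum_(n < N) pois l n < e / (4 * (M + 1)).
  have /cvgrPdist_lt /(_ _ e4) [N _ /(_ N (leqnn _)) HN] := cvg_sum_pois l.
  by exists N; exact: le_lt_trans (ler_norm _) HN.
have S0 : 0 <= 1 - \sum_(n < N) pois l n by rewrite subr_ge0 sum_pois_le1.
have tail : M * (1 - \sum_(n < N) pois l n) <= e / 4.
  apply: (@le_trans _ _ ((M + 1) * (e / (4 * (M + 1))))).
    by rewrite ler_pM// ?lerDl// ltW.
  have F (u v : R) : 0 < v -> v * (u / (4 * v)) <= u / 4.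
    by move=> v0; rewrite (_ : _ * _ = u / 4)//; field; rewrite gt_eqF.
  by apply: F; rewrite ltr_wpDl.
have /cvgrPdist_lt /(_ (e / 2)) : (fun k => \sum_(n < N) pois l n * A k n) @ \oo -->
    \sum_(n < N) pois l n * a n.
  apply: cvg_bigsum => i _; exact: cvgM (cvg_cst _) (Aa i).
rewrite divr_gt0// => /(_ isT) H; near=> k.
have Hk : `|\sum_(n < N) pois l n * a n - \sum_(n < N) pois l n * A k n| < e / 2.
  by near: k.
have T1 := le_trans (pmean_sub_sum N l0 aM) tail.
have T2 := le_trans (pmean_sub_sum N l0 (AM k)) tail.
move: Hk T1 T2; rewrite !ltr_norml !ler_norml => /andP[? ?] /andP[? ?] /andP[? ?].
by apply/andP; split; lra.
Unshelve. all: by end_near. Qed.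

(** The Poisson generating function at 1/2. It serves as tail bound: the indicator of [n < M] is at
    most $2^{M-n}$, so few jumps in a long time are exponentially unlikely. *)
Lemma pmean_geometric l : pmean l (fun n => 2 ^- n) = expR (- (l / 2)).
Proof.
rewrite pmeanE; last exact: geometric_growth.
rewrite (_ : pseries _ l = series (exp_coeff (l / 2))); last first.
  apply/funext => n; rewrite /pseries /series /=.
  by apply: eq_bigr => i _; rewrite /eseq /exp_coeff /= exprMn exprVn; ring.
by rewrite -/(expR _) -expRD; congr expR; lra.
Qed.

End PoissonMean.

(** * Mean value bounds, limits of derivatives, a maximum principle *)

Section RealTools.
Variable R : realType.
Implicit Types (a b c x y t h k e C M : R).

Lemma is_derive_within (f : R -> R) (df : R -> R) a b :
  (forall x, a <= x <= b -> is_derive x 1 f (df x)) ->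
  {within `[a, b], continuous f}.
Proof.
move=> fd; apply: derivable_within_continuous => x.
by rewrite in_itv/= => xab; have := fd x xab; case.
Qed.

Lemma is_derive_ge (f df : R -> R) a b c : a <= b ->
  (forall x, a <= x <= b -> is_derive x 1 f (df x)) ->
  (forall x, a <= x <= b -> c <= df x) -> c * (b - a) <= f b - f a.
Proof.
move=> ab fd dfc.
have fd' x : x \in `]a, b[%R -> is_derive x 1 f (df x).
  by rewrite in_itv/= => /andP[/ltW ax /ltW xb]; apply: fd; rewrite ax.
have [x xab ->] := MVT_segment ab fd' (is_derive_within fd).
rewrite ler_wpM2r ?subr_ge0//; apply: dfc.
by move: xab; rewrite in_itv.
Qed.

Lemma is_derive_le (f df : R -> R) a b c : a <= b ->
  (forall x, a <= x <= b -> is_derive x 1 f (df x)) ->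
  (forall x, a <= x <= b -> df x <= c) -> f b - f a <= c * (b - a).
Proof.
move=> ab fd dfc.
have fd' x : x \in `]a, b[%R -> is_derive x 1 f (df x).
  by rewrite in_itv/= => /andP[/ltW ax /ltW xb]; apply: fd; rewrite ax.
have [x xab ->] := MVT_segment ab fd' (is_derive_within fd).
rewrite ler_wpM2r ?subr_ge0//; apply: dfc.
by move: xab; rewrite in_itv.
Qed.

Lemma is_derive_lipschitz (f df : R -> R) a b C :
  (forall x, a < x -> is_derive x 1 f (df x)) ->
  (forall x, a < x -> `|df x| <= C) -> a < b ->
  forall c, a < c -> `|f b - f c| <= C * `|b - c|.
Proof.
move=> fd dC ab c ac.
wlog bc : b c ab ac / c <= b => [H|].
  have [/H->//|/ltW bc] := leP c b.
  by rewrite distrC [in leRHS]distrC H.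
have fd' x : c <= x <= b -> is_derive x 1 f (df x).
  by move=> /andP[cx _]; apply: fd; exact: lt_le_trans cx.
have dC' x : c <= x <= b -> - C <= df x <= C.
  by move=> /andP[cx _]; rewrite -ler_norml dC//; exact: lt_le_trans cx.
rewrite [X in _ * X]ger0_norm ?subr_ge0// ler_norml; apply/andP; split.
  by rewrite -mulNr; apply: is_derive_ge fd' _ => // x /dC' /andP[].
by apply: is_derive_le fd' _ => // x /dC' /andP[].
Qed.

Lemma is_derive_bigsum (I : Type) (s : seq I) (f : I -> R -> R) (df : I -> R) x :
  (forall i, is_derive x 1 (f i) (df i)) ->
  is_derive x 1 (fun t => \sum_(i <- s) f i t) (\sum_(i <- s) df i).
Proof.
move=> fd; elim: s => [|i s IH].
  by under eq_fun do rewrite big_nil; rewrite big_nil; exact: is_derive_cst.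
under eq_fun do rewrite big_cons.
by rewrite big_cons; apply: is_deriveD.
Qed.

Lemma is_derive_quadratic (u : R -> R) t v C e : 0 < e ->
  (forall h, `|h| < e -> `|u (t + h) - u t - h * v| <= C * h ^+ 2) ->
  is_derive t 1 u v.
Proof.
move=> e0 H; apply/is_derive1_caratheodory.
exists (fun z => if z == t then v else (u z - u t) / (z - t)); split.
- move=> z; case: eqP => [->|/eqP zt]; first by rewrite !subrr mulr0.
  by rewrite divfK// subr_eq0.
- have C0 : 0 <= C.
    have : `|e / 2| < e.
      by rewrite ger0_norm ?divr_ge0 1?ltW// ltr_pdivrMr// ltr_pMr// ltr1n.
    move=> /H /(le_trans (normr_ge0 _)).
    by rewrite pmulr_lge0// exprn_gt0// divr_gt0.
  apply/cvgrPdist_le => /= d d0; rewrite eqxx; near=> z.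
  case: eqP => [_|/eqP zt]; first by rewrite subrr normr0 ltW.
  have ze : `|z - t| < e by rewrite distrC; near: z; exists e.
  have zd : `|z - t| < d / (C + 1).
    rewrite distrC; near: z; exists (d / (C + 1)) => //=.
    by rewrite divr_gt0// ltr_wpDl.
  have := H _ ze; rewrite [t + (z - t)]addrC subrK => Hz.
  have zt0 : 0 < `|z - t| by rewrite normr_gt0 subr_eq0.
  rewrite -(ler_pM2l zt0) -normrM mulrBr mulrCA divff ?subr_eq0// mulr1.
  rewrite distrC (le_trans Hz)// -[_ ^+ 2]real_normK ?num_real// expr2 mulrCA.
  rewrite ler_wpM2l//.
  have := ltW zd; rewrite ler_pdivlMr ?ltr_wpDl// => zd'; apply: le_trans zd'.
  by rewrite mulrC mulrDr mulr1 lerDl.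
- by rewrite eqxx.
Unshelve. all: by end_near. Qed.

(* Equi-Lipschitz derivatives make the first-order Taylor remainder uniformly
   quadratic, hence stable under pointwise limits. *)
Lemma is_derive_limit (un vn : nat -> R -> R) (u v : R -> R) C t :
  (forall n x, 0 < x -> is_derive x 1 (un n) (vn n x)) ->
  (forall n x y, 0 < x -> 0 < y -> `|vn n x - vn n y| <= C * `|x - y|) ->
  (forall x, 0 < x -> un ^~ x @ \oo --> u x) ->
  (forall x, 0 < x -> vn ^~ x @ \oo --> v x) ->
  0 < t -> is_derive t 1 u (v t).
Proof.
move=> ud vL uu vv t0; apply: (@is_derive_quadratic _ _ _ C t) => // h ht.
have th0 : 0 < t + h.
  by move: ht; rewrite ltr_norml => /andP[ht _]; rewrite -ltrBlDl sub0r.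
have H n : `|un n (t + h) - un n t - h * vn n t| <= C * h ^+ 2.
  pose g x := un n x - x * vn n t.
  have gd x : 0 < x -> is_derive x 1 g (vn n x - vn n t).
    move=> x0; have := ud n x x0 => D.
    by apply: is_derive_eq; rewrite /GRing.scale/=; ring.
  have seg a b : 0 < a -> a <= b -> (forall x, a <= x <= b -> `|x - t| <= `|h|) ->
      `|g b - g a| <= C * `|h| * (b - a).
    move=> a0 ab Hx.
    have gd' x : a <= x <= b -> is_derive x 1 g (vn n x - vn n t).
      by move=> /andP[ax _]; apply: gd; exact: lt_le_trans ax.
    have C0 : 0 <= C.
      have := vL n 1 2 ltr01 (ltr0n _ _) => /(le_trans (normr_ge0 _)).
      by rewrite pmulr_lge0// normr_gt0; apply/eqP; lra.
    have B x : a <= x <= b -> - (C * `|h|) <= vn n x - vn n t <= C * `|h|.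
      move=> xab; rewrite -ler_norml (le_trans (vL _ _ _ _ _))//.
        by move: xab => /andP[ax _]; exact: lt_le_trans ax.
      by rewrite ler_wpM2l// Hx.
    rewrite ler_norml -mulNr; apply/andP; split.
      by apply: is_derive_ge gd' _ => // x /B /andP[].
    by apply: is_derive_le gd' _ => // x /B /andP[].
  have -> : un n (t + h) - un n t - h * vn n t = g (t + h) - g t by rewrite /g; ring.
  have [h0|h0] := leP 0 h.
    have := seg t (t + h) t0; rewrite lerDl => /(_ h0).
    rewrite addrC addrK (ger0_norm h0) -mulrA -expr2; apply.
    by move=> x /andP[tx xh]; rewrite ger0_norm; lra.
  have := seg (t + h) t th0; rewrite gerDl (ltW h0) => /(_ isT).
  rewrite distrC (ltr0_norm h0).
  rewrite (_ : C * - h * (t - (t + h)) = C * h ^+ 2); last by ring.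
  by apply => x /andP[tx xh]; rewrite ler0_norm; lra.
have L : `|un n (t + h) - un n t - h * vn n t| @[n --> \oo] -->
         `|u (t + h) - u t - h * v t|.
  apply: cvg_norm; apply: cvgB; first by apply: cvgB; exact: uu.
  by apply: cvgM; [exact: cvg_cst|exact: vv].
rewrite -(cvg_lim _ L)//; apply: limr_le; first by apply/cvg_ex; eexists; exact: L.
by near=> n; exact: H.
Unshelve. all: by end_near. Qed.

(* Each pass of length T improves an upper bound M to M * (1 - exp (-kT)). *)
Lemma maximum_principle (S : Type) (D : S -> Prop) (w dw : R -> S -> R) k M0 :
  (forall t s, 0 <= t -> D s -> is_derive t 1 (w ^~ s) (dw t s)) ->
  (forall t M, 0 <= t -> 0 <= M -> (forall s, D s -> w t s <= M) ->
     forall s, D s -> dw t s + k * w t s <= k * M) ->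
  (forall s, D s -> w 0 s <= 0) ->
  (forall t s, 0 <= t -> D s -> w t s <= M0) ->
  forall t s, 0 <= t -> D s -> w t s <= 0.
Proof.
move=> wd wle w0 wM0 T s T0 Ds.
pose q := 1 - expR (- (`|k| * T)).
have q01 : 0 <= q < 1.
  by rewrite /q subr_ge0 -expR0 ler_expR oppr_le0 mulr_ge0//= ltrBlDr expR0
             ltrDl expR_gt0.
pose M1 := Num.max M0 0.
have M10 : 0 <= M1 by rewrite /M1 le_max lexx orbT.
have step M : 0 <= M -> (forall t s, 0 <= t <= T -> D s -> w t s <= M) ->
    forall t s, 0 <= t <= T -> D s -> w t s <= M * q.
  move=> M_ge0 HM t u /andP[t0 tT] Du.
  (* Integrating factor: by [wle], [g] is nonincreasing as long as all [w] stay below [M], and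
     [g 0 <= - M]. *)
  pose g x := expR (k * x) * (w x u - M).
  have gd x : 0 <= x <= t ->
      is_derive x 1 g (expR (k * x) * (dw x u + k * w x u - k * M)).
    move=> /andP[x0 xt]; have Dw := wd x u x0 Du.
    by apply: is_derive_eq; rewrite /GRing.scale/=; ring.
  have := @is_derive_le g _ 0 t 0 t0 gd; rewrite mul0r subr_le0 => /(_ _).
  rewrite /g mulr0 expR0 mul1r => H0.
  have {H0}H : expR (k * t) * (w t u - M) <= w 0 u - M.
    apply: H0 => x /andP[x0 xt]; rewrite mulr_ge0_le0 ?expR_ge0// subr_le0.
    by apply: wle => // v Dv; apply: HM => //; rewrite x0 (le_trans xt).
  have {}H : expR (k * t) * (w t u - M) <= - M.
    by rewrite (le_trans H)// lerBlDr addNr w0.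
  have : w t u - M <= - M * expR (- (k * t)).
    by rewrite -(ler_pM2l (expR_gt0 (k * t))) mulrCA -expRD subrr expR0 mulr1.
  rewrite lerBlDl => /le_trans; apply.
  rewrite /q mulrBr mulr1 mulNr lerD2l lerN2 ler_wpM2l// ler_expR lerN2.
  by rewrite (le_trans (ler_norm _))// normrM (ger0_norm t0) ler_wpM2l.
have iter n : forall t s, 0 <= t <= T -> D s -> w t s <= M1 * q ^+ n.
  elim: n => [|n IH] t u tT Du.
    rewrite expr0 mulr1 /M1 le_max wM0//.
    by move: tT => /andP[].
  rewrite exprSr mulrA; apply: step => //.
  by rewrite mulr_ge0// exprn_ge0//; case/andP: q01.
have L : M1 * q ^+ n @[n --> \oo] --> (0 : R).
  rewrite -[X in _ --> X](mulr0 M1); apply: cvgM; first exact: cvg_cst.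
  by apply: cvg_expr; case/andP: q01 => q0 q1; rewrite ger0_norm.
rewrite -(cvg_lim _ L)//; apply: limr_ge; first by apply/cvg_ex; eexists; exact: L.
by near=> n; apply: iter => //; rewrite T0 lexx.
Unshelve. all: by end_near. Qed.

End RealTools.

(** * Semigroups of uniformized chains *)

Section Semigroup.
Variables (R : realType) (S : eqType) (moves : S -> seq S) (Lam : R).
Implicit Types (f g : S -> R) (s : S) (t c M : R).

Definition Qop f s : R :=
  \sum_(m <- moves s) f m / Lam + (1 - (size (moves s))%:R / Lam) * f s.

Definition sg t f s : R := pmean (Lam * t) (fun n => iter n Qop f s).

Definition gen f s : R := \sum_(m <- moves s) (f m - f s).

Lemma QnE n s s' : Qn moves Lam n s s' = iter n Qop (fun x => (x == s')%:R) s.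
Proof.
elim: n s => [//|n IH] s /=; rewrite /Qop IH; congr (_ + _).
by apply: eq_bigr => m _; rewrite IH.
Qed.

Lemma heatE t s s' : heat moves Lam t s s' = sg t (fun x => (x == s')%:R) s.
Proof. by rewrite /heat /sg /pmean; under eq_fun do rewrite QnE. Qed.

(** No single [Lam] bounds the rates of configurations with arbitrarily many particles. [D] is a
    class closed under the moves on which it does, typically the configurations of a given
    length. *)
Variable D : S -> Prop.
Hypothesis Dmoves : forall s m, D s -> m \in moves s -> D m.
Hypothesis Dsize : forall s, D s -> (size (moves s))%:R <= Lam.

Lemma rate_ge0 s : D s -> 0 <= Lam.
Proof. by move=> /Dsize; exact: le_trans. Qed.

Lemma Qop_ext f g s : D s -> (forall s, D s -> f s = g s) -> Qop f s = Qop g s.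
Proof.
move=> Ds fg; rewrite /Qop fg//; congr (_ + _).
by apply: eq_big_seq => m ms; rewrite fg//; exact: Dmoves ms.
Qed.

Lemma Qop_mono f g s : D s -> (forall s, D s -> f s <= g s) -> Qop f s <= Qop g s.
Proof.
move=> Ds fg; have L0 := rate_ge0 Ds; rewrite /Qop lerD//.
  rewrite big_seq [leRHS]big_seq; apply: ler_sum => m ms.
  by rewrite ler_wpM2r ?invr_ge0// fg//; exact: Dmoves ms.
rewrite ler_wpM2l// ?fg// subr_ge0.
have [->|L1] := eqVneq Lam 0; first by rewrite invr0 mulr0.
by rewrite ler_pdivrMr ?mul1r ?Dsize// lt_def L1.
Qed.

Lemma QopE f s : D s -> Lam * (Qop f s - f s) = gen f s.
Proof.
move=> Ds; rewrite /Qop /gen sumrB big_const_seq count_predT iter_addr_0.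
(* For [Lam = 0] the division returns 0, but then [Dsize] leaves no move out of [s] and both sides
   vanish. *)
have [L0|L0] := eqVneq Lam 0.
  have := Dsize Ds; rewrite L0 lern0 size_eq0 => /eqP ->.
  by rewrite !big_nil /= mulr0n subr0 mul0r.
rewrite -mulr_suml -[f s *+ _]mulr_natr; field.
exact: L0.
Qed.

Lemma Qop_cst c s : D s -> Qop (fun=> c) s = c.
Proof.
move=> Ds; have [L0|L0] := eqVneq Lam 0.
  have := Dsize Ds; rewrite L0 lern0 size_eq0 /Qop => /eqP ->.
  by rewrite !big_nil mul0r subr0 mul1r add0r.
rewrite /Qop -mulr_suml big_const_seq count_predT iter_addr_0 -[c *+ _]mulr_natr.
by field.
Qed.

Lemma QopDM f g c s : Qop (fun s => f s + c * g s) s = Qop f s + c * Qop g s.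
Proof.
rewrite /Qop [in RHS]mulrDr mulr_sumr addrACA -big_split /=; congr (_ + _); last by ring.
by apply: eq_bigr => m _; ring.
Qed.

Lemma iter_Qop_ext n f g s : D s -> (forall s, D s -> f s = g s) ->
  iter n Qop f s = iter n Qop g s.
Proof.
move=> + fg; elim: n s => [|n IH] s Ds /=; first exact: fg.
exact: Qop_ext.
Qed.

Lemma iter_Qop_mono n f g s : D s -> (forall s, D s -> f s <= g s) ->
  iter n Qop f s <= iter n Qop g s.
Proof.
move=> + fg; elim: n s => [|n IH] s Ds /=; first exact: fg.
exact: Qop_mono.
Qed.

Lemma iter_Qop_cst n c s : D s -> iter n Qop (fun=> c) s = c.
Proof.
elim: n s => [//|n IH] s Ds /=; rewrite -[RHS](Qop_cst c Ds).
exact: Qop_ext.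
Qed.

Lemma iter_QopDM n f g c s :
  iter n Qop (fun s => f s + c * g s) s = iter n Qop f s + c * iter n Qop g s.
Proof.
elim: n s => [//|n IH] s /=; rewrite -QopDM.
by congr Qop; apply/funext => u; exact: IH.
Qed.

Definition bounded_on f := exists M, forall s, D s -> `|f s| <= M.

Lemma bounded_on_lin f g c : bounded_on f -> bounded_on g ->
  bounded_on (fun s => f s + c * g s).
Proof.
move=> [M fM] [N gN]; exists (M + `|c| * N) => s Ds.
rewrite (le_trans (ler_normD _ _))// lerD ?fM// normrM ler_wpM2l//.
exact: gN.
Qed.

Lemma iter_Qop_le n f M s : D s -> (forall s, D s -> `|f s| <= M) ->
  `|iter n Qop f s| <= M.
Proof.
move=> Ds fM; rewrite ler_norml; apply/andP; split.
  rewrite -(iter_Qop_cst n (- M) Ds); apply: iter_Qop_mono => // u Du.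
  by have := fM u Du; rewrite ler_norml => /andP[].
rewrite -[leRHS](iter_Qop_cst n M Ds); apply: iter_Qop_mono => // u Du.
by have := fM u Du; rewrite ler_norml => /andP[].
Qed.

Lemma iter_Qop_growth f s : D s -> bounded_on f ->
  exp_growth (fun n => iter n Qop f s).
Proof.
by move=> Ds [M fM]; apply: (@bounded_growth _ M) => n; exact: iter_Qop_le.
Qed.

Lemma sg_ext t f g s : D s -> (forall s, D s -> f s = g s) -> sg t f s = sg t g s.
Proof.
by move=> Ds fg; congr pmean; apply/funext => n; exact: iter_Qop_ext.
Qed.

Lemma sg_mono t f g s : 0 <= t -> D s -> bounded_on f -> bounded_on g ->
  (forall s, D s -> f s <= g s) -> sg t f s <= sg t g s.
Proof.
move=> t0 Ds fb gb fg; apply: ler_pmean; [|exact: iter_Qop_growth..|].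
  by rewrite mulr_ge0// (rate_ge0 Ds).
by move=> n; exact: iter_Qop_mono.
Qed.

Lemma sg_le t f M s : 0 <= t -> D s -> (forall s, D s -> `|f s| <= M) ->
  `|sg t f s| <= M.
Proof.
move=> t0 Ds fM; apply: pmean_le => [|n]; last exact: iter_Qop_le.
by rewrite mulr_ge0// (rate_ge0 Ds).
Qed.

Lemma sgDM t f g c s : D s -> bounded_on f -> bounded_on g ->
  sg t (fun s => f s + c * g s) s = sg t f s + c * sg t g s.
Proof.
move=> Ds fb gb; rewrite /sg -pmeanDM; [|exact: iter_Qop_growth..].
by congr pmean; apply/funext => n; exact: iter_QopDM.
Qed.

Lemma sg_cst t c s : D s -> sg t (fun=> c) s = c.
Proof.
move=> Ds; rewrite /sg -[RHS](pmean_cst (Lam * t)).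
by congr pmean; apply/funext => n; exact: iter_Qop_cst.
Qed.

Lemma sg_ge0 t f s : 0 <= t -> D s -> bounded_on f ->
  (forall s, D s -> 0 <= f s) -> 0 <= sg t f s.
Proof.
move=> t0 Ds fb f0; rewrite -(sg_cst t 0 Ds).
by apply: sg_mono => //; exists 0 => u _; rewrite normr0.
Qed.

Lemma bounded_on_sum (I : Type) (r : seq I) (f : I -> S -> R) :
  (forall i, bounded_on (f i)) -> bounded_on (fun s => \sum_(i <- r) f i s).
Proof.
move=> fb; elim: r => [|i r IH].
  by exists 0 => s _; rewrite big_nil normr0.
have [M HM] := bounded_on_lin 1 (fb i) IH.
by exists M => s Ds; rewrite big_cons -[X in _ + X]mul1r HM.
Qed.

Lemma sg_sum (I : Type) (r : seq I) (f : I -> S -> R) t s : D s ->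
  (forall i, bounded_on (f i)) ->
  sg t (fun s => \sum_(i <- r) f i s) s = \sum_(i <- r) sg t (f i) s.
Proof.
move=> Ds fb; elim: r => [|i r IH].
  by rewrite big_nil -[RHS](sg_cst t 0 Ds); apply: sg_ext => // u _; rewrite big_nil.
rewrite big_cons -IH -[X in _ + X]mul1r -sgDM//; last exact: bounded_on_sum.
by apply: sg_ext => // u _; rewrite big_cons mul1r.
Qed.

Lemma sg0 f s : sg 0 f s = f s.
Proof. by rewrite /sg mulr0 pmean0. Qed.

Lemma is_derive_pmeanM (a : nat -> R) l t : exp_growth a ->
  is_derive t 1 (fun t => pmean (l * t) a)
    (l * (pmean (l * t) (fun n => a n.+1) - pmean (l * t) a)).
Proof.
move=> ag; have D1 : is_derive t 1 (fun t => l * t) l.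
  by apply: is_derive_eq; rewrite /GRing.scale/=; ring.
have := is_derive1_comp (is_derive_pmean (l * t) ag) D1.
by rewrite mulrC.
Qed.

Lemma is_derive_sg t f s : D s -> bounded_on f ->
  is_derive t 1 (fun t => sg t f s) (gen (sg t f) s).
Proof.
move=> Ds fb; have D1 := is_derive_pmeanM Lam t (iter_Qop_growth Ds fb).
apply: is_derive_eq D1 _; rewrite -QopE//; congr (_ * (_ - _)).
rewrite /Qop /sg.
have bg m : D m -> exp_growth (fun n => iter n Qop f m).
  by move=> Dm; exact: iter_Qop_growth.
(* Cut off outside [s] and its successors: [pmean_sum] wants the growth bound for every index, and
   it is available only on [D]. *)
pose F (m : S) n := if m \in s :: moves s then iter n Qop f m else 0.
have FE m : m \in s :: moves s -> F m = fun n => iter n Qop f m.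
  by move=> ms; apply/funext => n; rewrite /F ms.
have Fg m : exp_growth (F m).
  have [ms|/negbTE ms] := boolP (m \in s :: moves s).
    rewrite FE//; apply: bg; move: ms; rewrite inE => /predU1P[->//|].
    exact: Dmoves.
  by apply: (@bounded_growth _ 0) => n; rewrite /F ms normr0.
rewrite -(FE s) ?mem_head//.
rewrite (_ : (fun n => _) = fun n => \sum_(m <- moves s) (F m n) * Lam^-1 +
    (1 - (size (moves s))%:R / Lam) * F s n); last first.
  apply/funext => n; rewrite /= /Qop FE ?mem_head//; congr (_ + _).
  by apply: eq_big_seq => m ms; rewrite FE// inE ms orbT.
under eq_fun do rewrite -mulr_suml mulrC.
have gS : exp_growth (fun n => \sum_(m <- moves s) F m n) by exact: sum_growth.
rewrite pmeanDM//; last first.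
  have := lin_growth Lam^-1 (cst_growth 0) gS.
  by under eq_fun do rewrite add0r.
rewrite pmean_const_mul// pmean_sum// mulrC mulr_suml; congr (_ + _).
by apply: eq_big_seq => m ms; rewrite FE// inE ms orbT.
Qed.

(** Both sides are the derivative of the semigroup: on the left the additional jump is made first,
    and [iterSr] lets it be made last. This yields the forward equation. *)
Lemma gen_sg t f s : D s -> bounded_on f -> gen (sg t f) s = sg t (gen f) s.
Proof.
move=> Ds fb; have D1 := is_derive_sg t Ds fb.
have D2 := is_derive_pmeanM Lam t (iter_Qop_growth Ds fb).
have fg := iter_Qop_growth Ds fb.
have -> : gen (sg t f) s =
    Lam * (pmean (Lam * t) (fun n => iter n.+1 Qop f s) - sg t f s).
  by case: D1 D2 => _ <- [_ <-].
rewrite /sg mulrBr -!pmean_const_mul//; last exact: shift_growth fg.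
rewrite -mulN1r -pmean_const_mul; last first.
  by have := lin_growth Lam (cst_growth 0) fg; under eq_fun do rewrite add0r.
rewrite -pmeanD.
- congr pmean; apply/funext => n.
  rewrite mulN1r -mulrBr iterSr.
  rewrite (@iter_Qop_ext n (gen f) (fun s => 0 + Lam * (Qop f s + -1 * f s)))//.
    by rewrite iter_QopDM iter_Qop_cst// iter_QopDM; ring.
  by move=> u Du; rewrite add0r mulN1r QopE.
- have := lin_growth Lam (cst_growth 0) (shift_growth fg).
  by under eq_fun do rewrite add0r.
- have := lin_growth (- Lam) (cst_growth 0) fg.
  by under eq_fun do rewrite add0r mulNr -mulN1r.
Qed.

Lemma is_derive_sg' t f s : D s -> bounded_on f ->
  is_derive t 1 (fun t => sg t f s) (sg t (gen f) s).
Proof. by move=> Ds fb; rewrite -gen_sg//; exact: is_derive_sg. Qed.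

Lemma sg_dominated t (F : nat -> S -> R) f M s : 0 <= t -> D s ->
  (forall k s, D s -> `|F k s| <= M) ->
  (forall s, D s -> F ^~ s @ \oo --> f s) ->
  (fun k => sg t (F k) s) @ \oo --> sg t f s.
Proof.
move=> t0 Ds FM Ff; apply: (pmean_dominated (M := M)).
- by rewrite mulr_ge0// (rate_ge0 Ds).
- by move=> k n; apply: iter_Qop_le => // u Du; exact: FM.
- move=> n; elim: n s Ds => [|n IH] s Ds /=; first exact: Ff.
  rewrite /Qop; apply: cvgD; last first.
    by apply: cvgM; [exact: cvg_cst|exact: IH].
  apply: cvg_bigsum => m ms.
  by apply: cvgM; [apply: IH; exact: Dmoves ms|exact: cvg_cst].
Qed.

(** The maximum principle for [w t s - sg t f s] with [k = Lam]: the generator plus [Lam] is [Lam]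
    times the averaging operator [Qop], which preserves upper bounds. *)
Lemma sg_compare (w dw : R -> S -> R) f M t s :
  (forall t s, 0 <= t -> D s -> is_derive t 1 (w ^~ s) (dw t s)) ->
  (forall t s, 0 <= t -> D s -> dw t s <= gen (w t) s) ->
  (forall t s, 0 <= t -> D s -> `|w t s| <= M) ->
  (forall s, D s -> w 0 s <= f s) -> bounded_on f ->
  0 <= t -> D s -> w t s <= sg t f s.
Proof.
move=> wd wg wM w0 [N fN] t0 Ds; have fb : bounded_on f by exists N.
rewrite -subr_le0.
pose z t s := w t s - sg t f s.
apply: (@maximum_principle _ _ D z (fun t s => dw t s - gen (sg t f) s) Lam (M + N)
  _ _ _ _ t s) => //.
- move=> {t0}t u t0 Du; have D1 := wd t u t0 Du.
  by have D2 := is_derive_sg t Du fb; exact: is_deriveB.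
- move=> {t0}t K t0 K0 HK u Du.
  apply: (@le_trans _ _ (gen (z t) u + Lam * z t u)).
    rewrite lerD2r [leRHS](_ : _ = gen (w t) u - gen (sg t f) u).
      by rewrite lerD2r wg.
    by rewrite /gen -sumrB; apply: eq_bigr => m _; rewrite /z; ring.
  rewrite -QopE// -mulrDr subrK ler_wpM2l ?(rate_ge0 Du)//.
  by rewrite -[leRHS](Qop_cst K Du); exact: Qop_mono.
- by move=> u Du; rewrite /z sg0 subr_le0 w0.
- move=> {t0}t u t0 Du; rewrite /z (le_trans (ler_norm _))//.
  by rewrite (le_trans (ler_normB _ _))// lerD// ?wM//; exact: sg_le.
Qed.

(** As a function of [t], the left side solves the backward equation with initial value [sg u f], so
    comparison gives one inequality; applied to [- f] it gives the other. *)
Lemma sg_semigroup t u f s : 0 <= t -> 0 <= u -> D s -> bounded_on f ->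
  sg (t + u) f s = sg t (sg u f) s.
Proof.
move=> t0 u0 Ds [M fM].
have half g : (forall s, D s -> `|g s| <= M) -> sg (t + u) g s <= sg t (sg u g) s.
  move=> gM; have gb : bounded_on g by exists M.
  apply: (sg_compare (w := fun t => sg (t + u) g)
    (dw := fun t => gen (sg (t + u) g)) (M := M)) => //.
  - move=> x y x0 Dy; have := is_derive_sg (x + u) Dy gb => H.
    have H1 : is_derive x 1 (fun x => x + u) 1.
      by apply: is_derive_eq; rewrite addr0.
    by have := @is_derive1_comp _ (fun t => sg t g y) (fun x => x + u) x _ _ H H1; rewrite mulr1.
  - by move=> x y x0 Dy; apply: sg_le => //; rewrite addr_ge0.
  - by move=> y Dy; rewrite add0r.
  - by exists M => y Dy; exact: sg_le.
have opp v g y : D y -> bounded_on g -> sg v (fun s => - g s) y = - sg v g y.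
  move=> Dy gb; rewrite -[RHS]add0r -[in RHS](sg_cst v 0 Dy) -mulN1r -sgDM//.
    by apply: sg_ext => // z _; rewrite add0r mulN1r.
  by exists 0 => z _; rewrite normr0.
have fb : bounded_on f by exists M.
have sb : bounded_on (sg u f) by exists M => y Dy; exact: sg_le.
apply/eqP; rewrite eq_le half//= -lerN2 -!opp//.
rewrite -(@sg_ext t (sg u (fun s => - f s)))//; last by move=> y Dy; exact: opp.
by apply: half => y Dy; rewrite normrN fM.
Qed.

End Semigroup.

(** * Finite-dimensional laws on sets *)

Section CountableEnumeration.
Variable S : countType.

Definition enum_upto n : seq S := pmap (@pickle_inv S) (iota 0 n).

Lemma mem_enum_upto n s : (s \in enum_upto n) = (pickle s < n)%N.
Proof.
rewrite mem_pmap; apply/mapP/idP => [[k]|sn].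
  rewrite mem_iota add0n => /andP[_ kn] e.
  by have := @pickle_invK S k; rewrite /oapp -e => ->.
by exists (pickle s); rewrite ?mem_iota// pickleK_inv.
Qed.

Lemma enum_upto_uniq n : uniq (enum_upto n).
Proof. by apply: (pmap_uniq (@pickle_invK S)); exact: iota_uniq. Qed.

Lemma countable_cover (d : measure_display) (T : measurableType d)
    (f : S -> set T) :
  (forall s, measurable (f s)) -> measurable (\bigcup_(s in [set: S]) f s).
Proof.
move=> mf; rewrite (_ : \bigcup_(s in _) _ =
    \bigcup_n (if @unpickle S n is Some s then f s else set0)).
  by apply: bigcupT_measurable => n; case: unpickle.
apply/seteqP; split => [x [s _ fx]|x [n _]].
  by exists (pickle s) => //; rewrite pickleK.
by case: unpickle => // s fx; exists s.
Qed.

End CountableEnumeration.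

Section SetChains.
Variables (R : realType) (S : countType) (moves : S -> seq S) (Lam : R).
Variables (d : measure_display) (Omega : measurableType d).
Variables (P : probability Omega R) (init : seq S) (Y : R -> Omega -> S).
Hypothesis HY : is_ctmc moves Lam P init Y.
Variable D : S -> Prop.
Hypothesis Dmoves : forall s m, D s -> m \in moves s -> D m.
Hypothesis Dsize : forall s, D s -> (size (moves s))%:R <= Lam.
Hypothesis Dinit : forall s, s \in init -> D s.

Local Notation sg := (sg moves Lam).

Fixpoint set_chain (t0 : R) (s0 : S) (ts : seq (R * pred S)) : R :=
  match ts with
  | [::] => 1
  | (t, A) :: ts' =>
      sg (t - t0) (fun s => (A s)%:R * set_chain t s ts') s0
  end.

(** A hybrid of [chain_prob] and [set_chain]: exact states at the early times, sets at the later
    ones. The law is given for exact states only, and [mix_setE] moves one time after another from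
    the second kind to the first. *)
Fixpoint mix_chain (t0 : R) (s0 : S) (pre : seq (R * S))
    (ts : seq (R * pred S)) : R :=
  match pre with
  | [::] => set_chain t0 s0 ts
  | (t, s) :: pre' => heat moves Lam (t - t0) s0 s * mix_chain t s pre' ts
  end.

Lemma set_chain_le1 t0 s0 (ts : seq (R * pred S)) :
  path <=%R t0 [seq a.1 | a <- ts] -> D s0 -> `|set_chain t0 s0 ts| <= 1.
Proof.
elim: ts t0 s0 => [|[t A] ts IH] t0 s0 /=; first by rewrite normr1.
move=> /andP[t0t pts] Ds0; apply: (@sg_le _ _ _ _ D) => //.
  by rewrite subr_ge0.
move=> s Ds; rewrite normrM -[leRHS]mulr1 ler_pM//; last exact: IH.
by case: (A s); rewrite ?normr1 ?normr0.
Qed.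

Lemma bounded_indicator_chain t (A : pred S) (ts : seq (R * pred S)) :
  path <=%R t [seq a.1 | a <- ts] ->
  forall s, D s -> `|(A s)%:R * set_chain t s ts| <= 1.
Proof.
move=> pts s Ds; rewrite normrM -[leRHS]mulr1 ler_pM//; last exact: set_chain_le1.
by case: (A s); rewrite ?normr1 ?normr0.
Qed.

Lemma heat_eq0 t s0 s : D s0 -> ~ D s -> heat moves Lam t s0 s = 0.
Proof.
move=> Ds0 nDs; rewrite heatE -[RHS](sg_cst Dmoves Dsize t 0 Ds0).
apply: (sg_ext _ Dmoves) => // u Du; case: eqP => // us.
by rewrite us in Du.
Qed.

Lemma sum_mix_chain (l : seq S) t0 s0 pre t (ts : seq (R * pred S)) :
  uniq l -> path <=%R t [seq a.1 | a <- ts] -> D s0 ->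
  \sum_(s <- l) mix_chain t0 s0 (rcons pre (t, s)) ts =
  mix_chain t0 s0 pre ((t, mem l : pred S) :: ts).
Proof.
move=> ul pts; elim: pre t0 s0 => [|[t' s'] pre IH] t0 s0 Ds0 /=; last first.
  rewrite -mulr_sumr; have [Ds'|nDs'] := pselect (D s'); first by rewrite IH.
  by rewrite heat_eq0// !mul0r.
under eq_bigr do rewrite heatE.
have b1 s : bounded_on D (fun x => (x == s)%:R : R).
  by exists 1 => x _; case: eqP; rewrite ?normr1 ?normr0.
rewrite -(@sg_ext _ _ _ Lam _ Dmoves _
   (fun x => \sum_(s <- l) (0 + set_chain t s ts * (x == s)%:R))) => //.
- rewrite (sg_sum Dmoves Dsize)//.
    apply: eq_bigr => s _; rewrite (sgDM Dmoves Dsize)//.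
      by rewrite (sg_cst Dmoves Dsize)// add0r mulrC.
    by exists 0 => u _; rewrite normr0.
  move=> s; apply: bounded_on_lin => //.
  by exists 0 => u _; rewrite normr0.
- move=> u Du; have [ul'|ul'] := boolP (u \in l).
    rewrite (bigD1_seq u)//= eqxx mulr1 add0r big1 ?addr0 ?mul1r//.
    by move=> i /negbTE iu; rewrite eq_sym iu mulr0 addr0.
  rewrite mul0r big_seq big1// => i il; rewrite add0r.
  by case: eqP => [ui|_]; rewrite ?mulr0//; rewrite ui il in ul'.
Qed.

Lemma cvg_mix_chain (B : nat -> pred S) (A : pred S) t0 s0 pre t
    (ts : seq (R * pred S)) :
  (forall s, \forall n \near \oo, B n s = A s) ->
  path <=%R t0 ([seq a.1 | a <- pre] ++ t :: [seq a.1 | a <- ts]) -> D s0 ->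
  mix_chain t0 s0 pre ((t, B n) :: ts) @[n --> \oo] -->
  mix_chain t0 s0 pre ((t, A) :: ts).
Proof.
move=> BA; elim: pre t0 s0 => [|[t' s'] pre IH] t0 s0 /= /andP[t0t pts] Ds0; last first.
  have [Ds'|nDs'] := pselect (D s'); last first.
    by rewrite heat_eq0//; under eq_fun do rewrite mul0r; rewrite mul0r; exact: cvg_cst.
  by apply: cvgM; [exact: cvg_cst|exact: IH].
apply: (@sg_dominated _ _ _ _ _ Dmoves Dsize _ _ _ 1) => //.
- by rewrite subr_ge0.
- by move=> k s Ds; exact: bounded_indicator_chain.
- move=> s Ds; apply: cvgM; last exact: cvg_cst.
  apply: (@cvg_trans _ ((fun=> (A s)%:R : R) n @[n --> \oo])); last exact: cvg_cst.
  apply: near_eq_cvg.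
  by have := BA s; apply: filterS => n ->.
Qed.

Lemma measurable_at t (A : pred S) : measurable [set w | A (Y t w)].
Proof.
have [mY _ _] := HY.
rewrite (_ : mkset _ = \bigcup_(s in [set: S])
   (if A s then [set w | Y t w = s] else set0)).
  by apply: countable_cover => s; case: (A s) => //; exact: mY.
apply/seteqP; split => [w /= Aw|w [s _]]; first by exists (Y t w) => //; rewrite Aw.
by case: ifP => //= As YE; rewrite YE.
Qed.

Lemma measurable_all_at (ts : seq (R * pred S)) :
  measurable [set w | all (fun a => a.2 (Y a.1 w)) ts].
Proof.
elim: ts => [|[t A] ts IH]; first by rewrite (_ : mkset _ = setT)//; apply/seteqP.
rewrite (_ : mkset _ = [set w | A (Y t w)] `&`
   [set w | all (fun a => a.2 (Y a.1 w)) ts]).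
  by apply: measurableI => //; exact: measurable_at.
by apply/seteqP; split => w /=; [move=> /andP[]|move=> [-> ->]].
Qed.

Let mix_set (pre : seq (R * S)) (ts : seq (R * pred S)) : set Omega :=
  [set w | all (fun a => Y a.1 w == a.2) pre && all (fun a => a.2 (Y a.1 w)) ts].

Let measurable_mix_set pre ts : measurable (mix_set pre ts).
Proof.
have -> : mix_set pre ts = [set w | all (fun a => a.2 (Y a.1 w))
   ([seq (a.1, pred1 a.2 : pred S) | a <- pre] ++ ts)].
  by apply/seteqP; split => w /=; rewrite all_cat all_map.
exact: measurable_all_at.
Qed.

(** Induction on the set conditions. A finite set is a disjoint union of points, each handled by the
    induction hypothesis; an arbitrary set is the increasing union of its finite parts, and both
    sides pass to the limit. *)
Let mix_setE pre ts : sorted <%R ([seq a.1 | a <- pre] ++ [seq a.1 | a <- ts]) ->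
  path <=%R 0 ([seq a.1 | a <- pre] ++ [seq a.1 | a <- ts]) ->
  P (mix_set pre ts) =
  ((size init)%:R^-1 * \sum_(s0 <- init) mix_chain 0 s0 pre ts)%:E.
Proof.
elim: ts pre => [|[t A] ts IH] pre spre ppre.
  have [_ _ H] := HY.
  rewrite /mix_set; under eq_set do rewrite andbT.
  rewrite H.
  - congr (_ * _)%:E; apply: eq_bigr => s0 _.
    elim: (pre) (0 : R) s0 => [//|[t s] pre' IH'] t0 s0 /=.
    by rewrite IH'.
  - by move: spre; rewrite cats0 sorted_map.
  - move: ppre; rewrite cats0 => /(order_path_min le_trans).
    by rewrite all_map.
have single s : P (mix_set (rcons pre (t, s)) ts) =
  ((size init)%:R^-1 * \sum_(s0 <- init) mix_chain 0 s0 (rcons pre (t, s)) ts)%:E.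
  by apply: IH; rewrite map_rcons cat_rcons.
have pts : path <=%R t [seq a.1 | a <- ts].
  by move: ppre; rewrite cat_path /= => /and3P[].
have finite_case l : uniq l -> P (mix_set pre ((t, mem l : pred S) :: ts)) =
   ((size init)%:R^-1 * \sum_(s0 <- init) mix_chain 0 s0 pre ((t, mem l : pred S) :: ts))%:E.
  move=> ul; transitivity (\sum_(s <- l) P (mix_set (rcons pre (t, s)) ts))%E.
    elim: l ul => [|s l IHl] /=.
      rewrite big_nil (_ : mix_set _ _ = set0) ?measure0//.
      by apply/seteqP; split => w //=; rewrite /mix_set /= andbF.
    move=> /andP[sl ul]; rewrite big_cons -IHl// -measureU; [|exact: measurable_mix_set..|].
    - congr (P _); apply/seteqP; split => w; rewrite /mix_set /= all_rcons /= inE.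
        by move=> /and3P[-> /orP[->|->] ->]; [left|right].
      by move=> [/andP[/andP[-> ->] ->]|/and3P[-> -> ->]]//; rewrite orbT.
    - apply/seteqP; split => w //=; rewrite /mix_set /= all_rcons /=.
      by move=> [/andP[/andP[/eqP -> _] _]] /and3P[_ +]; rewrite (negbTE sl).
  under eq_bigr do rewrite single.
  rewrite sumEFin -mulr_sumr exchange_big /=; congr (_ * _)%:E.
  by apply: eq_big_seq => s0 /Dinit Ds0; exact: sum_mix_chain.
pose B n : pred S := mem [seq s <- enum_upto S n | A s].
have L1 : P (mix_set pre ((t, B n) :: ts)) @[n --> \oo] -->
          P (mix_set pre ((t, A) :: ts)).
  have -> : mix_set pre ((t, A) :: ts) = \bigcup_n mix_set pre ((t, B n) :: ts).
    apply/seteqP; split => w; rewrite /mix_set /=.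
      move=> /and3P[H1 H2 H3]; exists (pickle (Y t w)).+1 => //=.
      by rewrite H1 H3 /B /= mem_filter H2 mem_enum_upto ltnSn.
    by move=> [n _ /=]; rewrite /B /= mem_filter => /and3P[-> /andP[-> _] ->].
  apply: nondecreasing_cvg_mu => //; first exact: bigcupT_measurable.
  move=> n m nm; apply/subsetPset => w; rewrite /mix_set /= /B /= !mem_filter !mem_enum_upto.
  by move=> /and3P[-> /andP[-> h] ->]; rewrite (leq_trans h nm).
have L2 : P (mix_set pre ((t, B n) :: ts)) @[n --> \oo] -->
    ((size init)%:R^-1 * \sum_(s0 <- init) mix_chain 0 s0 pre ((t, A) :: ts))%:E.
  under eq_fun do rewrite finite_case ?filter_uniq ?enum_upto_uniq//.
  apply: cvg_EFin; first by apply: nearW.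
  apply: cvgM; first exact: cvg_cst.
  apply: cvg_bigsum => s0 /Dinit Ds0; apply: cvg_mix_chain => // s.
  exists (pickle s).+1 => // n /= ns.
  by rewrite /B /= mem_filter mem_enum_upto ns andbT.
exact: (cvg_unique _ L1 L2).
Qed.

Lemma prob_all_at (ts : seq (R * pred S)) : sorted <%R [seq a.1 | a <- ts] ->
  all (fun a => 0 <= a.1) ts ->
  P [set w | all (fun a => a.2 (Y a.1 w)) ts] =
  ((size init)%:R^-1 * \sum_(s0 <- init) set_chain 0 s0 ts)%:E.
Proof.
move=> sts ts0; rewrite -(@mix_setE [::])//.
case: ts sts ts0 => //= -[t A] ts /= pts /andP[t0 _].
rewrite t0 /=; apply: sub_path pts => x y; exact: ltW.
Qed.

Lemma prob_at t (A : pred S) : 0 <= t ->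
  P [set w | A (Y t w)] =
  ((size init)%:R^-1 * \sum_(s0 <- init) sg t (fun s => (A s)%:R) s0)%:E.
Proof.
move=> t0; have := @prob_all_at [:: (t, A)] isT; rewrite /= t0 => /(_ isT).
under eq_set do rewrite andbT.
move=> ->; congr (_ * _)%:E; apply: eq_bigr => s _; rewrite subr0.
by congr sg; apply/funext => u; rewrite mulr1.
Qed.

End SetChains.

(** * Negative correlation *)

Definition jump (V : eqType) (u w v : V) : V := if v == u then w else v.

Section CoupledMoves.
Variables (R : realType) (V : countType) (nb : V -> seq V) (r : nat).
Hypothesis nb_size : forall x, size (nb x) = r.
Implicit Types t c M : R.

Section StateSpace.
Variables (T : eqType) (act : (V -> V) -> T -> T) (supp : T -> seq V).

(** A coalescing jump is a map of [V], so it acts on any state built from vertices. This allows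
    several families to be driven by the same jumps. *)
Definition coupled_moves (x : T) : seq T :=
  flatten [seq [seq act (jump u w) x | w <- nb u] | u <- undup (supp x)].

Lemma gen_coupled (f : T -> R) x : gen coupled_moves f x =
  \sum_(u <- undup (supp x)) \sum_(w <- nb u) (f (act (jump u w) x) - f x).
Proof.
rewrite /gen big_flatten big_map; apply: eq_bigr => u _.
by rewrite big_map.
Qed.

Hypothesis act_id : forall u w x, u \notin supp x -> act (jump u w) x = x.

(** A jump from a site outside the support acts trivially, so extra sites contribute 0. Generators
    of families with different supports can thus be compared term by term over a common list [C]. *)
Lemma gen_coupled_ext (f : T -> R) x (C : seq V) :
  uniq C -> {subset supp x <= C} -> gen coupled_moves f x =
  \sum_(u <- C) \sum_(w <- nb u) (f (act (jump u w) x) - f x).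
Proof.
move=> uC sC; rewrite gen_coupled [RHS](bigID (mem (supp x)))/= -[X in _ = X + _]big_filter.
rewrite [X in _ = _ + X]big1 ?addr0; last first.
  by move=> u ux; rewrite big1// => w _; rewrite act_id// subrr.
apply: perm_big; apply: uniq_perm; rewrite ?undup_uniq ?filter_uniq// => u.
rewrite mem_undup mem_filter andb_idr//; exact: sC.
Qed.

Lemma size_coupled x : (size (coupled_moves x) <= size (supp x) * r)%N.
Proof.
apply: leq_trans (leq_mul (size_undup _) (leqnn _)).
rewrite /coupled_moves; elim: (undup _) => //= u s IH.
by rewrite size_cat size_map nb_size mulSn leq_add2l.
Qed.

Lemma coupled_movesP (D : T -> Prop) :
  (forall g x, D x -> D (act g x)) ->
  forall s m, D s -> m \in coupled_moves s -> D m.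
Proof.
by move=> Dact s m Ds /flatten_mapP[u _ /mapP[w _ ->]]; exact: Dact.
Qed.

End StateSpace.

Lemma map_jump_id u w (s : seq V) : u \notin s -> map (jump u w) s = s.
Proof.
move=> us; rewrite -[RHS]map_id; apply/eq_in_map => v vs.
by rewrite /jump; case: eqP => // vu; rewrite -vu vs in us.
Qed.

Lemma coal_movesE : coal_moves nb = coupled_moves (@map V V) id.
Proof. by []. Qed.

(** The uniformization rate is read off the configuration. It is constant along the evolution:
    merged particles remain in the list as equal entries, so the length never changes. *)
Definition csg t (f : seq V -> R) (s : seq V) : R :=
  sg (coal_moves nb) (size s * r)%:R t f s.

Let Dk k (s : seq V) : Prop := size s = k.

Lemma coal_size k s m : size s = k -> m \in coal_moves nb s -> size m = k.
Proof.
rewrite coal_movesE; move: s m; apply: (@coupled_movesP _ _ _ (Dk k)).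
by move=> g x; rewrite /Dk size_map.
Qed.

Lemma coal_rate k s : size s = k -> (size (coal_moves nb s))%:R <= (k * r)%:R :> R.
Proof. by move=> <-; rewrite ler_nat coal_movesE; exact: size_coupled. Qed.

Definition norm_bounded (f : seq V -> R) := exists M, forall s, `|f s| <= M.

Lemma norm_bounded_on f (D : seq V -> Prop) : norm_bounded f -> bounded_on D f.
Proof. by move=> [M fM]; exists M. Qed.

Lemma csgE k t f s : size s = k -> csg t f s = sg (coal_moves nb) (k * r)%:R t f s.
Proof. by move=> <-. Qed.

Lemma gen_csg k t f s : size s = k ->
  gen (coal_moves nb) (csg t f) s =
  gen (coal_moves nb) (sg (coal_moves nb) (k * r)%:R t f) s.
Proof.
move=> sk; apply: eq_big_seq => m ms.
by rewrite (csgE _ _ sk) (csgE _ _ (coal_size sk ms)).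
Qed.

Lemma is_derive_csg t f s : norm_bounded f ->
  is_derive t 1 (fun t => csg t f s) (gen (coal_moves nb) (csg t f) s).
Proof.
move=> fb; rewrite (gen_csg _ _ (erefl (size s))).
apply: (is_derive_sg (D := Dk (size s))) => //.
- by move=> ? ?; exact: coal_size.
- by move=> ?; exact: coal_rate.
- exact: norm_bounded_on.
Qed.

Lemma is_derive_csg' t f s : norm_bounded f ->
  is_derive t 1 (fun t => csg t f s) (csg t (gen (coal_moves nb) f) s).
Proof.
move=> fb; apply: (is_derive_sg' (D := Dk (size s))) => //.
- by move=> ? ?; exact: coal_size.
- by move=> ?; exact: coal_rate.
- exact: norm_bounded_on.
Qed.

Lemma csg_le t f M s : 0 <= t -> (forall s, `|f s| <= M) -> `|csg t f s| <= M.
Proof.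
move=> t0 fM; apply: (sg_le (D := Dk (size s))) => //.
- by move=> ? ?; exact: coal_size.
- by move=> ?; exact: coal_rate.
Qed.

Lemma csg_mono t f g s : 0 <= t -> norm_bounded f -> norm_bounded g ->
  (forall s, f s <= g s) -> csg t f s <= csg t g s.
Proof.
move=> t0 fb gb fg; apply: (sg_mono (D := Dk (size s))) => //.
- by move=> ? ?; exact: coal_size.
- by move=> ?; exact: coal_rate.
- exact: norm_bounded_on.
- exact: norm_bounded_on.
Qed.

Lemma csg_cst t c s : csg t (fun=> c) s = c.
Proof.
apply: (sg_cst (D := Dk (size s))) => //.
- by move=> ? ?; exact: coal_size.
- by move=> ?; exact: coal_rate.
Qed.

Lemma csgDM t f g c s : norm_bounded f -> norm_bounded g ->
  csg t (fun s => f s + c * g s) s = csg t f s + c * csg t g s.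
Proof.
move=> fb gb; apply: (sgDM (D := Dk (size s))) => //.
- by move=> ? ?; exact: coal_size.
- by move=> ?; exact: coal_rate.
- exact: norm_bounded_on.
- exact: norm_bounded_on.
Qed.

Lemma csgZ t f c s : norm_bounded f -> csg t (fun s => c * f s) s = c * csg t f s.
Proof.
move=> fb; have := csgDM t c s (_ : norm_bounded (fun=> 0)) fb.
rewrite csg_cst add0r => <-; last by exists 0 => ?; rewrite normr0.
by congr (csg _ _ _); apply/funext => u; rewrite add0r.
Qed.

Lemma csg_sum (I : Type) (l : seq I) (f : I -> seq V -> R) t s :
  (forall i, norm_bounded (f i)) ->
  csg t (fun s => \sum_(i <- l) f i s) s = \sum_(i <- l) csg t (f i) s.
Proof.
move=> fb; apply: (sg_sum (D := Dk (size s))) => //.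
- by move=> ? ?; exact: coal_size.
- by move=> ?; exact: coal_rate.
- by move=> i; exact: norm_bounded_on.
Qed.

Lemma csg0 f s : csg 0 f s = f s.
Proof. exact: sg0. Qed.

Definition occ (A s : seq V) : R := (all (mem s) A)%:R.

Lemma occ01 A s : 0 <= occ A s <= 1.
Proof. by rewrite /occ; case: all; rewrite ?lexx ?ler01. Qed.

Lemma occ_le1 A s : `|occ A s| <= 1.
Proof. by rewrite /occ; case: all; rewrite ?normr1 ?normr0. Qed.

Lemma bounded_occ A : norm_bounded (occ A).
Proof. by exists 1 => s; exact: occ_le1. Qed.

Section NegativeCorrelation.
Variables (z : V) (A : seq V).
Hypothesis zA : z \notin A.

Let pair_occ k (s : seq V) : R := occ [:: z] (take k s) * occ A (drop k s).

Let pair_occ_le1 k s : `|pair_occ k s| <= 1.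
Proof. by rewrite normrM -[leRHS]mulr1 ler_pM// occ_le1. Qed.

Let bounded_pair_occ k : norm_bounded (pair_occ k).
Proof. by exists 1 => s; exact: pair_occ_le1. Qed.

(* Two families driven by the same jumps: the joint probability that the first
   occupies [z] and the second occupies [A]. *)
Let psi t (s1 s2 : seq V) : R := csg t (pair_occ (size s1)) (s1 ++ s2).

Let psi0 s1 s2 : psi 0 s1 s2 = occ [:: z] s1 * occ A s2.
Proof. by rewrite /psi csg0 /pair_occ take_size_cat// drop_size_cat. Qed.

Let psi_le1 t s1 s2 : 0 <= t -> `|psi t s1 s2| <= 1.
Proof. by move=> t0; apply: csg_le => // s; exact: pair_occ_le1. Qed.

Let is_derive_psi t s1 s2 (C : seq V) : uniq C -> {subset s1 ++ s2 <= C} ->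
  is_derive t 1 (fun t => psi t s1 s2)
  (\sum_(u <- C) \sum_(w <- nb u)
     (psi t (map (jump u w) s1) (map (jump u w) s2) - psi t s1 s2)).
Proof.
move=> uC sC; have D1 := is_derive_csg t (s1 ++ s2) (bounded_pair_occ (size s1)).
apply: is_derive_eq D1 _; rewrite coal_movesE (gen_coupled_ext _ _ uC)//; last first.
  by move=> u w x; exact: map_jump_id.
apply: eq_bigr => u _; apply: eq_bigr => w _.
by rewrite /psi map_cat size_map.
Qed.

(** Two sites and two families with holes. Filling the holes of each family with either site gives
    four pairs of families, and [W] is the mixed second difference of [psi] over them. *)
Let state4 : eqType := (V * V * seq (option V) * seq (option V))%type.
Let act4 (g : V -> V) (x : state4) : state4 :=
  (g x.1.1.1, g x.1.1.2, map (omap g) x.1.2, map (omap g) x.2).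
Let supp4 (x : state4) : seq V :=
  x.1.1.1 :: x.1.1.2 :: pmap id x.1.2 ++ pmap id x.2.
Let fill (p : V) (l : seq (option V)) : seq V := map (odflt p) l.

Let fill_map g p l : fill (g p) (map (omap g) l) = map g (fill p l).
Proof. by rewrite /fill -!map_comp; apply: eq_map => -[]. Qed.

Let W t (x : state4) : R :=
  let: (p, q, l1, l2) := x in
  psi t (fill p l1) (fill p l2) - psi t (fill p l1) (fill q l2)
  - psi t (fill q l1) (fill p l2) + psi t (fill q l1) (fill q l2).

(** At time 0, [W] is a product of two differences of indicators. Filling with [p] instead of [q]
    can help to cover [z] only if [p = z], and to cover [A] only if [p] lies in [A]; as [z] is not
    in [A], the differences never have the same strict sign. *)
Let W0_le0 x : W 0 x <= 0.
Proof.
case: x => [[[p q] l1] l2]; rewrite /W !psi0.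
rewrite (_ : _ + _ = (occ [:: z] (fill p l1) - occ [:: z] (fill q l1)) *
             (occ A (fill p l2) - occ A (fill q l2))); last by ring.
have fillE a b l v : v != a -> v \in fill a l -> v \in fill b l.
  move=> va /mapP[[y|] yl e]; last by move: va; rewrite e /= eqxx.
  by apply/mapP; exists (Some y).
have H1 a b : z \in fill a l1 -> z \notin fill b l1 -> z = a.
  by move=> za zb; apply/eqP; apply: contraNT zb => /fillE; exact.
have H2 a b : all (mem (fill a l2)) A -> ~~ all (mem (fill b l2)) A -> a \in A.
  move=> /allP aA /allPn[y yA yb]; have ya := aA y yA.
  suff -> : a = y by [].
  by apply/eqP; rewrite eq_sym; apply: contraNT yb => /fillE; exact.
rewrite /occ /= !andbT.
case zp: (z \in fill p l1); case zq: (z \in fill q l1);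
  rewrite ?subrr ?mul0r//.
- case Ap: (all _ A); case Aq: (all _ A); rewrite ?subrr ?mulr0//.
    have := H2 _ _ Ap (negbT Aq); have := H1 _ _ zp (negbT zq) => <-.
    by rewrite (negbTE zA).
  by rewrite subr0 mul1r sub0r oppr_le0.
- case Ap: (all _ A); case Aq: (all _ A); rewrite ?subrr ?mulr0//.
    by rewrite subr0 mulr1 sub0r oppr_le0.
  have := H2 _ _ Aq (negbT Ap); have := H1 _ _ zq (negbT zp) => <-.
  by rewrite (negbTE zA).
Qed.

Let mem_fill a l v : v \in fill a l -> v \in a :: pmap id l.
Proof.
move=> /mapP[[y|] yl ->]; rewrite inE ?eqxx// mem_pmap.
by apply/orP; right; apply/mapP; exists (Some y).
Qed.

(** The four terms of [W] undergo the same jumps, so [W] solves the backward equation on [state4]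
    exactly and its sign at time 0 persists. *)
Let W_le0 t x : 0 <= t -> W t x <= 0.
Proof.
move=> t0; pose k1 := size x.1.2; pose k2 := size x.2.
pose D (y : state4) := size y.1.2 = k1 /\ size y.2 = k2.
pose mv := coupled_moves act4 supp4.
have Dmv : forall s m, D s -> m \in mv s -> D m.
  by apply: coupled_movesP => g [[[p q] l1] l2]; rewrite /D /= !size_map.
have Dsz s : D s -> (size (mv s))%:R <= ((2 + k1 + k2) * r)%:R :> R.
  move=> [s1 s2]; rewrite ler_nat (leq_trans (size_coupled _ _ _))//.
  rewrite leq_mul2r; apply/orP; right; rewrite /supp4 /= size_cat -s1 -s2.
  by rewrite !addSn add0n !ltnS leq_add// size_pmap count_size.
rewrite -(sg_cst Dmv Dsz t 0 (conj erefl erefl : D x)).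
apply: (sg_compare Dmv Dsz (w := W) (dw := fun t => gen mv (W t)) (M := 4)) => //.
- move=> {t0}t [[[p q] l1] l2] t0 _; rewrite gen_coupled.
  set C := undup _.
  have uC : uniq C by exact: undup_uniq.
  have sC a b : a \in [:: p; q] -> b \in [:: p; q] ->
      {subset fill a l1 ++ fill b l2 <= C}.
    move=> ha hb v; rewrite mem_undup /supp4 /= mem_cat => /orP[] /mem_fill.
      rewrite !inE => /predU1P[->|vl]; last by rewrite mem_cat vl !orbT.
      by move: ha; rewrite !inE => /orP[]->; rewrite ?orbT.
    rewrite !inE => /predU1P[->|vl]; last by rewrite mem_cat vl !orbT.
    by move: hb; rewrite !inE => /orP[]->; rewrite ?orbT.
  have hp : p \in [:: p; q] by rewrite mem_head.
  have hq : q \in [:: p; q] by rewrite !inE eqxx orbT.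
  have D1 := is_derive_psi t uC (sC _ _ hp hp).
  have D2 := is_derive_psi t uC (sC _ _ hp hq).
  have D3 := is_derive_psi t uC (sC _ _ hq hp).
  have D4 := is_derive_psi t uC (sC _ _ hq hq).
  have D5 := is_deriveD (is_deriveB (is_deriveB D1 D2) D3) D4.
  apply: is_derive_eq D5 _; rewrite -!sumrB -big_split /=.
  apply: eq_bigr => u _; rewrite -!sumrB -big_split /=.
  by apply: eq_bigr => w _; rewrite /W /= !fill_map; ring.
- move=> {t0}t [[[p q] l1] l2] t0 _; rewrite /W.
  rewrite (le_trans (ler_normD _ _))// (_ : 4 = 1 + 1 + 1 + 1)//; last by ring.
  rewrite lerD ?psi_le1// (le_trans (ler_normB _ _))// lerD ?psi_le1//.
  by rewrite (le_trans (ler_normB _ _))// lerD ?psi_le1.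
- by exists 0 => y _; rewrite normr0.
Qed.

(** This is [W <= 0] with [p = w], [q = u] and the holes at the particles sitting on [u]: a common
    jump of both families gains no more than the two separate jumps together. *)
Let psi_jump t u w s1 s2 : 0 <= t ->
  psi t (map (jump u w) s1) (map (jump u w) s2) - psi t s1 s2 <=
  (psi t (map (jump u w) s1) s2 - psi t s1 s2) +
  (psi t s1 (map (jump u w) s2) - psi t s1 s2).
Proof.
move=> t0; pose mark (s : seq V) := [seq if v == u then None else Some v | v <- s].
have E1 s : fill w (mark s) = map (jump u w) s.
  by rewrite /fill /mark -map_comp; apply: eq_map => v /=; rewrite /jump; case: eqP.
have E2 s : fill u (mark s) = s.
  rewrite /fill /mark -map_comp -[RHS]map_id; apply: eq_map => v /=.
  by case: eqP.
have := W_le0 (w, u, mark s1, mark s2) t0; rewrite /W !E1 !E2.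
by move=> H; lra.
Qed.

Let ind_moves (x : seq V * seq V) : seq (seq V * seq V) :=
  [seq (m, x.2) | m <- coal_moves nb x.1] ++ [seq (x.1, m) | m <- coal_moves nb x.2].

(** The product of the two probabilities solves the backward equation of [ind_moves], where the
    families jump separately; by [psi_jump], [psi] is a subsolution of it with the same initial
    value. *)
Let psi_le_product t s1 s2 : 0 <= t ->
  psi t s1 s2 <= csg t (occ [:: z]) s1 * csg t (occ A) s2.
Proof.
move=> t0; rewrite -subr_le0; pose k1 := size s1; pose k2 := size s2.
pose D (y : seq V * seq V) := size y.1 = k1 /\ size y.2 = k2.
have Dmv : forall s m, D s -> m \in ind_moves s -> D m.
  move=> [a b] m [/= ha hb]; rewrite mem_cat => /orP[] /mapP[y ym ->]; split => //=.
    exact: coal_size ym.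
  exact: coal_size ym.
have Dsz s : D s -> (size (ind_moves s))%:R <= ((k1 + k2) * r)%:R :> R.
  move=> [ha hb]; rewrite size_cat !size_map natrD mulnDl natrD lerD//.
    exact: coal_rate.
  exact: coal_rate.
pose w t (x : seq V * seq V) :=
  psi t x.1 x.2 - csg t (occ [:: z]) x.1 * csg t (occ A) x.2.
pose dw t (x : seq V * seq V) :=
  (\sum_(u <- undup (x.1 ++ x.2)) \sum_(w <- nb u)
     (psi t (map (jump u w) x.1) (map (jump u w) x.2) - psi t x.1 x.2)) -
  (gen (coal_moves nb) (csg t (occ [:: z])) x.1 * csg t (occ A) x.2 +
   csg t (occ [:: z]) x.1 * gen (coal_moves nb) (csg t (occ A)) x.2).
rewrite -[leRHS](sg_cst Dmv Dsz t 0 (conj erefl erefl : D (s1, s2))).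
rewrite -[leLHS]/(w t (s1, s2)).
apply: (sg_compare Dmv Dsz (dw := dw) (M := 1 + 1)) => //.
- move=> {t0}t [a b] t0 _.
  have uC : uniq (undup (a ++ b)) by exact: undup_uniq.
  have sC : {subset a ++ b <= undup (a ++ b)} by move=> v; rewrite mem_undup.
  have D1 := is_derive_psi t uC sC.
  have D2 := is_derive_csg t a (bounded_occ [:: z]).
  have D3 := is_derive_csg t b (bounded_occ A).
  apply: is_derive_eq (is_deriveB D1 (is_deriveM D2 D3)) _.
  by rewrite /dw /GRing.scale /=; ring.
- move=> {t0}t [a b] t0 _; rewrite /dw /=.
  have -> : gen ind_moves (w t) (a, b) =
     gen (coal_moves nb) (fun m => psi t m b) a +
     gen (coal_moves nb) (fun m => psi t a m) b -
     (gen (coal_moves nb) (csg t (occ [:: z])) a * csg t (occ A) b +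
      csg t (occ [:: z]) a * gen (coal_moves nb) (csg t (occ A)) b).
    have E1 : \sum_(m <- coal_moves nb a) (w t (m, b) - w t (a, b)) =
        gen (coal_moves nb) (fun m => psi t m b) a -
        gen (coal_moves nb) (csg t (occ [:: z])) a * csg t (occ A) b.
      by rewrite /gen mulr_suml -sumrB; apply: eq_bigr => m _; rewrite /w /=; ring.
    have E2 : \sum_(m <- coal_moves nb b) (w t (a, m) - w t (a, b)) =
        gen (coal_moves nb) (fun m => psi t a m) b -
        csg t (occ [:: z]) a * gen (coal_moves nb) (csg t (occ A)) b.
      by rewrite /gen mulr_sumr -sumrB; apply: eq_bigr => m _; rewrite /w /=; ring.
    by rewrite {1}/gen big_cat !big_map /= E1 E2; ring.
  rewrite lerD2r !coal_movesE.
  have uC : uniq (undup (a ++ b)) by exact: undup_uniq.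
  have sa : {subset a <= undup (a ++ b)} by move=> v; rewrite mem_undup mem_cat => ->.
  have sb : {subset b <= undup (a ++ b)}.
    by move=> v; rewrite mem_undup mem_cat => ->; rewrite orbT.
  have aid u v (x : seq V) : u \notin x -> map (jump u v) x = x by exact: map_jump_id.
  rewrite (gen_coupled_ext aid _ uC sa) (gen_coupled_ext aid _ uC sb).
  rewrite -big_split /=; apply: ler_sum => u _.
  by rewrite -big_split /=; apply: ler_sum => v _; exact: psi_jump.
- move=> {t0}t [a b] t0 _; rewrite /w /=.
  rewrite (le_trans (ler_normB _ _))//.
  apply: lerD; first exact: psi_le1.
  rewrite normrM -[leRHS]mulr1 ler_pM//.
    by apply: csg_le => // s; exact: occ_le1.
  by apply: csg_le => // s; exact: occ_le1.
- by move=> [a b] _; rewrite /w /= psi0 !csg0 subrr.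
- by exists 0 => y _; rewrite normr0.
Qed.

(** Two copies of [s] under common jumps stay equal, so [psi t s s] has the equation and the initial
    value of the left side. *)
Let csg_occ_le_psi t s : 0 <= t -> csg t (occ (z :: A)) s <= psi t s s.
Proof.
move=> t0; rewrite -subr_le0.
have Dmv s' m : Dk (size s) s' -> m \in coal_moves nb s' -> Dk (size s) m.
  exact: coal_size.
have Dsz s' : Dk (size s) s' -> (size (coal_moves nb s'))%:R <= (size s * r)%:R :> R.
  exact: coal_rate.
rewrite -[leRHS](sg_cst Dmv Dsz t 0 (erefl : Dk (size s) s)).
pose w t (x : seq V) := csg t (occ (z :: A)) x - psi t x x.
rewrite -[leLHS]/(w t s).
apply: (sg_compare Dmv Dsz (dw := fun t => gen (coal_moves nb) (w t))
   (M := 1 + 1)) => //.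
- move=> {t0}t x t0 _.
  have D1 := is_derive_csg t x (bounded_occ (z :: A)).
  have uC := undup_uniq x.
  have sC : {subset x ++ x <= undup x}.
    by move=> v; rewrite mem_undup mem_cat orbb.
  have D2 := is_derive_psi t uC sC.
  apply: is_derive_eq (is_deriveB D1 D2) _.
  rewrite coal_movesE !gen_coupled -sumrB; apply: eq_bigr => u _.
  by rewrite -sumrB; apply: eq_bigr => v _; rewrite /w; ring.
- move=> {t0}t x t0 _; rewrite /w (le_trans (ler_normB _ _))//.
  apply: lerD; last exact: psi_le1.
  by apply: csg_le => // u; exact: occ_le1.
- move=> x _; rewrite /w psi0 csg0 /occ /= andbT.
  by case: (z \in x); case: (all _ _); rewrite ?(mul0r, mulr0, mul1r) subrr.
- by exists 0 => y _; rewrite normr0.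
Qed.

Lemma negative_correlation t s : 0 <= t ->
  csg t (occ (z :: A)) s <= csg t (occ [:: z]) s * csg t (occ A) s.
Proof.
move=> t0; exact: le_trans (csg_occ_le_psi s t0) (psi_le_product s s t0).
Qed.

End NegativeCorrelation.
End CoupledMoves.

(** * Generator of the occupation indicators *)

Section OccupationHierarchy.
Variables (R : realType) (V : countType) (nb : V -> seq V) (r : nat).
Hypothesis nb_size : forall x, size (nb x) = r.
Hypothesis nb_simple : simple_graph nb.
Implicit Types (s A : seq V) (x y u w : V).

Local Notation occ := (@occ R V).
Local Notation coal_gen := (gen (coal_moves nb)).
Local Notation csg := (@csg R V nb r).

Let nb_sym x y : (y \in nb x) = (x \in nb y).
Proof. by case: nb_simple. Qed.

Let nb_irr x : x \notin nb x.
Proof. by case: nb_simple. Qed.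

Let nb_uniq x : uniq (nb x).
Proof. by case: nb_simple. Qed.

Lemma sum_nb_eq u x (c : R) :
  \sum_(w <- nb u) (w == x)%:R * c = (u \in nb x)%:R * c.
Proof.
rewrite -nb_sym; have [xu|xu] := boolP (x \in nb u).
  rewrite (bigD1_seq x)//= eqxx big1 ?addr0// => w /negbTE ->.
  by rewrite mul0r.
rewrite mul0r big_seq big1// => w wu; case: eqP => [wx|]; last by rewrite mul0r.
by rewrite -wx wu in xu.
Qed.

Lemma sum_jumps_to s x (c : V -> R) :
  \sum_(u <- undup s) \sum_(w <- nb u) (w == x)%:R * c u =
  \sum_(u <- nb x) (u \in s)%:R * c u.
Proof.
under eq_bigr do rewrite sum_nb_eq.
transitivity (\sum_(u <- [seq u <- undup s | u \in nb x]) c u).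
  rewrite big_filter [RHS]big_mkcond; apply: eq_bigr => u _.
  by case: ifP; rewrite ?mul1r ?mul0r.
transitivity (\sum_(u <- [seq u <- nb x | u \in s]) c u).
  apply: perm_big; apply: uniq_perm; rewrite ?filter_uniq ?undup_uniq// => u.
  by rewrite !mem_filter mem_undup andbC.
rewrite big_filter big_mkcond; apply: eq_bigr => u _.
by case: ifP; rewrite ?mul1r ?mul0r.
Qed.

Lemma sum_jumps_from s x (c : R) :
  \sum_(u <- undup s) \sum_(w <- nb u) (u == x)%:R * c =
  r%:R * (x \in s)%:R * c.
Proof.
under eq_bigr do rewrite big_const_seq count_predT iter_addr_0 nb_size.
have [xs|xs] := boolP (x \in s).
  rewrite (bigD1_seq x)/= ?undup_uniq ?mem_undup// eqxx big1.
    by rewrite addr0 !mulr1 mul1r mulr_natl.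
  by move=> u /negbTE ->; rewrite mul0r mul0rn.
rewrite big_seq big1 ?mulr0 ?mul0r// => u; rewrite mem_undup => us.
by case: eqP => [ux|]; [rewrite -ux us in xs|rewrite mul0r mul0rn].
Qed.

Lemma mem_map_jump u w x s : u \in s -> w != u ->
  (x \in map (jump u w) s) = (w == x) || ((x \in s) && (x != u)).
Proof.
move=> us wu; apply/mapP/orP => [[v vs ->]|[/eqP <-|/andP[xs xu]]].
- by rewrite /jump; have [_|vu] := eqVneq v u; [left|right; rewrite vs].
- by exists u => //; rewrite /jump eqxx.
- by exists x => //; rewrite /jump (negbTE xu).
Qed.

Lemma gen_coalE (f : seq V -> R) s : coal_gen f s =
  \sum_(u <- undup s) \sum_(w <- nb u) (f (map (jump u w) s) - f s).
Proof. by rewrite coal_movesE gen_coupled. Qed.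

Lemma eq_jump_sum s (f g : V -> V -> R) :
  (forall u w, u \in s -> w \in nb u -> w != u -> f u w = g u w) ->
  \sum_(u <- undup s) \sum_(w <- nb u) f u w =
  \sum_(u <- undup s) \sum_(w <- nb u) g u w.
Proof.
move=> fg; apply: eq_big_seq => u; rewrite mem_undup => us.
apply: eq_big_seq => w wu; apply: fg => //.
by apply: contraTneq wu => ->; exact: nb_irr.
Qed.

(** Gain: a neighbour jumps to [x] while [x] is empty. Loss: [x] jumps away, at rate [r], written as
    one term per neighbour so that the one-point terms will cancel once densities do not depend on
    the site. *)
Lemma gen_occ1 x s : coal_gen (occ [:: x]) s =
  \sum_(z <- nb x) (occ [:: z] s - occ [:: z; x] s - occ [:: x] s).
Proof.
rewrite gen_coalE; pose a : R := (x \in s)%:R.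
transitivity (\sum_(u <- undup s) \sum_(w <- nb u)
    ((w == x)%:R * (1 - a) - (u == x)%:R * 1)).
  apply: eq_jump_sum => u w us wu wNu; rewrite /occ /= !andbT mem_map_jump// /a.
  have [ux|ux] := eqVneq u x.
    by rewrite -ux us (negbTE wNu) /=; ring.
  by rewrite andbT; case: (w == x); case: (x \in s) => /=; ring.
under eq_bigr do rewrite sumrB.
rewrite sumrB (sum_jumps_to _ _ (fun=> 1 - a)) sum_jumps_from mulr1.
rewrite (_ : r%:R * _ = \sum_(z <- nb x) a); last first.
  by rewrite big_const_seq count_predT iter_addr_0 nb_size mulr_natl.
rewrite -sumrB; apply: eq_bigr => z _; rewrite /occ /= !andbT -mulnb natrM -/a; ring.
Qed.

(** The factor [u != y] is there because a jump from [y] to [x] vacates [y]. The three-point terms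
    discount jumps onto an occupied site; the site that stays put is listed first, ready to be split
    off by negative correlation. *)
Lemma gen_occ2 x y s : x != y -> coal_gen (occ [:: x; y]) s =
  \sum_(u <- nb x) (u != y)%:R * (occ [:: u; y] s - occ [:: y; u; x] s) +
  \sum_(u <- nb y) (u != x)%:R * (occ [:: x; u] s - occ [:: x; u; y] s) -
  2 * r%:R * occ [:: x; y] s.
Proof.
move=> xy; rewrite gen_coalE; pose a : R := (x \in s)%:R; pose b : R := (y \in s)%:R.
transitivity (\sum_(u <- undup s) \sum_(w <- nb u)
    (((w == x)%:R * ((u != y)%:R * (b * (1 - a))) +
     (w == y)%:R * ((u != x)%:R * (a * (1 - b)))) -
     ((u == x)%:R * (a * b) + (u == y)%:R * (a * b)))).
  apply: eq_jump_sum => u w us wu wNu; rewrite /occ /= !andbT !mem_map_jump// /a /b.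
  have [ux|ux] := eqVneq u x.
    rewrite ux in us wNu *; rewrite us (negbTE wNu) (eq_sym y x) (negbTE xy) /=.
    by case: (w == y); case: (y \in s) => /=; ring.
  have [uy|uy] := eqVneq u y.
    rewrite uy in us wNu *; rewrite us (negbTE wNu) /= ?andbT ?andbF.
    by case: (w == x); case: (x \in s) => /=; ring.
  rewrite !andbT /=.
  have [wx|wx] := eqVneq w x; last first.
    by case: (w == y); case: (x \in s); case: (y \in s) => /=; ring.
  rewrite wx (negbTE xy).
  by case: (x \in s); case: (y \in s) => /=; ring.
under eq_bigr do rewrite sumrB !big_split /=.
rewrite sumrB !big_split /= (sum_jumps_to _ x (fun u => (u != y)%:R * (b * (1 - a)))).
rewrite (sum_jumps_to _ y (fun u => (u != x)%:R * (a * (1 - b)))) !sum_jumps_from.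
have ab : occ [:: x; y] s = a * b by rewrite /occ /= andbT -mulnb natrM.
congr (_ + _ - _).
- apply: eq_bigr => u _; rewrite /occ /= !andbT.
  by rewrite -!mulnb !natrM -/a -/b; ring.
- apply: eq_bigr => u _; rewrite /occ /= !andbT.
  by rewrite -!mulnb !natrM -/a -/b; ring.
- by rewrite ab /a /b; case: (x \in s); case: (y \in s) => /=; ring.
Qed.

(** Only jumps into or out of a site of [A] matter, at most [r] of each per site, however many
    particles [s] contains. This uniformity is what permits the infinite limit. *)
Lemma gen_occ_le A s : `|coal_gen (occ A) s| <= 2 * r%:R * (size A)%:R.
Proof.
rewrite gen_coalE.
pose g u w : R := \sum_(x <- A) ((w == x)%:R * 1 + (u == x)%:R * 1).
have g0 u w : 0 <= g u w.
  by apply: sumr_ge0 => x _; rewrite addr_ge0// mulr1.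
apply: (@le_trans _ _ (\sum_(u <- undup s) \sum_(w <- nb u) g u w)).
  rewrite (le_trans (ler_norm_sum _ _ _))// big_seq [leRHS]big_seq.
  apply: ler_sum => u; rewrite mem_undup => us.
  rewrite (le_trans (ler_norm_sum _ _ _))// big_seq [leRHS]big_seq.
  apply: ler_sum => w wu.
  have wNu : w != u by apply: contraTneq wu => ->; exact: nb_irr.
  have [/hasP[x xA xuw]|/hasPn h] := boolP (has (fun x => (w == x) || (u == x)) A).
    apply: (@le_trans _ _ 1).
      by rewrite /occ; case: all; case: all;
        rewrite ?subrr ?subr0 ?sub0r ?normrN ?normr1 ?normr0.
    rewrite /g (perm_big _ (perm_to_rem xA)) big_cons /= -[leLHS]addr0 lerD//.
      by rewrite !mulr1; case/orP: xuw => ->; rewrite ?lerDl ?lerDr.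
    by apply: sumr_ge0 => y _; rewrite addr_ge0// mulr1.
  rewrite (_ : occ A (map (jump u w) s) = occ A s) ?subrr ?normr0//.
  congr (nat_of_bool _)%:R; apply: eq_in_all => x /h; rewrite negb_or => /andP[wx ux].
  by rewrite [LHS]mem_map_jump// (negbTE wx) /= eq_sym ux andbT.
rewrite /g; under eq_bigr do rewrite exchange_big /=.
rewrite exchange_big /=.
apply: (@le_trans _ _ (\sum_(x <- A) (2 * r%:R))).
  apply: ler_sum => x _; under eq_bigr do rewrite big_split /=.
  rewrite big_split /= (sum_jumps_to _ _ (fun=> 1)) sum_jumps_from mulr1.
  rewrite (_ : 2 * r%:R = r%:R + r%:R); last by ring.
  apply: lerD.
    apply: (@le_trans _ _ (\sum_(u <- nb x) 1)).
      by apply: ler_sum => u _; rewrite mulr1; case: (u \in s).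
    by rewrite big_const_seq count_predT iter_addr_0 nb_size.
  by case: (x \in s); rewrite ?mulr1 ?mulr0.
by rewrite big_const_seq count_predT iter_addr_0 -[leLHS]mulr_natr.
Qed.

Lemma csg_occ_lipschitz A s (t t' : R) : 0 < t -> 0 < t' ->
  `|csg t (occ A) s - csg t' (occ A) s| <= 2 * r%:R * (size A)%:R * `|t - t'|.
Proof.
move=> t0 t0'; apply: (is_derive_lipschitz (a := 0)
  (f := fun t => csg t (occ A) s) (df := fun t => csg t (coal_gen (occ A)) s)) => //.
- move=> x _; apply: is_derive_csg' => //; exact: bounded_occ.
- move=> x x0; apply: csg_le => //; first exact: ltW.
  exact: gen_occ_le.
Qed.

(** * Invariance under automorphisms *)

Section Automorphism.
Variable phi : V -> V.
Hypothesis phi_aut : is_aut nb phi.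

Let phi_inj : injective phi.
Proof. by have [/bij_inj] := phi_aut. Qed.

Lemma perm_nb_aut x : perm_eq (nb (phi x)) (map phi (nb x)).
Proof.
have [[psi psiK phiK] adj] := phi_aut.
apply: uniq_perm; rewrite ?map_inj_uniq// => y.
rewrite -(phiK y) adj mem_map//.
Qed.

Lemma perm_coal_moves_aut s :
  perm_eq (coal_moves nb (map phi s)) (map (map phi) (coal_moves nb s)).
Proof.
rewrite /coal_moves map_flatten -map_comp undup_map_inj// -map_comp.
elim: (undup s) => //= u l IH; apply: perm_cat => //.
apply: (perm_trans (perm_map _ (perm_nb_aut u))).
rewrite -!map_comp; apply/permP => p; congr count; apply: eq_map => w /=.
rewrite -!map_comp; apply: eq_map => v /=.
by rewrite (inj_eq phi_inj); case: eqP.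
Qed.

Lemma csg_aut t A s : csg t (occ (map phi A)) (map phi s) = csg t (occ A) s.
Proof.
suff H (L : R) n : iter n (Qop (coal_moves nb) L) (occ (map phi A)) (map phi s) =
    iter n (Qop (coal_moves nb) L) (occ A) s.
  by rewrite /csg /sg size_map; congr pmean; apply/funext => n; exact: H.
elim: n s => [|n IH] s.
  by rewrite /= /occ all_map; congr (nat_of_bool _)%:R; apply: eq_all => x /=; rewrite mem_map.
rewrite !iterS; move: IH; set F := iter n _ _; set G := iter n _ _ => IH.
rewrite /Qop (perm_big _ (perm_coal_moves_aut s)) (perm_size (perm_coal_moves_aut s)).
rewrite size_map big_map IH; congr (_ + _).
by apply: eq_bigr => m _; rewrite IH.
Qed.

End Automorphism.
End OccupationHierarchy.

(** * The infinite system *)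

Section OccupationProbability.
Variables (R : realType) (V : countType) (nb : V -> seq V) (r : nat) (o : V).
Hypothesis nb_size : forall x, size (nb x) = r.
Hypothesis nb_simple : simple_graph nb.
Hypothesis nb_trans : vertex_transitive nb.
Variables (d : measure_display) (Omega : measurableType d).
Variables (P : probability Omega R) (X : V -> R -> Omega -> V).
Hypothesis HX : coalescing_rw nb r P X.
Implicit Types (A F : seq V) (x y z : V) (t : R).

Local Notation occ := (@occ R V).
Local Notation csg := (@csg R V nb r).

Definition occupied t A : set Omega :=
  [set w | forall x, x \in A -> exists y, X y t w = x].

Definition rho t A : R := fine (P (occupied t A)).

Let config F t w : seq V := map (fun y => X y t w) F.

Let prob_finite F t A : uniq F -> 0 <= t ->
  P [set w | all (mem (config F t w)) A] = (csg t (occ A) F)%:E.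
Proof.
move=> uF t0; have H := HX uF.
have Dmv s m : size s = size F -> m \in coal_moves nb s -> size m = size F.
  exact: coal_size.
have Dsz s : size s = size F ->
    (size (coal_moves nb s))%:R <= (size F * r)%:R :> R by exact: coal_rate.
have Di s : s \in [:: F] -> size s = size F by rewrite inE => /eqP ->.
rewrite (prob_at H Dmv Dsz Di (fun s => all (mem s) A) t0).
by rewrite big_seq1 /= invr1 mul1r.
Qed.

Let measurable_finite F t A : uniq F -> measurable [set w | all (mem (config F t w)) A].
Proof. by move=> uF; exact: (measurable_at (HX uF) t (fun s => all (mem s) A)). Qed.

Let occupiedE t A :
  occupied t A = \bigcup_n [set w | all (mem (config (enum_upto V n) t w)) A].
Proof.
apply/seteqP; split => w.
  move=> H; suff [n Hn] : exists n, forall x, x \in A -> exists2 y, (pickle y < n)%N & X y t w = x.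
    exists n => //=; apply/allP => x /Hn[y yn <-].
    by apply: map_f; rewrite mem_enum_upto.
  elim: A H => [|a A IH] H; first by exists 0%N.
  have [|n Hn] := IH; first by move=> x xA; apply: H; rewrite inE xA orbT.
  have [|y ya] := H a; first by rewrite mem_head.
  exists (maxn n (pickle y).+1) => x; rewrite inE => /predU1P[->|/Hn[z zn zx]].
    by exists y => //; rewrite leq_max ltnSn orbT.
  by exists z => //; rewrite leq_max zn.
move=> [n _ /= /allP H] x /H /mapP[y _ ->]; by exists y.
Qed.

Let measurable_occupied t A : measurable (occupied t A).
Proof.
rewrite occupiedE; apply: bigcupT_measurable => n.
by apply: measurable_finite; exact: enum_upto_uniq.
Qed.

Lemma cvg_rho t A : 0 <= t ->
  csg t (occ A) (enum_upto V n) @[n --> \oo] --> rho t A.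
Proof.
move=> t0; pose G n := [set w | all (mem (config (enum_upto V n) t w)) A].
rewrite (_ : (fun n => _) = fine \o (P \o G)); last first.
  by apply/funext => n; rewrite /= prob_finite//; exact: enum_upto_uniq.
apply: fine_cvg; rewrite /rho fineK; last exact: fin_num_measure.
rewrite occupiedE.
apply: nondecreasing_cvg_mu.
- by move=> n; apply: measurable_finite; exact: enum_upto_uniq.
- by rewrite -occupiedE.
- move=> n m nm; apply/subsetPset => w /= /allP H; apply/allP => x /H /mapP[y yn ->].
  by apply: map_f; move: yn; rewrite !mem_enum_upto => /leq_trans; exact.
Qed.

Lemma csg_le_rho t A F : 0 <= t -> uniq F -> csg t (occ A) F <= rho t A.
Proof.
move=> t0 uF; rewrite -lee_fin -prob_finite// /rho fineK; last exact: fin_num_measure.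
apply: le_measure; rewrite ?inE//; first exact: measurable_finite.
by move=> w /= /allP H x /H /mapP[y _ ->]; exists y.
Qed.

Lemma rho_ge0 t A : 0 <= rho t A.
Proof. exact: fine_ge0. Qed.

Lemma rho_le1 t A : rho t A <= 1.
Proof.
by rewrite -lee_fin /rho fineK ?fin_num_measure//; exact: probability_le1.
Qed.

Lemma rho_sub t A B : {subset A <= B} -> rho t B <= rho t A.
Proof.
move=> AB; rewrite -lee_fin /rho !fineK ?fin_num_measure//.
apply: le_measure; rewrite ?inE// => w H x xA; exact: H (AB _ xA).
Qed.

Lemma rho_eqi t A B : A =i B -> rho t A = rho t B.
Proof.
by move=> AB; apply/eqP; rewrite eq_le !rho_sub// => x; rewrite AB.
Qed.

(** The image of a finite initial family is another finite family, whose probability is at most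
    [rho]. This gives one inequality, and the inverse automorphism the other. *)
Lemma rho_aut phi t A : is_aut nb phi -> 0 <= t -> rho t (map phi A) = rho t A.
Proof.
move=> phiA t0.
have H f B : is_aut nb f -> rho t B <= rho t (map f B).
  move=> fA; rewrite -(cvg_lim _ (cvg_rho (A := B) t0))//.
  apply: limr_le; first by apply/cvg_ex; eexists; exact: cvg_rho.
  near=> n; rewrite -(csg_aut r nb_simple fA)//; apply: csg_le_rho => //.
  rewrite map_inj_uniq ?enum_upto_uniq//; exact: bij_inj fA.1.
apply/eqP; rewrite eq_le H// andbT.
have [[psi psiK phiK] adj] := phiA.
have psiA : is_aut nb psi.
  by split=> [|x y]; [exists phi|rewrite -adj !phiK].
have := H psi (map phi A) psiA; rewrite -map_comp.
rewrite (_ : map (psi \o phi) A = A)//.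
by rewrite -[RHS]map_id; apply: eq_map => x /=; rewrite psiK.
Unshelve. all: by end_near. Qed.

Lemma rho1_const t x : 0 <= t -> rho t [:: x] = rho t [:: o].
Proof.
move=> t0; have [phi [phiA <-]] := nb_trans o x.
exact: (@rho_aut phi t [:: o]).
Qed.

Lemma sum_rho2_const t x : 0 <= t ->
  \sum_(y <- nb x) rho t [:: x; y] = \sum_(y <- nb o) rho t [:: o; y].
Proof.
move=> t0; have [phi [phiA <-]] := nb_trans o x.
rewrite (perm_big _ (perm_nb_aut nb_simple phiA o)) big_map /=.
by apply: eq_bigr => y _; exact: (@rho_aut phi t [:: o; y]).
Qed.

Lemma rho_negative_correlation t z A : 0 <= t -> z \notin A ->
  rho t (z :: A) <= rho t [:: z] * rho t A.
Proof.
move=> t0 zA.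
have L1 := cvg_rho (A := z :: A) t0.
have L2 : csg t (occ [:: z]) (enum_upto V n) * csg t (occ A) (enum_upto V n) @[n --> \oo]
   --> rho t [:: z] * rho t A by apply: cvgM; exact: cvg_rho.
rewrite -(cvg_lim _ L1)// -(cvg_lim _ L2)//; apply: ler_lim.
- by apply/cvg_ex; eexists; exact: L1.
- by apply/cvg_ex; eexists; exact: L2.
- by near=> n; exact: negative_correlation.
Unshelve. all: by end_near. Qed.

Let lipschitz_sum (I : Type) (l : seq I) (f : I -> nat -> R -> R) :
  (forall i, exists C : R, forall (n : nat) (x y : R), 0 < x -> 0 < y ->
    `|f i n x - f i n y| <= C * `|x - y|) ->
  exists C : R, forall (n : nat) (x y : R), 0 < x -> 0 < y ->
   `|\sum_(i <- l) f i n x - \sum_(i <- l) f i n y| <= C * `|x - y|.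
Proof.
move=> H; elim: l => [|i l [K HK]].
  by exists 0 => n x y _ _; rewrite !big_nil subrr normr0 mul0r.
have [L HL] := H i; exists (L + K) => n x y x0 y0; rewrite !big_cons.
rewrite opprD addrACA mulrDl (le_trans (ler_normD _ _))// lerD//.
  exact: HL.
exact: HK.
Qed.

Let lipschitz_occ A : exists C : R, forall (n : nat) (x y : R), 0 < x -> 0 < y ->
  `|csg x (occ A) (enum_upto V n) - csg y (occ A) (enum_upto V n)| <= C * `|x - y|.
Proof.
exists (2 * r%:R * (size A)%:R) => n x y x0 y0.
exact: csg_occ_lipschitz.
Qed.

(** For finite families the derivative is the stated combination of [csg] values, Lipschitz in time
    with a constant independent of the family; [is_derive_limit] then applies. *)
Lemma is_derive_rho t A (l : seq (R * seq V)) : 0 < t ->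
  (forall s, gen (coal_moves nb) (occ A) s = \sum_(a <- l) a.1 * occ a.2 s) ->
  is_derive t 1 (fun t => rho t A) (\sum_(a <- l) a.1 * rho t a.2).
Proof.
move=> t0 H.
have [|C HC] := @lipschitz_sum _ l (fun a n u => a.1 * csg u (occ a.2) (enum_upto V n)).
  move=> a; have [C HC] := lipschitz_occ a.2; exists (`|a.1| * C) => n x y x0 y0.
  by rewrite -mulrBr normrM -mulrA ler_wpM2l// HC.
apply: (@is_derive_limit _ (fun n t => csg t (occ A) (enum_upto V n))
  (fun n t => \sum_(a <- l) a.1 * csg t (occ a.2) (enum_upto V n))
  (fun t => rho t A) (fun t => \sum_(a <- l) a.1 * rho t a.2) C t) => //.
- move=> n x x0.
  have D := is_derive_csg' nb_size x (enum_upto V n) (bounded_occ R A).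
  apply: is_derive_eq D _; rewrite (_ : gen _ _ = fun s => \sum_(a <- l) a.1 * occ a.2 s).
    rewrite csg_sum//; last first.
      move=> a; exists `|a.1| => s; rewrite normrM -[leRHS]mulr1 ler_wpM2l//.
      exact: occ_le1.
    by apply: eq_bigr => a _; apply: (csgZ nb_size); exact: bounded_occ.
  by apply/funext => s; exact: H.
- by move=> x x0; apply: cvg_rho; exact: ltW.
- move=> x x0; apply: cvg_bigsum => a _; apply: cvgM; first exact: cvg_cst.
  by apply: cvg_rho; exact: ltW.
Qed.

Lemma is_derive_rho1 t x : 0 < t ->
  is_derive t 1 (fun t => rho t [:: x]) (- \sum_(y <- nb x) rho t [:: x; y]).
Proof.
move=> t0.
have D := @is_derive_rho t [:: x]
  (flatten [seq [:: (1, [:: z]); (-1, [:: z; x]); (-1, [:: x])] | z <- nb x]) t0.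
apply: is_derive_eq (D _) _ => [s|].
  rewrite (gen_occ1 R nb_size nb_simple) big_flatten big_map; apply: eq_bigr => z _.
  by rewrite !big_cons big_nil /=; ring.
rewrite big_flatten big_map -sumrN; apply: eq_bigr => z _.
rewrite !big_cons big_nil /= (rho1_const z) 1?ltW// (rho1_const x) 1?ltW//.
rewrite (@rho_eqi t [:: z; x] [:: x; z]); first by ring.
by move=> u; rewrite !inE orbC.
Qed.

Lemma is_derive_rho2 t x y : 0 < t -> x != y ->
  is_derive t 1 (fun t => rho t [:: x; y])
  (\sum_(u <- nb x) (u != y)%:R * (rho t [:: u; y] - rho t [:: y; u; x]) +
   \sum_(u <- nb y) (u != x)%:R * (rho t [:: x; u] - rho t [:: x; u; y]) -
   2 * r%:R * rho t [:: x; y]).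
Proof.
move=> t0 xy.
pose l1 := flatten [seq [:: ((u != y)%:R : R, [:: u; y]);
   (- (u != y)%:R, [:: y; u; x])] | u <- nb x].
pose l2 := flatten [seq [:: ((u != x)%:R : R, [:: x; u]);
   (- (u != x)%:R, [:: x; u; y])] | u <- nb y].
have D := @is_derive_rho t [:: x; y] (l1 ++ l2 ++ [:: (- (2 * r%:R), [:: x; y])]) t0.
apply: is_derive_eq (D _) _ => [s|].
  rewrite (gen_occ2 R nb_size nb_simple s xy) !big_cat /= !big_flatten !big_map /= big_seq1 /=.
  rewrite mulNr addrA; congr (_ + _ - _); apply: eq_bigr => u _;
    by rewrite !big_cons big_nil /=; ring.
rewrite !big_cat /= !big_flatten !big_map /= big_seq1 /=.
rewrite mulNr addrA; congr (_ + _ - _); apply: eq_bigr => u _;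
  by rewrite !big_cons big_nil /=; ring.
Qed.

(** Jensen in the linearized form $Z^2\ge 2mZ-m^2$. The number [m] can then be the mean in the
    infinite system while [Z] is taken over a finite family, and only one- and two-point functions
    pass to the limit. *)
Lemma rho_second_moment t (l : seq (R * V)) : 0 <= t ->
  (\sum_(a <- l) a.1) ^+ 2 * rho t [:: o] ^+ 2 <=
  \sum_(a <- l) \sum_(b <- l) a.1 * b.1 * rho t [:: a.2; b.2].
Proof.
move=> t0; pose m := (\sum_(a <- l) a.1) * rho t [:: o].
pose Z s : R := \sum_(a <- l) a.1 * occ [:: a.2] s.
have bZ : norm_bounded Z.
  exists (\sum_(a <- l) `|a.1|) => s; rewrite (le_trans (ler_norm_sum _ _ _))//.
  by apply: ler_sum => a _; rewrite normrM -[leRHS]mulr1 ler_wpM2l// occ_le1.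
have bZ2 : norm_bounded (fun s => Z s ^+ 2).
  have [M ZM] := bZ; exists (M ^+ 2) => s; rewrite normrX.
  by rewrite ler_sqr ?nnegrE// (le_trans _ (ZM s)).
have csgM c A F : csg t (fun s => c * occ A s) F = c * csg t (occ A) F.
  by apply: (csgZ nb_size); exact: bounded_occ.
have bM c A : norm_bounded (fun s => c * occ A s).
  exists `|c| => s; rewrite normrM -[leRHS]mulr1 ler_wpM2l//; exact: occ_le1.
have fin F : 2 * m * (\sum_(a <- l) a.1 * csg t (occ [:: a.2]) F) - m ^+ 2 <=
   \sum_(a <- l) \sum_(b <- l) a.1 * b.1 * csg t (occ [:: a.2; b.2]) F.
  have -> : \sum_(a <- l) a.1 * csg t (occ [:: a.2]) F = csg t Z F.
    by rewrite csg_sum//; apply: eq_bigr => a _; rewrite csgM.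
  have -> : \sum_(a <- l) \sum_(b <- l) a.1 * b.1 * csg t (occ [:: a.2; b.2]) F =
      csg t (fun s => Z s ^+ 2) F.
    rewrite (_ : (fun s => Z s ^+ 2) = fun s => \sum_(a <- l) \sum_(b <- l)
        (a.1 * b.1 * occ [:: a.2; b.2] s)).
      rewrite csg_sum//.
        apply: eq_bigr => a _; rewrite csg_sum//.
        by apply: eq_bigr => b _; rewrite csgM.
      move=> a; exists (\sum_(b <- l) `|a.1 * b.1|) => s.
      rewrite (le_trans (ler_norm_sum _ _ _))//; apply: ler_sum => b _.
      by rewrite normrM -[leRHS]mulr1 ler_wpM2l// occ_le1.
    apply/funext => s; rewrite expr2 /Z mulr_suml; apply: eq_bigr => a _.
    rewrite mulr_sumr; apply: eq_bigr => b _.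
    by rewrite /occ /= !andbT -mulnb natrM; ring.
  rewrite -[X in _ - X](csg_cst nb_size t (m ^+ 2) F).
  have -> : 2 * m * csg t Z F - csg t (fun=> m ^+ 2) F =
      csg t (fun s => - m ^+ 2 + 2 * m * Z s) F.
    rewrite csgDM//; last by exists `|- m ^+ 2|.
    by rewrite !csg_cst//; ring.
  apply: csg_mono => //.
    have [M ZM] := bZ; exists (`|- m ^+ 2| + `|2 * m| * M) => s.
    by rewrite (le_trans (ler_normD _ _))// lerD// normrM ler_wpM2l.
  by move=> s; have := sqr_ge0 (Z s - m); rewrite sqrrB; lra.
have L1 : (fun n => 2 * m * (\sum_(a <- l) a.1 * csg t (occ [:: a.2]) (enum_upto V n)) - m ^+ 2)
   @ \oo --> 2 * m * (\sum_(a <- l) a.1 * rho t [:: a.2]) - m ^+ 2.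
  apply: cvgB; last exact: cvg_cst.
  apply: cvgM; first exact: cvg_cst.
  by apply: cvg_bigsum => a _; apply: cvgM; [exact: cvg_cst|exact: cvg_rho].
have L2 : (fun n => \sum_(a <- l) \sum_(b <- l) a.1 * b.1 * csg t (occ [:: a.2; b.2]) (enum_upto V n))
   @ \oo --> \sum_(a <- l) \sum_(b <- l) a.1 * b.1 * rho t [:: a.2; b.2].
  apply: cvg_bigsum => a _; apply: cvg_bigsum => b _.
  by apply: cvgM; [exact: cvg_cst|exact: cvg_rho].
have E : \sum_(a <- l) a.1 * rho t [:: a.2] = m.
  by rewrite /m mulr_suml; apply: eq_bigr => a _; rewrite rho1_const.
have -> : (\sum_(a <- l) a.1) ^+ 2 * rho t [:: o] ^+ 2 =
     2 * m * (\sum_(a <- l) a.1 * rho t [:: a.2]) - m ^+ 2.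
  by rewrite E /m; ring.
rewrite -(cvg_lim _ L1)// -(cvg_lim _ L2)//; apply: ler_lim.
- by apply/cvg_ex; eexists; exact: L1.
- by apply/cvg_ex; eexists; exact: L2.
- by near=> n; exact: fin.
Unshelve. all: by end_near. Qed.

End OccupationProbability.

(** * Two independent walks *)

Section PairChain.
Variables (R : realType) (V : countType) (nb : V -> seq V) (r : nat) (o : V).
Hypothesis nb_size : forall x, size (nb x) = r.
Hypothesis nb_simple : simple_graph nb.
Hypothesis nb_trans : vertex_transitive nb.
Hypothesis r_gt0 : (0 < r)%N.
Implicit Types (f g : V -> V -> R) (x y z u v : V) (c t l : R).

Let r0 : r%:R != 0 :> R.
Proof. by rewrite pnatr_eq0 -lt0n. Qed.

Let rp : 0 < r%:R :> R.
Proof. by rewrite ltr0n. Qed.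

(* One step of the jump chain of two independent walks. *)
Definition pair_step f x y : R :=
  (\sum_(z <- nb x) f z y + \sum_(z <- nb y) f x z) / (2 * r%:R).

Definition diag x y : R := (x == y)%:R.

Definition killed_step f x y : R := (x != y)%:R * pair_step f x y.

Definition escape n : V -> V -> R := iter n killed_step (fun x y => (x != y)%:R).

Lemma pair_step_cst c x y : pair_step (fun _ _ => c) x y = c.
Proof.
rewrite /pair_step !big_const_seq !count_predT !iter_addr_0 !nb_size -mulr_natl.
by field.
Qed.

Lemma pair_stepDM f g c x y :
  pair_step (fun x y => f x y + c * g x y) x y = pair_step f x y + c * pair_step g x y.
Proof. by rewrite /pair_step !big_split /= -!mulr_sumr; field. Qed.

Lemma pair_step_mono f g x y : (forall x y, f x y <= g x y) ->
  pair_step f x y <= pair_step g x y.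
Proof.
move=> fg; rewrite ler_wpM2r ?invr_ge0 ?mulr_ge0//.
by apply: lerD; apply: ler_sum.
Qed.

Lemma iter_pair_step_mono n f g x y : (forall x y, f x y <= g x y) ->
  iter n pair_step f x y <= iter n pair_step g x y.
Proof. by move=> fg; elim: n x y => //= n IH x y; exact: pair_step_mono. Qed.

Lemma iter_pair_step_cst n c x y : iter n pair_step (fun _ _ => c) x y = c.
Proof.
elim: n x y => //= n IH x y.
rewrite (_ : iter n pair_step _ = fun _ _ => c) ?pair_step_cst//.
by apply/funext => u; apply/funext => v; exact: IH.
Qed.

Lemma iter_pair_stepDM n f g c x y :
  iter n pair_step (fun x y => f x y + c * g x y) x y =
  iter n pair_step f x y + c * iter n pair_step g x y.
Proof.
elim: n x y => //= n IH x y; rewrite -pair_stepDM; congr pair_step.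
by apply/funext => u; apply/funext => v; exact: IH.
Qed.

Lemma iter_pair_step_ge0 n f x y : (forall x y, 0 <= f x y) ->
  0 <= iter n pair_step f x y.
Proof.
by move=> f0; rewrite -[leLHS](iter_pair_step_cst n 0 x y); exact: iter_pair_step_mono.
Qed.

Lemma is_derive_pair_step n (f df : R -> V -> V -> R) t x y :
  (forall x y, is_derive t 1 (fun t => f t x y) (df t x y)) ->
  is_derive t 1 (fun t => iter n pair_step (f t) x y) (iter n pair_step (df t) x y).
Proof.
move=> fd; elim: n x y => //= n IH x y; rewrite /pair_step.
have D1 : is_derive t 1 (fun t => \sum_(z <- nb x) iter n pair_step (f t) z y)
   (\sum_(z <- nb x) iter n pair_step (df t) z y) by apply: is_derive_bigsum.
have D2 : is_derive t 1 (fun t => \sum_(z <- nb y) iter n pair_step (f t) x z)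
   (\sum_(z <- nb y) iter n pair_step (df t) x z) by apply: is_derive_bigsum.
have D3 := is_deriveZ (2 * r%:R)^-1 (is_deriveD D1 D2).
rewrite (_ : (fun t => pair_step _ x y) = (2 * r%:R)^-1 \*:
  ((fun t => \sum_(z <- nb x) iter n pair_step (f t) z y) +
   (fun t => \sum_(z <- nb y) iter n pair_step (f t) x z))).
  by apply: is_derive_eq D3 _; exact: mulrC.
by apply/funext => u; exact: mulrC.
Qed.

Lemma pair_step_sym f : (forall x y, f x y = f y x) ->
  forall x y, pair_step f x y = pair_step f y x.
Proof.
move=> fs x y; rewrite /pair_step addrC.
by congr ((_ + _) / _); apply: eq_bigr => z _; rewrite fs.
Qed.

Lemma pair_step_aut phi f : is_aut nb phi ->
  (forall x y, f (phi x) (phi y) = f x y) ->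
  forall x y, pair_step f (phi x) (phi y) = pair_step f x y.
Proof.
move=> phiA fi x y; rewrite /pair_step !(perm_big _ (perm_nb_aut nb_simple phiA _)) !big_map.
by congr ((_ + _) / _); apply: eq_bigr => z _; rewrite fi.
Qed.

Lemma escape_sym n x y : escape n x y = escape n y x.
Proof.
elim: n x y => [|n IH] x y; first by rewrite /escape /= eq_sym.
by rewrite /escape /= /killed_step eq_sym (pair_step_sym IH).
Qed.

Lemma escape_aut phi n x y : is_aut nb phi ->
  escape n (phi x) (phi y) = escape n x y.
Proof.
move=> phiA; have phi_inj : injective phi by have [/bij_inj] := phiA.
elim: n x y => [|n IH] x y; first by rewrite /escape /= (inj_eq phi_inj).
by rewrite /escape /= /killed_step (inj_eq phi_inj) (pair_step_aut phiA IH).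
Qed.

Lemma killed_step_mono f g x y : (forall x y, f x y <= g x y) ->
  killed_step f x y <= killed_step g x y.
Proof. by move=> fg; rewrite ler_wpM2l// pair_step_mono. Qed.

Lemma escape_diag n x : escape n x x = 0.
Proof. by case: n => [|n]; rewrite /escape /= /killed_step eqxx ?mul0r. Qed.

Lemma escape_ge0 n x y : 0 <= escape n x y.
Proof.
elim: n x y => [|n IH] x y; first by rewrite /escape /=.
rewrite /escape /= mulr_ge0//.
exact: (@iter_pair_step_ge0 1).
Qed.

Lemma escapeS_le n x y : escape n.+1 x y <= escape n x y.
Proof.
elim: n x y => [|n IH] x y; last exact: killed_step_mono.
rewrite /escape /= /killed_step ler_piMr// -[leRHS](pair_step_cst 1 x y).
by apply: pair_step_mono => u v; case: (u != v).
Qed.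

Lemma escape_le m n x y : (m <= n)%N -> escape n x y <= escape m x y.
Proof.
move=> /subnK <-; elim: (n - m)%N => // k IH; rewrite addSn.
exact: le_trans (escapeS_le _ _ _) IH.
Qed.

Lemma escape_le1 n x y : escape n x y <= 1.
Proof.
by rewrite (le_trans (escape_le x y (leq0n n)))// /escape /=; case: (x != y).
Qed.

(* [renewal n.+1] is the probability that two walks started together split at
   the first jump and do not meet during the next [n] jumps. *)
Definition renewal n : R := if n is k.+1 then pair_step (escape k) o o else 1.

Definition pair_diag n : R := iter n pair_step diag o o.

Lemma renewalE k : renewal k.+1 = r%:R^-1 * \sum_(y <- nb o) escape k o y.
Proof.
rewrite /= /pair_step.
have -> : \sum_(z <- nb o) escape k z o = \sum_(z <- nb o) escape k o z.
  by apply: eq_bigr => y _; rewrite escape_sym.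
by field.
Qed.

Lemma pair_step_escape_diag n z : pair_step (escape n) z z = renewal n.+1.
Proof.
have [phi [phiA <-]] := nb_trans o z.
by apply: (pair_step_aut phiA) => x y; exact: escape_aut.
Qed.

(** Split according to the last jump number [m] up to [N] at which the walks are together;
    afterwards they avoid each other for the other [N - m] jumps. By transitivity that factor does
    not depend on the place of meeting. The induction conditions on the first jump. *)
Lemma last_meeting_decomposition N x y :
  escape N x y + \sum_(m < N.+1) iter m pair_step diag x y * renewal (N - m) = 1.
Proof.
elim: N x y => [|N IH] x y.
  rewrite big_ord_recl big_ord0 addr0 /escape /= mulr1 /diag.
  by case: (x == y); rewrite ?add0r ?addr0.
rewrite big_ord_recl /= addrA.
have E : escape N.+1 x y + diag x y * renewal N.+1 = pair_step (escape N) x y.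
  rewrite [escape N.+1 x y]/escape /= -/(escape N) /killed_step /diag.
  have [->|xy] := eqVneq x y; last by rewrite mul1r mul0r addr0.
  by rewrite mul0r add0r mul1r (pair_step_escape_diag N y).
rewrite -[pair_step (escape N) o o]/(renewal N.+1) E.
rewrite -[RHS](pair_step_cst 1 x y).
rewrite (_ : (fun _ _ : V => 1) = (fun x y => escape N x y +
   \sum_(m < N.+1) iter m pair_step diag x y * renewal (N - m))); last first.
  by apply/funext => u; apply/funext => v; rewrite IH.
have H k (F : 'I_k -> V -> V -> R) u v : pair_step (fun x y => \sum_(m < k) F m x y) u v =
    \sum_(m < k) pair_step (F m) u v.
  rewrite /pair_step -mulr_suml big_split /=; congr (_ * _).
  by rewrite exchange_big [X in _ + X]exchange_big.
have := @pair_stepDM (escape N) (fun x y => \sum_(m < N.+1)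
   iter m pair_step diag x y * renewal (N - m)) 1 x y.
rewrite mul1r H => E2; transitivity (pair_step (fun x0 y0 => escape N x0 y0 + 1 *
   (\sum_(m < N.+1) iter m pair_step diag x0 y0 * renewal (N - m))) x y).
  rewrite E2; congr (_ + _); apply: eq_bigr => m _; rewrite subSS.
  have := @pair_stepDM (fun _ _ => 0) (iter m pair_step diag) (renewal (N - m)) x y.
  rewrite pair_step_cst add0r mulrC => <-; congr pair_step.
  by apply/funext => u; apply/funext => v; rewrite add0r mulrC.
by congr pair_step; apply/funext => u; apply/funext => v; rewrite mul1r.
Qed.

Lemma renewal_decomposition N : \sum_(m < N.+1) pair_diag m * renewal (N - m) = 1.
Proof. by rewrite -[RHS](last_meeting_decomposition N o o) escape_diag add0r. Qed.

Lemma pair_diag_ge0 n : 0 <= pair_diag n.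
Proof. by apply: iter_pair_step_ge0 => x y; rewrite /diag. Qed.

Lemma pair_diag_le1 n : pair_diag n <= 1.
Proof.
rewrite -[leRHS](iter_pair_step_cst n 1 o o); apply: iter_pair_step_mono => x y.
by rewrite /diag; case: eqP.
Qed.

Lemma renewalS_le n : renewal n.+1 <= renewal n.
Proof.
case: n => [|n]; last by apply: pair_step_mono => x y; exact: escapeS_le.
rewrite /= -[leRHS](pair_step_cst 1 o o); apply: pair_step_mono => x y.
by case: (x != y).
Qed.

Lemma renewal_le m n : (m <= n)%N -> renewal n <= renewal m.
Proof.
move=> /subnK <-; elim: (n - m)%N => // k IH; rewrite addSn.
exact: le_trans (renewalS_le _) IH.
Qed.

Lemma renewal_ge0 n : 0 <= renewal n.
Proof.
by case: n => [|n] //=; apply: (@iter_pair_step_ge0 1) => x y; exact: escape_ge0.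
Qed.

Lemma renewal_le1 n : renewal n <= 1.
Proof. exact: (renewal_le (leq0n n)). Qed.

Lemma pair_diag_growth : exp_growth pair_diag.
Proof. by apply: unit_growth => n; rewrite pair_diag_ge0 pair_diag_le1. Qed.

(** With [c] the limit of [renewal], this is where the Green function at the diagonal is bounded by
    $r/\alpha$. *)
Lemma green_bound c N : (forall n, c <= renewal n) -> 0 <= c ->
  c * \sum_(m < N) pair_diag m <= 1.
Proof.
move=> cr c0; rewrite -[leRHS](renewal_decomposition N) mulr_sumr.
rewrite big_ord_recr /= (le_trans (_ : _ <= \sum_(m < N) pair_diag m * renewal (N - m)))//.
  by apply: ler_sum => m _; rewrite mulrC ler_wpM2l// pair_diag_ge0.
by rewrite lerDl mulr_ge0// ?pair_diag_ge0// renewal_ge0.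
Qed.

(* If the Green function is finite, at least half of the mass of the
   decomposition at time [N + M] comes from the first [M] terms. *)
Lemma renewal_bound_below (G : R) : (forall N, \sum_(m < N) pair_diag m <= G) ->
  exists2 c, 0 < c & forall n, c <= renewal n.
Proof.
move=> GH; pose S n := \sum_(m < n) pair_diag m.
have Sinc : nondecreasing_seq S.
  by apply/nondecreasing_seqP => n; rewrite /S big_ord_recr /= lerDl pair_diag_ge0.
have Scvg : cvgn S.
  by apply: nondecreasing_is_cvgn => //; exists G => _ [n _ <-]; exact: GH.
have Sle n : S n <= limn S by exact: nondecreasing_cvgn_le.
have [M HM] : exists M, limn S - S M < 2^-1.
  have /cvgrPdist_lt /(_ 2^-1) : S @ \oo --> limn S by [].
  rewrite invr_gt0 ltr0n => /(_ isT) [M _ /(_ M (leqnn _))] H; exists M.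
  exact: le_lt_trans (ler_norm _) H.
have Gp : 0 < S M.+1 by rewrite /S big_ord_recl ltr_pwDl ?sumr_ge0// => [|i _];
  rewrite ?pair_diag_ge0// /pair_diag /= /diag eqxx.
exists ((2 * S M.+1)^-1); first by rewrite invr_gt0 mulr_gt0.
suff H N : (2 * S M.+1)^-1 <= renewal N.
  by [].
rewrite -[leLHS]mul1r ler_pdivrMr ?mulr_gt0// mulrCA -ler_pdivrMl//.
have := renewal_decomposition (N + M); rewrite -addnS.
rewrite -(big_mkord xpredT (fun m => pair_diag m * renewal (N + M - m))).
rewrite (@big_cat_nat _ _ _ M 0 (N + M.+1))//=; last by rewrite addnS ltnW// ltnS leq_addl.
move=> E; have A1 : \sum_(0 <= m < M) pair_diag m * renewal (N + M - m) <= S M * renewal N.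
  rewrite big_mkord /S mulr_suml; apply: ler_sum => m _.
  rewrite ler_wpM2l ?pair_diag_ge0//; apply: renewal_le.
  by rewrite -addnBA ?leq_addr// ltnW.
have A2 : \sum_(M <= m < N + M.+1) pair_diag m * renewal (N + M - m) <= 2^-1.
  apply: (@le_trans _ _ (S (N + M.+1)%N - S M)).
    rewrite /S -!(big_mkord xpredT pair_diag) (@big_cat_nat _ _ _ M 0 (N + M.+1))//=.
      rewrite addrAC subrr add0r; apply: ler_sum => m _.
      by rewrite ler_piMr ?pair_diag_ge0 ?renewal_le1.
    by rewrite addnS ltnW// ltnS leq_addl.
  by rewrite (le_trans _ (ltW HM))// lerD2r.
have A3 : S M * renewal N <= S M.+1 * renewal N.
  by rewrite ler_wpM2r ?renewal_ge0// Sinc.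
rewrite mulr1; have -> : 2^-1 = 1 - 2^-1 :> R by field.
apply: (@le_trans _ _ (S M.+1 * renewal N)); last by rewrite mulrC.
by rewrite lerBlDr -[leLHS]E; exact: lerD (le_trans A1 A3) A2.
Qed.

(** The law of one walk after [k] jumps, as weighted endpoints with repetitions: the finite list
    that [rho_second_moment] takes. *)
Definition walk_list : nat -> V -> seq (R * V) :=
  fix wl k x := if k is k'.+1 then
    flatten [seq [seq (a.1 / r%:R, a.2) | a <- wl k' z] | z <- nb x]
  else [:: (1, x)].

Lemma walk_list_sum k x : \sum_(a <- walk_list k x) a.1 = 1.
Proof.
elim: k x => [|k IH] x /=; first by rewrite big_seq1.
rewrite big_flatten big_map.
transitivity (\sum_(z <- nb x) r%:R^-1 : R).
  by apply: eq_bigr => z _; rewrite big_map /= -mulr_suml IH mul1r.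
by rewrite big_const_seq count_predT iter_addr_0 nb_size -[LHS]mulr_natl divff.
Qed.

Let grid f k m x y : R :=
  \sum_(a <- walk_list k x) \sum_(b <- walk_list m y) a.1 * b.1 * f a.2 b.2.

Let gridSl f k m x y : grid f k.+1 m x y = (\sum_(z <- nb x) grid f k m z y) / r%:R.
Proof.
rewrite /grid /= big_flatten big_map mulr_suml; apply: eq_bigr => z _.
rewrite big_map mulr_suml; apply: eq_bigr => a _; rewrite mulr_suml.
by apply: eq_bigr => b _ /=; ring.
Qed.

Let gridSr f k m x y : grid f k m.+1 x y = (\sum_(z <- nb y) grid f k m x z) / r%:R.
Proof.
rewrite exchange_big /= mulr_suml /grid; apply: eq_bigr => a _.
rewrite /= big_flatten big_map mulr_suml; apply: eq_bigr => z _.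
rewrite big_map mulr_suml; apply: eq_bigr => b _ /=; ring.
Qed.

(** Among [n] jumps of the pair, the number made by the first walk is binomial with parameter 1/2;
    the induction is Pascal's rule. *)
Let iter_pair_step_grid n f x y :
  2 ^+ n * iter n pair_step f x y = \sum_(k < n.+1) 'C(n, k)%:R * grid f k (n - k) x y.
Proof.
elim: n x y => [|n IH] x y.
  by rewrite big_ord_recl big_ord0 /grid /= !big_seq1 /= expr0 bin0; ring.
pose G (k : nat) := grid f k (n.+1 - k) x y.
have -> : \sum_(k < n.+2) 'C(n.+1, k)%:R * grid f k (n.+1 - k) x y =
    \sum_(k < n.+1) 'C(n, k)%:R * G k.+1 + \sum_(k < n.+2) 'C(n, k)%:R * G k.
  rewrite -/(G _) big_ord_recl [X in _ = _ + X]big_ord_recl addrCA /= !bin0.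
  congr (_ + _); rewrite -big_split /=; apply: eq_bigr => k _.
  by rewrite /G /bump leq0n add1n binS natrD; ring.
rewrite [X in _ = _ + X]big_ord_recr /= bin_small// mul0r addr0 exprS /pair_step.
have S1 : \sum_(k < n.+1) 'C(n, k)%:R * G k.+1 =
   (\sum_(z <- nb x) 2 ^+ n * iter n pair_step f z y) / r%:R.
  under [X in X / _]eq_bigr do rewrite IH.
  rewrite exchange_big /= mulr_suml; apply: eq_bigr => k _.
  by rewrite /G subSS gridSl mulrA mulr_sumr.
have S2 : \sum_(k < n.+1) 'C(n, k)%:R * G k =
   (\sum_(z <- nb y) 2 ^+ n * iter n pair_step f x z) / r%:R.
  under [X in X / _]eq_bigr do rewrite IH.
  rewrite exchange_big /= mulr_suml; apply: eq_bigr => k _.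
  by rewrite /G subSn -1?ltnS// gridSr mulrA mulr_sumr.
by rewrite S1 S2 -!mulr_sumr; field.
Qed.

(** Poisson thinning: the clock of the pair splits into two independent clocks, one for each
    walk. *)
Let pois_bin l n k : (k <= n)%N ->
  pois (2 * l) n * 2 ^- n * 'C(n, k)%:R = pois l k * pois l (n - k).
Proof.
move=> kn; rewrite /pois exprMn.
have -> : l ^+ n = l ^+ k * l ^+ (n - k) by rewrite -exprD subnKC.
have -> : expR (- (2 * l)) = expR (- l) * expR (- l).
  by rewrite -expRD; congr expR; ring.
have nf : n`!%:R = 'C(n, k)%:R * (k`!%:R * (n - k)`!%:R) :> R.
  by rewrite -!natrM bin_fact.
have f0 m : m`!%:R != 0 :> R by rewrite pnatr_eq0 -lt0n fact_gt0.
have b0 : 'C(n, k)%:R != 0 :> R by rewrite pnatr_eq0 -lt0n bin_gt0.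
rewrite nf; field; rewrite f0 f0 b0 /=.
by rewrite expf_neq0// pnatr_eq0.
Qed.

Let triangle (N : nat) (G : nat -> nat -> R) : (forall i j, 0 <= G i j) ->
  \sum_(k < N) \sum_(l < N) G k l <= \sum_(n < 2 * N) \sum_(k < n.+1) G k (n - k)%N.
Proof.
move=> G0.
have E (n : 'I_(2 * N)) : \sum_(k < n.+1) G k (n - k)%N =
    \sum_(k < 2 * N) (if (k <= n)%N then G k (n - k)%N else 0).
  by rewrite -big_mkcond /= (big_ord_widen _ (fun k => G k (n - k)%N) (ltn_ord n)).
rewrite (eq_bigr _ (fun n _ => E n)) [leRHS]exchange_big /=.
rewrite -(big_mkord xpredT (fun k => \sum_(l < N) G k l)).
rewrite -(big_mkord xpredT (fun k => \sum_(i < 2 * N) (if (k <= i)%N then G k (i - k)%N else 0))).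
have NN : (N <= 2 * N)%N by rewrite mul2n -addnn leq_addr.
rewrite [leRHS](@big_cat_nat _ _ _ N)//= -[leLHS]addr0 lerD//; last first.
  by apply: sumr_ge0 => k _; apply: sumr_ge0 => i _; case: ifP.
rewrite big_nat [leRHS]big_nat; apply: ler_sum => k /andP[_ kN].
rewrite -(big_mkord xpredT (fun i => if (k <= i)%N then G k (i - k)%N else 0)).
rewrite [leRHS](@big_cat_nat _ _ _ k)//=; last by rewrite (leq_trans (ltnW kN)).
rewrite [X in _ <= _ + X](@big_cat_nat _ _ _ (N + k))//=; last 2 first.
- exact: leq_addl.
- by rewrite mul2n -addnn leq_add2l ltnW.
rewrite -[leLHS]add0r lerD//; first by apply: sumr_ge0 => i _; case: ifP.
rewrite -[leLHS]addr0 lerD//; last by apply: sumr_ge0 => i _; case: ifP.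
have := big_addn 0 (N + k) k xpredT (fun i => if (k <= i)%N then G k (i - k)%N else 0).
move=> /(_ 0 +%R); rewrite add0n addnK => ->; rewrite big_mkord.
by apply: ler_sum => i _; rewrite leq_addl addnK.
Qed.

(** The list [s] is the law of one walk after a Poisson number of jumps, truncated at [N]. Its
    square is a law on pairs with fewer than [2 * N] jumps in all; as [f] is nonnegative, enlarging
    the square of jump numbers to that triangle only increases the sum. *)
Lemma poisson_second_moment (N : nat) f (l p : R) : 0 <= l ->
  (forall x y, 0 <= f x y) ->
  (forall s : seq (R * V), (\sum_(a <- s) a.1) ^+ 2 * p <=
     \sum_(a <- s) \sum_(b <- s) a.1 * b.1 * f a.2 b.2) ->
  (\sum_(k < N) pois l k) ^+ 2 * p <=
  \sum_(n < 2 * N) pois (2 * l) n * iter n pair_step f o o.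
Proof.
move=> l0 f0 H.
pose s := flatten [seq [seq (pois l (val k) * a.1, a.2) | a <- walk_list k o]
                  | k : 'I_N <- index_enum 'I_N].
have grid0 k m : 0 <= grid f k m o o.
  have wl0 j x a : a \in walk_list j x -> 0 <= a.1.
    elim: j x a => [|j IH] x a /=; first by rewrite inE => /eqP ->.
    move=> /flatten_mapP[z _ /mapP[b bz ->]] /=.
    by rewrite divr_ge0// (IH _ _ bz).
  rewrite /grid big_seq sumr_ge0// => a /wl0 a0; rewrite big_seq sumr_ge0// => b /wl0 b0.
  by rewrite mulr_ge0// mulr_ge0.
have := H s; rewrite /s big_flatten big_map.
under eq_bigr do rewrite big_map /= -mulr_sumr walk_list_sum mulr1.
move=> /le_trans; apply; rewrite big_flatten big_map.
apply: (@le_trans _ _ (\sum_(k < N) \sum_(m < N) pois l k * pois l m * grid f k m o o)).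
  rewrite le_eqVlt; apply/orP; left; apply/eqP; apply: eq_bigr => k _.
  rewrite big_map; under eq_bigr do rewrite big_flatten big_map.
  rewrite exchange_big /=; apply: eq_bigr => m _; rewrite /grid mulr_sumr.
  apply: eq_bigr => a _; rewrite big_map mulr_sumr; apply: eq_bigr => b _ /=; ring.
apply: le_trans (triangle N (G := fun k m => pois l k * pois l m * grid f k m o o) _) _.
  by move=> i j; rewrite mulr_ge0// mulr_ge0// pois_ge0.
apply: ler_sum => n _.
have -> : iter n pair_step f o o = 2 ^- n * (2 ^+ n * iter n pair_step f o o).
  by rewrite mulKf// expf_neq0// pnatr_eq0.
rewrite iter_pair_step_grid mulrA mulr_sumr; apply: ler_sum => k _.
by rewrite mulrA pois_bin// -ltnS.
Qed.

Lemma pois_first_moment l N : 0 <= l -> \sum_(n < N) pois l n * n%:R <= l.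
Proof.
move=> l0; case: N => [|N]; first by rewrite big_ord0.
rewrite big_ord_recl /= mulr0 add0r -[leRHS]mulr1.
apply: le_trans (_ : _ <= l * \sum_(n < N) pois l n) _; last first.
  by rewrite ler_wpM2l// sum_pois_le1.
rewrite mulr_sumr; apply: ler_sum => n _.
rewrite le_eqVlt; apply/orP; left; apply/eqP; rewrite /pois /= /bump leq0n add1n factS natrM exprS.
have f0 : n`!%:R != 0 :> R by rewrite pnatr_eq0 -lt0n fact_gt0.
have n0 : n.+1%:R != 0 :> R by rewrite pnatr_eq0.
have F (a b e q : R) : a != 0 -> b != 0 -> e * (l * q) / (b * a) * b = l * (e * q / a).
  by move=> a0 b0; field; rewrite a0 b0.
exact: F.
Qed.

End PairChain.

(** * Transience and return probabilities *)

Lemma dyadic_between (R : realType) (t e : R) : 0 <= t -> 0 < e ->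
  exists j0, forall j, (j0 <= j)%N ->
    exists k, t < k.+1%:R / 2 ^+ j /\ k.+1%:R / 2 ^+ j < t + e.
Proof.
move=> t0 e0; pose j0 := Num.truncn e^-1; exists j0.+1 => j j0j.
have j1 : e^-1 < 2 ^+ j.
  apply: (lt_le_trans (truncnS_gt _)).
  rewrite -natrX ler_nat; apply: leq_trans (ltnW (ltn_expl j (ltnSn 1))).
  exact: j0j.
have p0 : 0 < 2 ^+ j :> R by rewrite exprn_gt0.
have ep : 1 < e * 2 ^+ j by rewrite -ltr_pdivrMl// mulr1.
have tp : 0 <= t * 2 ^+ j by rewrite mulr_ge0// ltW.
have := truncn_itv tp; set k := Num.truncn _ => /andP[k1 k2].
exists k; rewrite ltr_pdivlMr// ltr_pdivrMr//; split=> //.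
by rewrite mulrDl -natr1; lra.
Qed.

(** * Avoiding a set at all times, measurably *)

Section AvoidForever.
Variables (R : realType) (S : countType).
Variables (d : measure_display) (Omega : measurableType d).
Variables (P : probability Omega R) (Y : R -> Omega -> S) (A : pred S).
Hypothesis mY : forall t s, measurable [set w | Y t w = s].
Hypothesis rcY : forall w (t : R), 0 <= t ->
  exists2 e : R, 0 < e & forall u, t <= u < t + e -> Y u w = Y t w.

(** By right continuity the position at [t] is also the position at some dyadic time just after [t].
    This reduces uncountably many conditions to countably many. *)
Lemma avoid_on_dyadics w (T : R) : 0 <= T ->
  (forall j k, T <= k.+1%:R / 2 ^+ j -> A (Y (k.+1%:R / 2 ^+ j) w)) ->
  forall t, T <= t -> A (Y t w).
Proof.
move=> T0 H t Tt; have t0 : 0 <= t := le_trans T0 Tt.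
have [e e0 He] := rcY w t0; have [j Hj] := dyadic_between t0 e0.
have [k [k1 k2]] := Hj j (leqnn j).
have := H j k (le_trans Tt (ltW k1)); rewrite He//.
by rewrite k2 (ltW k1).
Qed.

Lemma measurable_pred_at t (B : pred S) : measurable [set w | B (Y t w)].
Proof.
rewrite (_ : mkset _ = \bigcup_(s in [set: S])
   (if B s then [set w | Y t w = s] else set0)).
  by apply: countable_cover => s; case: (B s) => //; exact: mY.
apply/seteqP; split => [w /= Bw|w [s _]]; first by exists (Y t w) => //; rewrite Bw.
by case: ifP => //= Bs YE; rewrite YE.
Qed.

Lemma measurable_avoid (T : R) : 0 <= T ->
  measurable [set w | forall t, T <= t -> A (Y t w)].
Proof.
move=> T0; rewrite (_ : mkset _ = \bigcap_j \bigcap_k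
   (if T <= k.+1%:R / 2 ^+ j then [set w | A (Y (k.+1%:R / 2 ^+ j) w)] else setT)).
  apply: bigcapT_measurable => j; apply: bigcapT_measurable => k.
  by case: ifP => _ //; exact: measurable_pred_at.
apply/seteqP; split => [w H j _ k _|w H].
  by case: ifP => //= Tk; exact: H.
move=> t; apply: avoid_on_dyadics => // j k Tk.
by have := H j I k I; rewrite Tk.
Qed.

End AvoidForever.

Section Transience.
Variables (R : realType) (V : countType) (nb : V -> seq V) (r : nat) (o : V).
Hypothesis nb_size : forall x, size (nb x) = r.
Hypothesis nb_simple : simple_graph nb.
Hypothesis r_gt0 : (0 < r)%N.
Variables (d : measure_display) (Omega : measurableType d).
Variables (P : probability Omega R) (X : V -> R -> Omega -> V).
Hypothesis HX : coalescing_rw nb r P X.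
Hypothesis Htransient :
  P [set w | exists T : R, forall t, T <= t -> X o t w != o] = 1%E.

Let r0 : r%:R != 0 :> R.
Proof. by rewrite pnatr_eq0 -lt0n. Qed.

Let Y (t : R) w : seq V := [:: X o t w].

Let HY : is_ctmc (coal_moves nb) r%:R P [:: [:: o]] Y.
Proof. by have := HX (isT : uniq [:: o]); rewrite mul1n. Qed.

Let D1 (s : seq V) := size s = 1%N.

Let Dmv s m : D1 s -> m \in coal_moves nb s -> D1 m.
Proof. exact: coal_size. Qed.

Let Dsz s : D1 s -> (size (coal_moves nb s))%:R <= r%:R :> R.
Proof. by move=> Ds; have := coal_rate R nb_size Ds; rewrite mul1n. Qed.

Let Do : D1 [:: o].
Proof. by []. Qed.

Let T := @sg R (seq V) (coal_moves nb) r%:R.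

Let home (s : seq V) : R := (s == [:: o])%:R.

Let bounded_home : bounded_on D1 home.
Proof. by exists 1 => s _; rewrite /home; case: eqP; rewrite ?normr1 ?normr0. Qed.

Let visits N (s : seq V) : R := \sum_(k < N.+1) T k%:R home s.

Let avoid N : seq V -> R :=
  iter N (fun f s => (s != [:: o])%:R * T 1 f s) (fun s => (s != [:: o])%:R).

Let T_home_ge0 (t : R) s : 0 <= t -> D1 s -> 0 <= T t home s.
Proof.
by move=> t0 Ds; exact: (sg_ge0 Dmv Dsz).
Qed.

Let bounded_T (t : R) f : 0 <= t -> bounded_on D1 f -> bounded_on D1 (T t f).
Proof. by move=> t0 [M fM]; exists M => s Ds; exact: (sg_le Dmv Dsz). Qed.

Let bounded_visits N : bounded_on D1 (visits N).
Proof. by apply: bounded_on_sum => k; exact: bounded_T. Qed.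

Let avoid01 N s : D1 s -> 0 <= avoid N s <= 1.
Proof.
elim: N s => [|N IH] s Ds; first by rewrite /avoid /=; case: eqP; rewrite ?lexx ?ler01.
have bA : bounded_on D1 (avoid N).
  by exists 1 => u /IH /andP[? ?]; rewrite ger0_norm.
rewrite /avoid /= -/(avoid N); case: eqP => _ /=; rewrite ?mul0r ?lexx ?ler01// mul1r.
apply/andP; split; first by apply: (sg_ge0 Dmv Dsz) => // u /IH /andP[].
rewrite -[leRHS](sg_cst Dmv Dsz 1 1 Ds); apply: (sg_mono Dmv Dsz) => //.
  by exists 1 => u _; rewrite normr1.
by move=> u /IH /andP[].
Qed.

Let bounded_avoid N : bounded_on D1 (avoid N).
Proof. by exists 1 => u /(avoid01 N) /andP[? ?]; rewrite ger0_norm. Qed.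

Let T_semigroup (t u : R) f s : 0 <= t -> 0 <= u -> D1 s -> bounded_on D1 f ->
  T (t + u) f s = T t (T u f) s.
Proof. exact: (sg_semigroup Dmv Dsz). Qed.

Let visits_shift (t : R) N s : 0 <= t -> D1 s ->
  T t (visits N) s = \sum_(k < N.+1) T (t + k%:R) home s.
Proof.
move=> t0 Ds; rewrite [LHS](sg_sum Dmv Dsz)//; last by move=> k; exact: bounded_T.
by apply: eq_bigr => k _; rewrite T_semigroup.
Qed.

Let one_sub (t c : R) f s : D1 s -> bounded_on D1 f ->
  T t (fun s => (1 - f s) * c) s = (1 - T t f s) * c.
Proof.
move=> Ds fb; have b1 : bounded_on D1 (fun=> c : R) by exists `|c|.
rewrite -[RHS](_ : T t (fun=> c) s + - c * T t f s = _).
  rewrite -(sgDM Dmv Dsz)//; apply: (sg_ext _ Dmv) => // u _; ring.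
by rewrite [T t (fun=> c) s](sg_cst Dmv Dsz)//; ring.
Qed.

(** Nothing is counted before [o] is reached, and from then on at most [visits N [:: o]] remains.
    The induction on [N] replaces the strong Markov property. *)
Let visits_le N s : D1 s -> visits N s <= (1 - avoid N s) * visits N [:: o].
Proof.
elim: N s => [|N IH] s Ds.
  rewrite /visits !big_ord1 /avoid /= /T !sg0 /home eqxx.
  by case: eqP => _ /=; rewrite ?subr0 ?subrr ?mul1r ?mul0r.
rewrite /avoid /= -/(avoid N).
have [->|so] := eqVneq s [:: o]; first by rewrite mul0r subr0 mul1r.
rewrite mul1r {1}/visits big_ord_recl /= [T 0 _ _]sg0 {1}/home (negbTE so) add0r.
rewrite (eq_bigr (fun k : 'I_N.+1 => T (1 + k%:R) home s)); last first.
  by move=> k _; rewrite /bump leq0n natrD.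
rewrite -visits_shift//.
apply: (@le_trans _ _ (T 1 (fun s => (1 - avoid N s) * visits N [:: o]) s)).
  apply: (sg_mono Dmv Dsz) => //.
  have [M HM] := bounded_avoid N; exists ((1 + M) * `|visits N [:: o]|) => u Du.
  rewrite normrM ler_wpM2r// (le_trans (ler_normB _ _))// normr1 lerD2l; exact: HM.
rewrite one_sub// ler_wpM2l//.
  have /andP[] := avoid01 N.+1 Ds; rewrite /avoid /= -/(avoid N) so mul1r => _.
  by rewrite subr_ge0.
by rewrite /visits [leRHS]big_ord_recr /= lerDl T_home_ge0.
Qed.

Let times K N : seq (R * pred (seq V)) :=
  [seq ((K + i)%:R, (fun s => s != [:: o]) : pred (seq V)) | i <- iota 0 N.+1].

Let set_chain_times K N (t0 : R) s :
  set_chain (coal_moves nb) r%:R t0 s (times K N) = T (K%:R - t0) (avoid N) s.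
Proof.
elim: N K t0 s => [|N IH] K t0 s.
  rewrite /times /= addn0 /T; congr sg; apply/funext => u; exact: mulr1.
have -> : times K N.+1 = (K%:R, (fun s => s != [:: o]) : pred (seq V)) :: times K.+1 N.
  rewrite /times (_ : iota 0 N.+2 = 0%N :: [seq (1 + i)%N | i <- iota 0 N.+1]).
    rewrite map_cons -map_comp addn0; congr (_ :: _).
    by apply: eq_map => i /=; rewrite add1n addSnnS.
  by rewrite -[iota 0 N.+2]/(0%N :: iota (1 + 0) N.+1) iotaDl.
have E : (fun s => (s != [:: o])%:R *
    set_chain (coal_moves nb) r%:R K%:R s (times K.+1 N)) = avoid N.+1.
  by apply/funext => u; rewrite IH -natr1 addrAC subrr add0r.
by rewrite -E.
Qed.

Let prob_avoid K N : P [set w | all (fun a => a.2 (Y a.1 w)) (times K N)] =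
  (T K%:R (avoid N) [:: o])%:E.
Proof.
have Di s : s \in [:: [:: o]] -> D1 s by rewrite inE => /eqP ->.
rewrite (prob_all_at HY Dmv Dsz Di).
- by rewrite big_seq1 (_ : size _ = 1%N)// invr1 mul1r set_chain_times subr0.
- rewrite /times -map_comp sorted_map.
  apply: (@sub_sorted _ ltn); last exact: iota_ltn_sorted.
  by move=> i j /= ij; rewrite ltr_nat ltn_add2l.
- by apply/allP => a /mapP[i _ ->] /=.
Qed.

Let mY t s : measurable [set w | Y t w = s].
Proof. by case: HY. Qed.

Let rcY w (t : R) : 0 <= t ->
  exists2 e : R, 0 < e & forall u, t <= u < t + e -> Y u w = Y t w.
Proof. by case: HY => _ H _; exact: H. Qed.

(** The events of no visit after time [n] increase to an almost sure event, so one of them has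
    probability at least 1/2. Restricting to integer times enlarges it. *)
Let last_visit : exists K, forall N, 2^-1 <= T K%:R (avoid N) [:: o].
Proof.
pose G (n : nat) := [set w | forall t : R, n%:R <= t -> Y t w != [:: o]].
have mG n : measurable (G n).
  exact: (measurable_avoid (fun s => s != [:: o]) mY rcY).
have UG : \bigcup_n G n = [set w | exists T : R, forall t, T <= t -> X o t w != o].
  apply/seteqP; split => [w [n _ H]|w [T0 H]].
    by exists n%:R => t nt; have := H t nt; rewrite /Y eqseq_cons andbT.
  exists (Num.truncn T0).+1 => // t nt; rewrite /Y eqseq_cons andbT; apply: H.
  by rewrite (le_trans _ nt)// ltW// truncnS_gt.
have L : P (G n) @[n --> \oo] --> 1%E.
  rewrite -Htransient -UG; apply: nondecreasing_cvg_mu => //.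
    exact: bigcupT_measurable.
  move=> m n mn; apply/subsetPset => w H t nt; apply: H.
  by rewrite (le_trans _ nt)// ler_nat.
have L' : fine (P (G n)) @[n --> \oo] --> (1 : R) by exact: fine_cvg L.
have /cvgrPdist_lt /(_ 2^-1) := L'; rewrite invr_gt0 ltr0n => /(_ isT).
move=> [K _ /(_ K (leqnn _))] HK; exists K => N.
have : 2^-1 <= fine (P (G K)) by move: HK; rewrite ltr_norml => /andP[_ HK]; lra.
move=> /le_trans; apply; rewrite -lee_fin fineK ?fin_num_measure//.
rewrite -prob_avoid; apply: le_measure; rewrite ?inE//.
  exact: (measurable_all_at HY).
move=> w H; apply/allP => a /mapP[i _ ->] /=; apply: H.
by rewrite ler_nat leq_addr.
Qed.

(** At most [K] visits occur before time [K]. After it [o] is missed altogether with probability at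
    least 1/2, so the remaining expected number is at most half of the total. *)
Let visits_bounded : exists C, forall N, visits N [:: o] <= C.
Proof.
have [K HK] := last_visit; exists (2 * K%:R) => N.
have V0 : 0 <= visits N [:: o] by apply: sumr_ge0 => k _; exact: T_home_ge0.
have T1 (t : R) : 0 <= t -> T t home [:: o] <= 1.
  move=> t0; rewrite -[leRHS](sg_cst Dmv Dsz t 1 Do); apply: (sg_mono Dmv Dsz) => //.
    by exists 1 => u _; rewrite normr1.
  by move=> u _; rewrite /home; case: eqP.
have H1 : T K%:R (visits N) [:: o] <= 2^-1 * visits N [:: o].
  apply: (@le_trans _ _ (T K%:R (fun s => (1 - avoid N s) * visits N [:: o]) [:: o])).
    apply: (sg_mono Dmv Dsz) => //; last by move=> u Du; exact: visits_le.
    have [M HM] := bounded_avoid N; exists ((1 + M) * `|visits N [:: o]|) => u Du.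
    rewrite normrM ler_wpM2r// (le_trans (ler_normB _ _))// normr1 lerD2l; exact: HM.
  rewrite one_sub// ler_wpM2r//; have := HK N; lra.
have H2 : visits N [:: o] <= K%:R + T K%:R (visits N) [:: o].
  rewrite visits_shift// /visits.
  rewrite -(big_mkord xpredT (fun k => T k%:R home [:: o])).
  rewrite -(big_mkord xpredT (fun k => T (K%:R + k%:R) home [:: o])).
  apply: (@le_trans _ _ (\sum_(0 <= k < K + N.+1) T k%:R home [:: o])).
    rewrite [leRHS](@big_cat_nat _ _ _ N.+1)//= ?leq_addl// lerDl sumr_ge0// => k _.
    exact: T_home_ge0.
  rewrite (@big_cat_nat _ _ _ K)//= ?leq_addr//; apply: lerD.
    apply: (@le_trans _ _ (\sum_(0 <= k < K) 1)).
      by apply: ler_sum => k _; exact: T1.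
    by rewrite big_const_nat iter_addr_0 subn0.
  have := big_addn 0 (K + N.+1) K xpredT (fun k => T k%:R home [:: o]).
  move=> /(_ 0 +%R); rewrite add0n addKn => ->.
  by rewrite le_eqVlt; apply/orP; left; apply/eqP; apply: eq_bigr => k _; rewrite natrD addrC.
lra.
Qed.

Let single_step (f : V -> V -> R) x y : R := (\sum_(z <- nb x) f z y) / r%:R.

Let pair_step_diag : pair_step nb r (@diag R V) = single_step (@diag R V).
Proof.
apply/funext => x; apply/funext => y; rewrite /pair_step /single_step.
have [nb_sym _ nb_uniq] := nb_simple.
have E u v : \sum_(z <- nb u) diag R z v = (v \in nb u)%:R.
  under eq_bigr do rewrite /diag -[(_ == _)%:R]mulr1.
  by rewrite (sum_nb_eq nb_simple) mulr1 -nb_sym.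
rewrite (_ : \sum_(z <- nb y) _ = \sum_(z <- nb y) diag R z x); last first.
  by apply: eq_bigr => z _; rewrite /diag eq_sym.
by rewrite !E nb_sym; field.
Qed.

Let pair_step_single f : pair_step nb r (single_step f) = single_step (pair_step nb r f).
Proof.
apply/funext => x; apply/funext => y; rewrite /pair_step /single_step.
rewrite -!mulr_suml big_split /= -mulrDl mulrAC; congr (_ / _ / _).
by congr (_ + _); rewrite exchange_big.
Qed.

(** As the graph is undirected, moving one walk or the other has the same effect on [diag]. Hence
    two walks are together after [n] jumps with the probability that one walk returns after [n]
    jumps. *)
Let iter_pair_diag n x y :
  iter n.+1 (pair_step nb r) (@diag R V) x y =
  (\sum_(z <- nb x) iter n (pair_step nb r) (@diag R V) z y) / r%:R.
Proof.
rewrite -/(single_step _ x y); congr (_ x y).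
elim: n => [|n IH]; first exact: pair_step_diag.
by rewrite iterS [in LHS]IH pair_step_single.
Qed.

Let iter_Qop_home n x :
  iter n (Qop (coal_moves nb) r%:R) home [:: x] =
  iter n (pair_step nb r) (@diag R V) x o.
Proof.
elim: n x => [|n IH] x; first by rewrite /= /home eqseq_cons andbT.
rewrite iter_pair_diag iterS {1}/Qop /coal_moves /= cats0 size_map nb_size divff//.
rewrite subrr mul0r addr0 big_map mulr_suml; apply: eq_bigr => z _ /=.
by rewrite eqxx IH.
Qed.

Let heat_diag (t : R) : T t home [:: o] = pmean (r%:R * t) (pair_diag R nb r o).
Proof. by congr pmean; apply/funext => n; exact: iter_Qop_home. Qed.

Lemma sum_heat_diag_bounded :
  exists C, forall N, \sum_(k < N) pmean (r%:R * k%:R) (pair_diag R nb r o) <= C.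
Proof.
have [C HC] := visits_bounded; exists C => N; apply: le_trans (HC N).
rewrite /visits big_ord_recr /= -[leLHS]addr0 lerD//; last exact: T_home_ge0.
by apply: ler_sum => k _; rewrite heat_diag.
Qed.

(** From integer times to jump numbers. The Poisson average of the partial sums [A] has derivative
    [r * p], and since $e^{rt}p(t)$ is nondecreasing, [p] on a unit interval is at most $e^r$ times
    its value at the right end. So that average is bounded at integer times, and letting time grow
    recovers every [A M]. *)
Lemma sum_pair_diag_bounded : exists C, forall N, \sum_(k < N) pair_diag R nb r o k <= C.
Proof.
have [C HC] := sum_heat_diag_bounded.
pose dg := pair_diag R nb r o; pose A n := \sum_(m < n) dg m.
have dg0 n : 0 <= dg n by exact: pair_diag_ge0.
have dg1 n : dg n <= 1 by exact: pair_diag_le1.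
have dgg : exp_growth dg by exact: pair_diag_growth.
have A0 n : 0 <= A n by apply: sumr_ge0.
have AS n : A n.+1 = A n + dg n by rewrite /A big_ord_recr.
have Ag : exp_growth A.
  exists 1 => n; rewrite mul1r ger0_norm//; elim: n => [|n IH]; first by rewrite /A big_ord0 expr0 ler01.
  rewrite AS exprS (_ : 2 * 2 ^+ n = 2 ^+ n + 2 ^+ n); last by ring.
  by rewrite lerD// (le_trans (dg1 n))// exprn_ege1// ler1n.
have Ainc : nondecreasing_seq A by apply/nondecreasing_seqP => n; rewrite AS lerDl.
have r0' : 0 <= r%:R :> R by [].
pose p (t : R) := pmean (r%:R * t) dg.
have pd (t : R) : is_derive t 1 p (r%:R * (pmean (r%:R * t) (fun n => dg n.+1) - p t)).
  exact: is_derive_pmeanM.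
have ID (t : R) : is_derive t 1 (fun t => pmean (r%:R * t) A) (r%:R * p t).
  apply: is_derive_eq (is_derive_pmeanM r%:R t Ag) _; congr (_ * _).
  rewrite (_ : (fun n => A n.+1) = fun n => A n + dg n); last by apply/funext.
  by rewrite pmeanD// addrAC subrr add0r.
have pmono (s t : R) : 0 <= s -> s <= t -> t <= s + 1 -> p s <= expR r%:R * p t.
  move=> s0 st t1; pose g (u : R) := expR (r%:R * u) * p u.
  have gd (u : R) : s <= u <= t -> is_derive u 1 g
      (expR (r%:R * u) * (r%:R * pmean (r%:R * u) (fun n => dg n.+1))).
    move=> _; have Dp := pd u.
    by apply: is_derive_eq; rewrite /GRing.scale/=; ring.
  have := is_derive_ge (c := 0) st gd; rewrite mul0r subr_ge0 => H.
  have {}H : g s <= g t.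
    apply: H => u /andP[su _]; rewrite mulr_ge0 ?expR_ge0// mulr_ge0//.
    apply: pmean_ge0 => //; first by rewrite mulr_ge0// (le_trans s0).
    exact: shift_growth.
  have pt0 : 0 <= p t.
    by apply: pmean_ge0 => //; rewrite mulr_ge0// (le_trans s0).
  rewrite -(ler_pM2l (expR_gt0 (r%:R * s))) (le_trans H)// /g mulrA -expRD.
  rewrite ler_wpM2r// ler_expR (_ : r%:R * s + r%:R = r%:R * (s + 1)); last by ring.
  by rewrite ler_wpM2l.
have Ibound N : pmean (r%:R * N%:R) A <= r%:R * expR r%:R * C.
  apply: (@le_trans _ _ (\sum_(k < N) r%:R * expR r%:R * p k.+1%:R)).
    elim: N => [|N IH]; first by rewrite big_ord0 mulr0 pmean0 /A big_ord0.
    rewrite big_ord_recr /= -lerBlDl.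
    have NN : N%:R <= N.+1%:R :> R by rewrite ler_nat.
    have ID' (u : R) : N%:R <= u <= N.+1%:R ->
      is_derive u 1 (fun t => pmean (r%:R * t) A) (r%:R * p u) by move=> _; exact: ID.
    have := is_derive_le (c := r%:R * expR r%:R * p N.+1%:R) NN ID'.
    rewrite [N.+1%:R - _](_ : _ = 1) ?mulr1; last by rewrite -natr1; ring.
    move=> H; apply: le_trans (H _); first by rewrite lerD2l lerN2.
    move=> u /andP[Nu uN]; rewrite -mulrA ler_wpM2l//; apply: pmono => //.
      exact: le_trans Nu.
    by rewrite -natr1 lerD2r.
  rewrite -mulr_sumr ler_wpM2l ?mulr_ge0 ?expR_ge0//.
  apply: le_trans (HC N.+1); rewrite big_ord_recl /= -[leLHS]add0r lerD//.
    by rewrite mulr0 pmean0.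
exists (r%:R * expR r%:R * C) => M; rewrite -/(A M).
(* Pointwise, [A n] is at least $A_M(1-2^{M-n})$: by monotonicity for [n >= M], and because the
   right side is nonpositive otherwise. *)
have low N : A M - A M * 2 ^+ M * expR (- (r%:R * N%:R / 2)) <= r%:R * expR r%:R * C.
  apply: le_trans (Ibound N).
  have gg := geometric_growth R.
  rewrite -(pmean_geometric (r%:R * N%:R)) -[X in X - _](pmean_cst (r%:R * N%:R) (A M)).
  rewrite -mulNr -pmeanDM//; last exact: cst_growth.
  apply: ler_pmean => //; first by apply: lin_growth => //; exact: cst_growth.
  move=> n; have [Mn|nM] := leqP M n.
    rewrite (le_trans _ (Ainc _ _ Mn))// gerDl mulNr oppr_le0.
    by rewrite mulr_ge0 ?mulr_ge0 ?exprn_ge0 ?invr_ge0 ?exprn_ge0.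
  rewrite (le_trans _ (A0 n))// -{1}[A M]mulr1 mulNr -mulrA -mulrBr.
  rewrite mulr_ge0_le0// subr_le0 -(subnK (ltnW nM)) exprD mulfK ?expf_neq0 ?pnatr_eq0//.
  by rewrite exprn_ege1// ler1n.
have L : (fun N : nat => A M - A M * 2 ^+ M * expR (- (r%:R * N%:R / 2))) @ \oo --> A M.
  rewrite -[X in _ --> X]subr0 -[X in _ --> _ - X](mulr0 (A M * 2 ^+ M)).
  apply: cvgB; first exact: cvg_cst.
  apply: cvgM; first exact: cvg_cst.
  rewrite (_ : (fun N : nat => _) = fun N => expR (- (r%:R / 2)) ^+ N).
    apply: cvg_expr; rewrite ger0_norm ?expR_ge0// expR_lt1 oppr_lt0.
    by rewrite divr_gt0// ltr0n.
  apply/funext => N; rewrite -expRM_natl; congr expR.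
  by rewrite -mulr_natl; ring.
rewrite -(cvg_lim _ L)//; apply: limr_le; first by apply/cvg_ex; eexists; exact: L.
by near=> N; exact: low.
Unshelve. all: by end_near. Qed.

End Transience.

(** * The meeting probability *)

Section MeetingProbability.
Variables (R : realType) (V : countType) (nb : V -> seq V) (r : nat) (o : V).
Hypothesis nb_size : forall x, size (nb x) = r.
Hypothesis nb_simple : simple_graph nb.
Hypothesis nb_trans : vertex_transitive nb.
Hypothesis r_gt0 : (0 < r)%N.
Variables (d : measure_display) (Omega : measurableType d).
Variables (P : probability Omega R) (W1 W2 : R -> Omega -> V).
Hypothesis HW : is_ctmc (@indep_moves V nb) ((2 * r)%:R) P
  [seq [:: o; y] | y <- nb o] (fun t w => [:: W1 t w; W2 t w]).
Implicit Types (x y z : V) (h c th : R) (f : V -> V -> R).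

Let r0 : r%:R != 0 :> R.
Proof. by rewrite pnatr_eq0 -lt0n. Qed.

Let Y (t : R) w : seq V := [:: W1 t w; W2 t w].

Local Notation pair_step := (@pair_step R V nb r).
Local Notation killed_step := (@killed_step R V nb r).
Local Notation escape := (@escape R V nb r).
Local Notation renewal := (@renewal R V nb r o).

Let D2 (s : seq V) := size s = 2%N.

Let indep_pair x y : indep_moves nb [:: x; y] =
  [seq [:: w; y] | w <- nb x] ++ [seq [:: x; w] | w <- nb y].
Proof. by rewrite /= cats0 -map_comp. Qed.

Let D2P s : D2 s -> exists x y, s = [:: x; y].
Proof. by case: s => [|x [|y []]]//; exists x, y. Qed.

Let Dmv s m : D2 s -> m \in indep_moves nb s -> D2 m.
Proof.
move=> /D2P[x [y ->]]; rewrite indep_pair mem_cat.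
by case/orP => /mapP[z _ ->].
Qed.

Let Dsz s : D2 s -> (size (indep_moves nb s))%:R <= (2 * r)%:R :> R.
Proof.
move=> /D2P[x [y ->]]; rewrite indep_pair size_cat !size_map !nb_size.
by rewrite addnn mul2n.
Qed.

Let Dinit s : s \in [seq [:: o; y] | y <- nb o] -> D2 s.
Proof. by move=> /mapP[y _ ->]. Qed.

Let iter_Qop_pair n (f : seq V -> R) x y :
  iter n (Qop (indep_moves nb) (2 * r)%:R) f [:: x; y] =
  iter n pair_step (fun x y => f [:: x; y]) x y.
Proof.
elim: n x y => [//|n IH] x y; rewrite !iterS.
have -> : iter n pair_step (fun x y => f [:: x; y]) =
    fun x y => iter n (Qop (indep_moves nb) (2 * r)%:R) f [:: x; y].
  by apply/funext => u; apply/funext => v; rewrite IH.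
move: (iter n _ f) => g; rewrite /Qop indep_pair big_cat !big_map size_cat !size_map.
rewrite !nb_size addnn -mul2n divff ?subrr ?mul0r ?addr0; last first.
  by rewrite pnatr_eq0 -lt0n muln_gt0 r_gt0.
by rewrite /= /pair_step -!mulr_suml -mulrDl natrM.
Qed.

Let off (s : seq V) : bool := if s is [:: x; y] then x != y else false.

(** The probability of being apart at the start and at the next [N] points of a time grid, where
    [th] is the mean number of jumps of the pair per mesh. *)
Fixpoint skeleton th N : V -> V -> R :=
  if N is N'.+1 then
    fun x y => (x != y)%:R * pmean th (fun n => iter n pair_step (skeleton th N') x y)
  else fun x y => (x != y)%:R.

Let times h (K N : nat) : seq (R * pred (seq V)) :=
  [seq ((K + i).+1%:R * h, off : pred (seq V)) | i <- iota 0 N].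

Let timesS h K N : times h K N.+1 = (K.+1%:R * h, off : pred (seq V)) :: times h K.+1 N.
Proof.
rewrite /times -[iota 0 N.+1]/(0%N :: iota (1 + 0) N) iotaDl map_cons -map_comp addn0.
by congr (_ :: _); apply: eq_map => i /=; rewrite add1n addnS.
Qed.

Let set_chain_skeleton h K N x y :
  (x != y)%:R * set_chain (indep_moves nb) (2 * r)%:R (K%:R * h) [:: x; y] (times h K N) =
  skeleton ((2 * r)%:R * h) N x y.
Proof.
elim: N K x y => [|N IH] K x y; first exact: mulr1.
rewrite timesS; congr (_ * _).
have -> : set_chain (indep_moves nb) (2 * r)%:R (K%:R * h) [:: x; y]
    ((K.+1%:R * h, off : pred (seq V)) :: times h K.+1 N) =
  sg (indep_moves nb) (2 * r)%:R h (fun s => (off s)%:R *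
     set_chain (indep_moves nb) (2 * r)%:R (K.+1%:R * h) s (times h K.+1 N)) [:: x; y].
  rewrite -[LHS]/(sg (indep_moves nb) (2 * r)%:R (K.+1%:R * h - K%:R * h) _ _).
  by rewrite -mulrBl -natr1 addrAC subrr add0r mul1r.
congr pmean; apply/funext => n; rewrite iter_Qop_pair.
congr (iter n pair_step _ x y); apply/funext => u; apply/funext => v.
exact: IH.
Qed.

Let prob_skeleton h N : 0 < h ->
  P [set w | all (fun a => a.2 (Y a.1 w)) (times h 0 N)] =
  (r%:R^-1 * \sum_(y <- nb o) skeleton ((2 * r)%:R * h) N o y)%:E.
Proof.
move=> h0; rewrite (prob_all_at HW Dmv Dsz Dinit).
- rewrite size_map nb_size big_map; congr (_ * _)%:E; apply: eq_big_seq => y yo.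
  rewrite -(set_chain_skeleton h 0) mul0r (_ : o != y) ?mul1r//.
  have [_ irr _] := nb_simple.
  by apply: contraTneq yo => <-; exact: irr.
- rewrite /times -map_comp sorted_map.
  apply: (@sub_sorted _ ltn); last exact: iota_ltn_sorted.
  by move=> i j /= ij; rewrite ltr_pM2r// ltr_nat ltnS ltn_add2l.
- by apply/allP => a /mapP[i _ ->] /=; rewrite mulr_ge0// ltW.
Qed.

(** Two or more jumps in one mesh, and the linearization of the weights of zero and one jump, cost
    together $2\,th(1-e^{-th})$. *)
Let pmean_first_order th (a : nat -> R) : 0 <= th -> (forall n, `|a n| <= 1) ->
  `|pmean th a - ((1 - th) * a 0%N + th * a 1%N)| <= 2 * th ^+ 2.
Proof.
move=> th0 a1; have := @pmean_sub_sum _ a th 1 2 th0 a1.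
rewrite !big_ord_recr !big_ord0 /= !add0r /pois fact0 !expr0 expr1 !mulr1 !divr1 mul1r.
have := expR_ge1Dx (- th); set e := expR (- th) => e1.
have e2 : e <= 1 by rewrite /e -expR0 ler_expR oppr_le0.
move=> H; have H2 : `|(e - (1 - th)) * a 0%N + (e * th - th) * a 1%N| <=
    (e - (1 - th)) + (th - e * th).
  rewrite (le_trans (ler_normD _ _))// lerD// normrM.
    by rewrite [`|e - _|]ger0_norm ?ler_piMr//; lra.
  rewrite distrC [`|th - _|]ger0_norm ?ler_piMr//; last by rewrite subr_ge0 ler_piMl.
  by rewrite subr_ge0 ler_piMl.
have -> : pmean th a - ((1 - th) * a 0%N + th * a 1%N) =
   (pmean th a - (e * a 0%N + e * th * a 1%N)) +
   ((e - (1 - th)) * a 0%N + (e * th - th) * a 1%N) by ring.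
rewrite (le_trans (ler_normD _ _))// (le_trans (lerD H H2))//.
have H3 : th * (1 - e) <= th * th by rewrite ler_wpM2l//; lra.
rewrite expr2; lra.
Qed.

(* The binomial mixture of the killed chains run for the jumps of [m] steps. *)
Fixpoint lazy_escape th m k x y : R :=
  if m is m'.+1 then
    (1 - th) * lazy_escape th m' k x y + th * lazy_escape th m' k.+1 x y
  else escape k x y.

Let killed_lazy th m k : killed_step (lazy_escape th m k) = lazy_escape th m k.+1.
Proof.
elim: m k => [//|m IH] k; apply/funext => x; apply/funext => y.
have E2 : lazy_escape th m k.+1 x y = (x != y)%:R * pair_step (lazy_escape th m k) x y.
  by rewrite -IH.
have E3 : lazy_escape th m k.+2 x y = (x != y)%:R * pair_step (lazy_escape th m k.+1) x y.
  by rewrite -IH.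
rewrite -[RHS]/((1 - th) * lazy_escape th m k.+1 x y + th * lazy_escape th m k.+2 x y).
rewrite E2 E3.
have := @pair_stepDM R V nb r r_gt0 (fun x y => (1 - th) * lazy_escape th m k x y)
   (lazy_escape th m k.+1) th x y.
have := @pair_stepDM R V nb r r_gt0 (fun _ _ => 0) (lazy_escape th m k) (1 - th) x y.
rewrite (pair_step_cst nb_size r_gt0) add0r => E1.
rewrite (_ : (fun x y => 0 + _) = fun x y => (1 - th) * lazy_escape th m k x y) in E1; last first.
  by apply/funext => u; apply/funext => v; rewrite add0r.
rewrite E1 => E4; transitivity ((x != y)%:R * pair_step (fun x y =>
    (1 - th) * lazy_escape th m k x y + th * lazy_escape th m k.+1 x y) x y) => //.
by rewrite E4; ring.
Qed.

Let skeleton_bounds th N x y : 0 <= th -> 0 <= skeleton th N x y <= 1.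
Proof.
move=> th0; elim: N x y => [|N IH] x y /=; first by case: eqP; rewrite /= ?lexx ?ler01.
have a01 n : 0 <= iter n pair_step (skeleton th N) x y <= 1.
  rewrite (iter_pair_step_ge0 nb_size r_gt0)/=; last by move=> u v; case/andP: (IH u v).
  rewrite -[leRHS](iter_pair_step_cst nb_size r_gt0 n 1 x y).
  by apply: (iter_pair_step_mono) => u v; case/andP: (IH u v).
have ag : exp_growth (fun n => iter n pair_step (skeleton th N) x y).
  exact: unit_growth.
case: eqP => _ /=; rewrite ?mul0r ?lexx ?ler01// mul1r.
rewrite -{1}(pmean_cst th 0) -[X in _ && (_ <= X)](pmean_cst th 1).
by rewrite !ler_pmean//; try exact: cst_growth; move=> n; case/andP: (a01 n).
Qed.

(** Each mesh is replaced by at most one killed jump, made with probability [th]; the errors of the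
    meshes add up. *)
Let skeleton_lazy th N x y : 0 <= th <= 1 ->
  `|skeleton th N x y - lazy_escape th N 0 x y| <= N%:R * (2 * th ^+ 2).
Proof.
move=> /andP[th0 th1]; elim: N x y => [|N IH] x y; first by rewrite subrr normr0 mul0r.
have K0 : `|killed_step (skeleton th N) x y - killed_step (lazy_escape th N 0) x y| <=
    N%:R * (2 * th ^+ 2).
  set e := N%:R * _; rewrite /killed_step -mulrBr.
  have B u v : - e <= skeleton th N u v - lazy_escape th N 0 u v <= e.
    by rewrite -ler_norml IH.
  have e0 : 0 <= e by rewrite mulr_ge0// mulr_ge0// sqr_ge0.
  case: eqP => _ /=; first by rewrite mul0r normr0.
  rewrite mul1r.
  have -> : pair_step (skeleton th N) x y - pair_step (lazy_escape th N 0) x y =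
      pair_step (fun x y => skeleton th N x y + -1 * lazy_escape th N 0 x y) x y.
    by rewrite pair_stepDM// mulN1r.
  rewrite ler_norml; apply/andP; split.
    rewrite -[leLHS](pair_step_cst nb_size r_gt0 (- e) x y); apply: pair_step_mono => u v.
    by rewrite mulN1r; case/andP: (B u v).
  rewrite -[leRHS](pair_step_cst nb_size r_gt0 e x y); apply: pair_step_mono => u v.
  by rewrite mulN1r; case/andP: (B u v).
rewrite killed_lazy in K0.
have [xy|xy] := eqVneq x y.
  have lz m k : lazy_escape th m k x x = 0.
    by elim: m k => [|m IHm] k /=; rewrite ?escape_diag// !IHm !mulr0 addr0.
  by rewrite xy /= eqxx mul0r -xy !lz !mulr0 addr0 subrr normr0 mulr_ge0// mulr_ge0// sqr_ge0.
have a1 n : `|iter n pair_step (skeleton th N) x y| <= 1.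
  have s01 u v := skeleton_bounds N u v th0.
  rewrite ger0_norm; last first.
    by apply: (iter_pair_step_ge0 nb_size r_gt0) => u v; case/andP: (s01 u v).
  rewrite -[leRHS](iter_pair_step_cst nb_size r_gt0 n 1 x y).
  by apply: iter_pair_step_mono => u v; case/andP: (s01 u v).
have := pmean_first_order th0 a1 => /= H.
rewrite /= xy mul1r; rewrite /killed_step xy mul1r in K0.
set A := pmean _ _ in H *; set B := pair_step (skeleton th N) x y in H K0.
have := IH x y; set S := skeleton th N x y in H *.
set L0 := lazy_escape th N 0 x y; set L1 := lazy_escape th N 1 x y in K0 *.
move=> H0; set e := N%:R * _ in H0 K0.
have -> : A - ((1 - th) * L0 + th * L1) =
    (A - ((1 - th) * S + th * B)) + ((1 - th) * (S - L0) + th * (B - L1)) by ring.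
rewrite (_ : N.+1%:R * _ = 2 * th ^+ 2 + e); last by rewrite /e -natr1; ring.
rewrite (le_trans (ler_normD _ _))// lerD//.
rewrite (le_trans (ler_normD _ _))// !normrM [`|1 - th|]ger0_norm ?subr_ge0//.
rewrite [`|th|]ger0_norm// (_ : e = (1 - th) * e + th * e); last by ring.
by rewrite lerD// ler_wpM2l// subr_ge0.
Qed.

Let lazy_ge th m k x y : 0 <= th <= 1 -> escape (m + k) x y <= lazy_escape th m k x y.
Proof.
move=> /andP[th0 th1]; elim: m k => [//|m IH] k.
have H1 := IH k; have H2 := IH k.+1; rewrite addnS in H2; rewrite addSn.
have H3 := @escapeS_le R V nb r nb_size r_gt0 (m + k) x y.
have : (1 - th) * escape (m + k).+1 x y + th * escape (m + k).+1 x y <=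
   (1 - th) * lazy_escape th m k x y + th * lazy_escape th m k.+1 x y.
  by rewrite lerD// ler_wpM2l ?subr_ge0// (le_trans H3).
rewrite -mulrDl subrK mul1r => H; exact: H.
Qed.

(** Either at least [M] jumps have been made, or not; the second case is controlled by the mean of
    $2^{M-J}$ for [J] the number of jumps, a Chernoff bound. *)
Let lazy_le th m k M x y : 0 <= th <= 1 ->
  lazy_escape th m k x y <= escape M x y + 2 ^+ M * 2 ^- k * (1 - th / 2) ^+ m.
Proof.
move=> /andP[th0 th1]; elim: m k => [|m IH] k /=.
  rewrite expr0 mulr1; have [Mk|kM] := leqP M k.
    by rewrite (le_trans (escape_le R nb_size r_gt0 x y Mk))// lerDl mulr_ge0 ?invr_ge0 ?exprn_ge0.
  rewrite (le_trans (escape_le1 R nb_size r_gt0 k x y))// -[leLHS]add0r lerD ?escape_ge0//.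
  rewrite -(subnK (ltnW kM)) exprD mulfK ?expf_neq0 ?pnatr_eq0//.
  by rewrite exprn_ege1// ler1n.
have H1 := IH k; have H2 := IH k.+1.
apply: (@le_trans _ _ ((1 - th) * (escape M x y + 2 ^+ M * 2 ^- k * (1 - th / 2) ^+ m) +
  th * (escape M x y + 2 ^+ M * 2 ^- k.+1 * (1 - th / 2) ^+ m))).
  by rewrite lerD// ler_wpM2l// subr_ge0.
rewrite !exprS invfM le_eqVlt; apply/orP; left; apply/eqP; field.
by rewrite expf_neq0// pnatr_eq0.
Qed.

Let mY (t : R) s : measurable [set w | Y t w = s].
Proof. by case: HW => H _ _; exact: H. Qed.

Let rcY w (t : R) : 0 <= t ->
  exists2 e : R, 0 < e & forall u, t <= u < t + e -> Y u w = Y t w.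
Proof. by case: HW => _ H _; exact: H. Qed.

(** Mesh $2^{-j}$ up to time [j]. The grids are nested and exhaust the positive dyadic times, while
    the number of meshes times the square of the mesh, $j2^{-j}$, tends to 0. *)
Let E j := [set w | all (fun a => a.2 (Y a.1 w)) (times (2 ^- j) 0 (j * 2 ^ j))].

Let mE j : measurable (E j).
Proof. exact: (measurable_all_at HW). Qed.

Let EP j w : E j w <-> forall k, (k < j * 2 ^ j)%N -> W1 (k.+1%:R / 2 ^+ j) w != W2 (k.+1%:R / 2 ^+ j) w.
Proof.
split=> [/allP H k kj|H].
  by apply: (H (k.+1%:R / 2 ^+ j, off)); apply/mapP; exists k; rewrite ?mem_iota// add0n.
by apply/allP => a /mapP[k]; rewrite mem_iota add0n => kj -> /=; exact: H.
Qed.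

Let capE : \bigcap_j E j = [set w | forall t, 0 <= t -> W1 t w != W2 t w].
Proof.
apply/seteqP; split => w H; last first.
  by move=> j _; apply/EP => k _; apply: H; rewrite divr_ge0// exprn_ge0.
suff: forall t : R, 0 <= t -> off (Y t w) by [].
apply: (avoid_on_dyadics rcY) => // j k _ /=.
(* The grid of level [i] contains the given dyadic time and reaches far enough to include it; its
   index is a predecessor because grid times are numbered from [k.+1]. *)
pose i := (j + k.+1)%N; have /EP Hi := H i I.
have k0 : (0 < k.+1 * 2 ^ k.+1)%N by rewrite muln_gt0 expn_gt0.
have := Hi (k.+1 * 2 ^ k.+1).-1.
rewrite prednK// (_ : (k.+1 * 2 ^ k.+1)%:R / 2 ^+ i = k.+1%:R / 2 ^+ j); first apply.
  rewrite /i expnD mulnA leq_mul2r; apply/orP; right.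
  by rewrite (leq_trans (leq_addl j k.+1))// leq_pmulr// expn_gt0.
rewrite natrM natrX /i exprD invfM mulrACA divff ?mulr1//.
Qed.

Let E_decr : {homo E : n m / (n <= m)%N >-> (m <= n)%O}.
Proof.
apply/nonincreasing_seqP => j; apply/subsetPset => w /EP H; apply/EP => k kj.
have := H (2 * k).+1; rewrite (_ : (2 * k).+2%:R / 2 ^+ j.+1 = k.+1%:R / 2 ^+ j).
  apply; apply: (@leq_trans (2 * (j * 2 ^ j))).
    by move: kj; set m := (j * 2 ^ j)%N; lia.
  by rewrite expnS [leqRHS]mulnCA leq_mul2l /= leq_mul2r leqnSn orbT.
rewrite (_ : (2 * k).+2 = 2 * k.+1)%N; last by rewrite mulnS.
by rewrite natrM exprS invfM mulrACA divff ?mul1r// pnatr_eq0.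
Qed.

Lemma renewal_cvg : renewal n @[n --> \oo] --> limn renewal.
Proof.
apply: nonincreasing_is_cvgn.
  by apply/nonincreasing_seqP => n; exact: renewalS_le.
by exists 0 => _ [n _ <-]; exact: renewal_ge0.
Qed.

Let j2j : (fun j => j%:R * 2 ^- j : R) @ \oo --> (0 : R).
Proof.
have B (j : nat) : j%:R <= 2 * (3 / 2) ^+ j :> R.
  elim: j => [|j IH]; first by rewrite expr0 mulr1.
  have : 1 <= (3 / 2) ^+ j :> R by rewrite exprn_ege1//; lra.
  rewrite exprS -[j.+1%:R]natr1; set q := (3 / 2) ^+ j in IH * => q1.
  by lra.
apply: (@squeeze_cvgr _ _ _ _ (fun=> 0) (fun j => 2 * (3 / 4) ^+ j)); last 2 first.
- exact: cvg_cst.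
- rewrite -[X in _ --> X](mulr0 2); apply: cvgM; first exact: cvg_cst.
  by apply: cvg_expr; rewrite ger0_norm; lra.
near=> j; rewrite mulr_ge0 ?invr_ge0 ?exprn_ge0//= ler_pdivrMr ?exprn_gt0//.
rewrite (le_trans (B j))// -mulrA -exprMn (_ : 3 / 4 * 2 = 3 / 2)//.
by field.
Unshelve. all: by end_near. Qed.

(** On grid [j] the walks make at most [N j] lazy jumps and, with high probability, more than any
    fixed [M]. So the probability is squeezed between late and arbitrary values of [renewal]. *)
Lemma prob_never_meet :
  fine (P [set w | forall t, 0 <= t -> W1 t w != W2 t w]) = limn renewal.
Proof.
pose th j : R := (2 * r)%:R * 2 ^- j; pose N j := (j * 2 ^ j)%N.
have L0 : P (E j) @[j --> \oo] --> P (\bigcap_j E j).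
  apply: nonincreasing_cvg_mu => //.
  - by rewrite (le_lt_trans (probability_le1 _ (mE 0)))// ltry.
  - exact: bigcapT_measurable.
have L1 : fine (P (E j)) @[j --> \oo] --> fine (P (\bigcap_j E j)).
  apply: fine_cvg; rewrite fineK; first exact: L0.
  by apply: fin_num_measure; exact: bigcapT_measurable.
rewrite capE in L1.
have th0 j : 0 <= th j by rewrite mulr_ge0// invr_ge0 exprn_ge0.
have PE j : fine (P (E j)) = r%:R^-1 * \sum_(y <- nb o) skeleton (th j) (N j) o y.
  by rewrite /E prob_skeleton// invr_gt0 exprn_gt0.
have thN j : (N j)%:R * (2 * th j ^+ 2) = 8 * r%:R ^+ 2 * (j%:R * 2 ^- j).
  rewrite /N /th !natrM natrX; set q : R := 2 ^+ j.
  by field; rewrite /q expf_neq0// pnatr_eq0.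
have err : (fun j => (N j)%:R * (2 * th j ^+ 2)) @ \oo --> (0 : R).
  have H : (fun j => 8 * r%:R ^+ 2 * (j%:R * 2 ^- j) : R) @ \oo --> 8 * r%:R ^+ 2 * (0 : R).
    by apply: cvgM; [exact: cvg_cst|exact: j2j].
  by rewrite mulr0 in H; under eq_fun do rewrite thN; exact: H.
have th1 : \forall j \near \oo, th j <= 1.
  have /cvgrPdist_le /(_ 1 ltr01) : th @ \oo --> (0 : R).
    rewrite -[X in _ --> X](mulr0 (2 * r)%:R); apply: cvgM; first exact: cvg_cst.
    rewrite (_ : (fun j : nat => 2 ^- j : R) = fun j => 2^-1 ^+ j).
      by apply: cvg_expr; rewrite ger0_norm; lra.
    by apply/funext => j; rewrite exprVn.
  by apply: filterS => j; rewrite sub0r normrN ger0_norm.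
have avg c : r%:R^-1 * \sum_(y <- nb o) c = c :> R.
  by rewrite big_const_seq count_predT iter_addr_0 nb_size -(mulr_natl c r) mulKf.
have rg : 0 <= r%:R^-1 :> R by rewrite invr_ge0.
have low : \forall j \near \oo,
    renewal (N j).+1 - (N j)%:R * (2 * th j ^+ 2) <= fine (P (E j)).
  near=> j; have tj : 0 <= th j <= 1 by rewrite th0/=; near: j.
  rewrite PE renewalE// -[X in _ - X]avg -mulrBr -sumrB ler_wpM2l// ler_sum// => y _.
  have := skeleton_lazy (N j) o y tj; have := lazy_ge (N j) 0 o y tj.
  by rewrite addn0 ler_norml => ? /andP[? ?]; lra.
have up M : \forall j \near \oo, fine (P (E j)) <=
   renewal M.+1 + (2 ^+ M * expR (- (r%:R * j%:R)) + (N j)%:R * (2 * th j ^+ 2)).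
  near=> j; have tj : 0 <= th j <= 1 by rewrite th0/=; near: j.
  rewrite PE renewalE// -[X in _ <= _ + X]avg -mulrDr -big_split ler_wpM2l// ler_sum// => y _ /=.
  have := skeleton_lazy (N j) o y tj; have := lazy_le (N j) 0 M o y tj.
  rewrite expr0 invr1 mulr1 ler_norml => H1 /andP[_ H2].
  have H3 : (1 - th j / 2) ^+ N j <= expR (- (r%:R * j%:R)).
    rewrite (_ : expR _ = expR (- (th j / 2)) ^+ N j).
      rewrite lerXn2r ?nnegrE ?expR_ge0//; last exact: expR_ge1Dx.
      by case/andP: tj => _ ?; lra.
    rewrite -expRM_natl; congr expR; rewrite /th /N !natrM natrX.
    by field; rewrite expf_neq0// pnatr_eq0.
  have H4 : 2 ^+ M * (1 - th j / 2) ^+ N j <= 2 ^+ M * expR (- (r%:R * j%:R)).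
    by rewrite ler_wpM2l// exprn_ge0.
  by lra.
have Ninf : N j @[j --> \oo] --> \oo.
  apply/cvgnyPge => M; near=> j; apply: (@leq_trans j).
    by near: j; exact: nbhs_infty_ge.
  by rewrite /N leq_pmulr// expn_gt0.
apply/eqP; rewrite eq_le; apply/andP; split; last first.
  have L2 : renewal (N j).+1 - (N j)%:R * (2 * th j ^+ 2) @[j --> \oo] --> limn renewal - 0.
    apply: cvgB => //.
    have R1 : renewal n.+1 @[n --> \oo] --> limn renewal.
      by have := renewal_cvg; rewrite -[X in X -> _]cvg_shiftS.
    exact: (@cvg_comp _ _ _ N (fun n => renewal n.+1) _ _ _ Ninf R1).
  rewrite subr0 in L2; rewrite -(cvg_lim _ L1)// -(cvg_lim _ L2)//; apply: ler_lim => //.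
  - by apply/cvg_ex; eexists; exact: L2.
  - by apply/cvg_ex; eexists; exact: L1.
have upM M : fine (P [set w | forall t, 0 <= t -> W1 t w != W2 t w]) <= renewal M.+1.
  have L2 : renewal M.+1 + (2 ^+ M * expR (- (r%:R * j%:R)) + (N j)%:R * (2 * th j ^+ 2))
     @[j --> \oo] --> renewal M.+1 + (2 ^+ M * 0 + 0).
    apply: cvgD; first exact: cvg_cst.
    apply: cvgD => //; apply: cvgM; first exact: cvg_cst.
    rewrite (_ : (fun j : nat => _) = fun j => expR (- r%:R) ^+ j).
      apply: cvg_expr; rewrite ger0_norm ?expR_ge0// expR_lt1 oppr_lt0.
      by rewrite ltr0n.
    by apply/funext => j; rewrite -expRM_natl; congr expR; ring.
  rewrite mulr0 !addr0 in L2; rewrite -(cvg_lim _ L1)// -(cvg_lim _ L2)//; apply: ler_lim => //.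
  - by apply/cvg_ex; eexists; exact: L1.
  - by apply/cvg_ex; eexists; exact: L2.
have R1 : renewal n.+1 @[n --> \oo] --> limn renewal.
  by have := renewal_cvg; rewrite -[X in X -> _]cvg_shiftS.
rewrite -(cvg_lim _ R1)//; apply: limr_ge; first by apply/cvg_ex; eexists; exact: R1.
by near=> M; exact: upM.
Unshelve. all: by end_near. Qed.

End MeetingProbability.

(** * Estimates on the pair density *)

Section DensityEstimates.
Variables (R : realType) (V : countType) (nb : V -> seq V) (r : nat) (o : V).
Hypothesis nb_size : forall x, size (nb x) = r.
Hypothesis nb_simple : simple_graph nb.
Hypothesis nb_trans : vertex_transitive nb.
Hypothesis r_gt0 : (0 < r)%N.
Variables (d : measure_display) (Omega : measurableType d).
Variables (P : probability Omega R) (X : V -> R -> Omega -> V).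
Hypothesis HX : coalescing_rw nb r P X.
Implicit Types (x y z u v : V) (t s c e : R).

Local Notation pair_step := (@pair_step R V nb r).
Local Notation diag := (@diag R V).
Local Notation escape := (@escape R V nb r).
Local Notation renewal := (@renewal R V nb r o).
Local Notation pair_diag := (@pair_diag R V nb r o).
Local Notation rho := (@rho R V d Omega P X).

Let rp : 0 < r%:R :> R.
Proof. by rewrite ltr0n. Qed.

Let r0 : r%:R != 0 :> R.
Proof. by rewrite gt_eqF. Qed.

Let nb_irr x z : z \in nb x -> z != x.
Proof. by have [_ irr _] := nb_simple; apply: contraTneq => ->; exact: irr. Qed.

Definition density t : R := rho t [:: o].
Definition coalescence_rate t : R := \sum_(y <- nb o) rho t [:: o; y].

Local Notation p := density.
Local Notation h := coalescence_rate.

Let rho_swap t x y : rho t [:: x; y] = rho t [:: y; x].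
Proof. by apply: (rho_eqi HX) => z; rewrite !inE orbC. Qed.

Let rho2_le t x y : 0 <= t -> x != y -> rho t [:: x; y] <= p t ^+ 2.
Proof.
move=> t0 xy; have := rho_negative_correlation nb_size HX t0 (_ : x \notin [:: y]).
rewrite inE => /(_ xy) /le_trans; apply.
by rewrite !(rho1_const o nb_size nb_simple nb_trans HX _ t0) expr2.
Qed.

Lemma density_ge0 t : 0 <= p t.
Proof. exact: rho_ge0. Qed.

Lemma density_le1 t : p t <= 1.
Proof. exact: (rho_le1 HX). Qed.

Lemma coalescence_rate_ge0 t : 0 <= h t.
Proof. by apply: sumr_ge0 => y _; exact: rho_ge0. Qed.

Lemma coalescence_rate_le t : 0 <= t -> h t <= r%:R * p t ^+ 2.
Proof.
move=> t0; apply: (@le_trans _ _ (\sum_(y <- nb o) p t ^+ 2)).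
  rewrite /h big_seq [leRHS]big_seq; apply: ler_sum => y yo; apply: rho2_le => //.
  by rewrite eq_sym nb_irr.
by rewrite big_const_seq count_predT iter_addr_0 nb_size mulr_natl.
Qed.

Lemma is_derive_density t : 0 < t -> is_derive t 1 p (- h t).
Proof. by move=> t0; exact: (is_derive_rho1 o nb_size nb_simple nb_trans HX). Qed.

(** The particle started at [o] has not yet jumped with probability $e^{-rt}$, the first term of the
    Poisson average. *)
Lemma density_gt0 t : 0 <= t -> 0 < p t.
Proof.
move=> t0; apply: lt_le_trans (csg_le_rho nb_size HX [:: o] t0 (isT : uniq [:: o])).
have Dmv (s m : seq V) : size s = 1%N -> m \in coal_moves nb s -> size m = 1%N by exact: coal_size.
have Dsz (s : seq V) : size s = 1%N -> (size (coal_moves nb s))%:R <= (1 * r)%:R :> R.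
  exact: coal_rate.
have i0 n : 0 <= iter n (Qop (coal_moves nb) (1 * r)%:R) (occ R [:: o]) [:: o].
  rewrite -[leLHS](iter_Qop_cst Dmv Dsz n 0 (erefl : size [:: o] = 1%N)).
  apply: (iter_Qop_mono Dmv Dsz) => // s _; by case/andP: (occ01 R [:: o] s).
have ig : exp_growth (fun n => iter n (Qop (coal_moves nb) (1 * r)%:R) (occ R [:: o]) [:: o]).
  apply: (iter_Qop_growth Dmv Dsz (erefl : size [:: o] = 1%N)).
  by exists 1 => s _; exact: occ_le1.
have l0 : 0 <= (1 * r)%:R * t by rewrite mulr_ge0.
apply: lt_le_trans (pmean_ge_sum 1 l0 ig i0).
rewrite big_ord1 /= /pois expr0 fact0 divr1 mulr1 mulr_gt0 ?expR_gt0//.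
by rewrite /occ /= mem_head.
Qed.

Let off_density t x y : R := (x != y)%:R * rho t [:: x; y].

Let triple t x y : R := (x != y)%:R *
  (\sum_(u <- nb x) (u != y)%:R * rho t [:: y; u; x] +
   \sum_(u <- nb y) (u != x)%:R * rho t [:: x; u; y]).

(** On the diagonal [off_density] vanishes, whereas the pair step produces [2 * h t]; the [diag]
    term takes it away. One formula then holds on all pairs and can be averaged by [pair_step]. *)
Let d_off t x y : R :=
  2 * r%:R * (pair_step (off_density t) x y - off_density t x y)
  - diag x y * (2 * h t) - triple t x y.

Let pair_step_off_diag t x : 0 <= t -> 2 * r%:R * pair_step (off_density t) x x = 2 * h t.
Proof.
move=> t0; have E : \sum_(z <- nb x) rho t [:: x; z] = h t.
  exact: (sum_rho2_const o nb_size nb_simple nb_trans HX).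
rewrite /pair_step mulrCA divff ?mulr1 ?mulf_neq0// ?pnatr_eq0// -E.
rewrite mulr_natl mulr2n; congr (_ + _); apply: eq_big_seq => z zx.
  by rewrite /off_density nb_irr// mul1r rho_swap.
by rewrite /off_density eq_sym nb_irr// mul1r.
Qed.

Let is_derive_off t x y : 0 < t ->
  is_derive t 1 (fun t => off_density t x y) (d_off t x y).
Proof.
move=> t0; have [->|xy] := eqVneq x y.
  rewrite /off_density eqxx (_ : (fun _ => _) = cst 0); last first.
    by apply/funext => u; rewrite /= mul0r.
  apply: is_derive_eq (is_derive_cst _ _ _) _.
  rewrite /d_off /diag /triple eqxx /= mulrBr pair_step_off_diag ?ltW//.
  by rewrite /off_density eqxx /=; ring.
have D := is_derive_rho2 nb_size nb_simple HX t0 xy.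
rewrite /off_density xy (_ : (fun _ => _) = fun t => rho t [:: x; y]); last first.
  by apply/funext => u; rewrite mul1r.
apply: is_derive_eq D _; rewrite /d_off /diag /triple (negbTE xy) mul0r subr0 mul1r.
rewrite /pair_step /off_density xy mul1r.
have -> : \sum_(z <- nb y) (x != z)%:R * rho t [:: x; z] =
    \sum_(z <- nb y) (z != x)%:R * rho t [:: x; z].
  by apply: eq_bigr => z _; rewrite eq_sym.
under eq_bigr do rewrite mulrBr.
under [X in _ + X - _ = _]eq_bigr do rewrite mulrBr.
by rewrite !sumrB; field.
Qed.

Let triple_ge0 t x y : 0 <= triple t x y.
Proof.
rewrite mulr_ge0// addr_ge0//; apply: sumr_ge0 => u _;
  by rewrite mulr_ge0// rho_ge0.
Qed.

Let sum_rho_swap t x : 0 <= t -> \sum_(u <- nb x) rho t [:: u; x] = h t.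
Proof.
move=> t0; rewrite /h -(sum_rho2_const o nb_size nb_simple nb_trans HX x t0).
by apply: eq_bigr => u _; exact: rho_swap.
Qed.

(** Negative correlation splits off the vertex that does not jump; the adjacent pair that remains
    sums to [h]. *)
Let triple_le t x y : 0 <= t -> triple t x y <= 2 * (p t * h t).
Proof.
move=> t0; rewrite /triple; case: eqP => [_|/eqP xy] /=.
  by rewrite mul0r mulr_ge0// mulr_ge0 ?density_ge0 ?coalescence_rate_ge0.
have H a b : a != b ->
    \sum_(u <- nb a) (u != b)%:R * rho t [:: b; u; a] <= p t * h t.
  move=> ab; rewrite -(sum_rho_swap a t0) mulr_sumr; apply: ler_sum => u _.
  case: (eqVneq u b) => [_|ub] /=.
    by rewrite mul0r mulr_ge0 ?density_ge0 ?rho_ge0.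
  rewrite mul1r -[p t](rho1_const o nb_size nb_simple nb_trans HX b t0).
  apply: (rho_negative_correlation nb_size HX) => //.
  by rewrite !inE negb_or ![b == _]eq_sym ub ab.
rewrite mul1r mulr_natl mulr2n; apply: lerD; first exact: H.
by apply: H; rewrite eq_sym.
Qed.

Let triple_le_rate t x y : 0 <= t -> triple t x y <= 2 * h t.
Proof.
move=> t0; rewrite (le_trans (triple_le x y t0))// ler_wpM2l//.
by rewrite ler_piMl ?coalescence_rate_ge0// density_le1.
Qed.

Let off_density_ge0 t x y : 0 <= off_density t x y.
Proof. by rewrite mulr_ge0// rho_ge0. Qed.

Let off_density_le t x y : 0 <= t -> off_density t x y <= p t ^+ 2.
Proof.
move=> t0; rewrite /off_density; case: eqP => [_|/eqP xy] /=.
  by rewrite mul0r exprn_ge0// density_ge0.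
by rewrite mul1r rho2_le.
Qed.

Let escape_growth x y : exp_growth (fun n => escape n x y).
Proof.
by apply: unit_growth => n; rewrite escape_ge0 ?escape_le1.
Qed.

Let survival s x y : R := pmean (2 * r%:R * s) (fun n => escape n x y).

Let survival_step s x y : x != y ->
  pmean (2 * r%:R * s) (fun n => escape n.+1 x y) = pair_step (survival s) x y.
Proof.
move=> xy; rewrite /pair_step /survival.
rewrite -(@pmean_sum _ _ (nb x) (fun z n => escape n z y)); last by move=> z; exact: escape_growth.
rewrite -(@pmean_sum _ _ (nb y) (fun z n => escape n x z)); last by move=> z; exact: escape_growth.
have g1 : exp_growth (fun n => \sum_(z <- nb x) escape n z y).
  by apply: sum_growth => z; exact: escape_growth.
have g2 : exp_growth (fun n => \sum_(z <- nb y) escape n x z).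
  by apply: sum_growth => z; exact: escape_growth.
rewrite -pmeanD// [RHS]mulrC -(pmean_const_mul (2 * r%:R)^-1); last first.
  by have := lin_growth 1 g1 g2; under eq_fun do rewrite mul1r.
congr pmean; apply/funext => n.
by rewrite /escape /= /killed_step xy mul1r /pair_step mulrC.
Qed.

(* Dropping the three-point term, the pair density is a subsolution of the
   equation killed on the diagonal, which [survival] solves. *)
Lemma off_density_survival t0 s x y : 0 < t0 -> 0 <= s ->
  off_density (t0 + s) x y <= p t0 ^+ 2 * survival s x y.
Proof.
move=> t00 s0; have [<-|xy] := eqVneq x y.
  rewrite /off_density eqxx mul0r mulr_ge0 ?exprn_ge0 ?density_ge0//.
  by apply: pmean_ge0 => [||n]; rewrite ?mulr_ge0 ?escape_ge0//; exact: escape_growth.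
rewrite -subr_le0; pose D (z : V * V) := z.1 != z.2.
pose w s (z : V * V) := off_density (t0 + s) z.1 z.2 - p t0 ^+ 2 * survival s z.1 z.2.
pose dw s (z : V * V) := d_off (t0 + s) z.1 z.2 - p t0 ^+ 2 *
  (2 * r%:R * (pmean (2 * r%:R * s) (fun n => escape n.+1 z.1 z.2) - survival s z.1 z.2)).
have surv0 u v : survival 0 u v = (u != v)%:R by rewrite /survival mulr0 pmean0.
have surv_diag s' u : survival s' u u = 0.
  rewrite /survival -[RHS](pmean_cst (2 * r%:R * s')); congr pmean.
  by apply/funext => n; rewrite escape_diag.
have surv_ge0 s' u v : 0 <= s' -> 0 <= survival s' u v.
  move=> s'0.
  by apply: pmean_ge0 => [||n]; rewrite ?mulr_ge0 ?escape_ge0//; exact: escape_growth.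
rewrite -[leLHS]/(w s (x, y)).
have H := @maximum_principle R (V * V)%type (fun z : V * V => D z) w dw (2 * r%:R) 1 _ _ _ _ s (x, y).
apply: H => //.
- move=> {s0}s [u v] s0 _.
  have H := is_derive_off u v (_ : 0 < t0 + s).
  have {}H := H (ltr_pwDl t00 s0).
  have H1 : is_derive s 1 (fun s => t0 + s) 1.
    by apply: is_derive_eq (is_deriveD (is_derive_cst t0 s 1) (is_derive_id s 1)) _; rewrite add0r.
  have D1 := @is_derive1_comp _ (fun t => off_density t u v) (fun s => t0 + s) s _ _ H H1.
  have D2 := is_derive_pmeanM (2 * r%:R) s (escape_growth u v).
  have D3 := is_deriveB D1 (is_deriveZ (p t0 ^+ 2) D2).
  by apply: is_derive_eq D3 _; rewrite mulr1.
- move=> {s0}s M s0 M0 HM [u v] Duv; rewrite /dw /w /=.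
  have ts0 : 0 <= t0 + s by rewrite addr_ge0// ltW.
  have uv : u != v := Duv.
  rewrite survival_step// /d_off /diag (negbTE uv) mul0r subr0.
  have HM' a b : off_density (t0 + s) a b + - (p t0 ^+ 2) * survival s a b <= M.
    rewrite mulNr; have [->|ab] := eqVneq a b; last exact: (HM (a, b)).
    by rewrite /off_density eqxx mul0r surv_diag mulr0 subr0.
  have H2 : pair_step (off_density (t0 + s)) u v - p t0 ^+ 2 * pair_step (survival s) u v <= M.
    rewrite -mulNr -(pair_stepDM nb r_gt0) -[leRHS](pair_step_cst nb_size r_gt0 M u v).
    exact: pair_step_mono.
  have H3 : 2 * r%:R * (pair_step (off_density (t0 + s)) u v -
     p t0 ^+ 2 * pair_step (survival s) u v) <= 2 * r%:R * M.
    by rewrite ler_wpM2l// mulr_ge0.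
  have H4 := triple_ge0 (t0 + s) u v.
  rewrite (le_trans _ H3)// -subr_ge0.
  by rewrite (_ : _ - _ = triple (t0 + s) u v)//; ring.
- move=> [u v] Duv; have uv : u != v := Duv; rewrite /w /= addr0 surv0 uv mulr1 subr_le0.
  exact/off_density_le/ltW.
- move=> {s0}s [u v] s0 _; have ts0 : 0 <= t0 + s by rewrite addr_ge0// ltW.
  rewrite /w /= lerBlDr (le_trans (off_density_le u v ts0))//.
  rewrite -[leLHS]addr0 lerD//; last by rewrite mulr_ge0 ?surv_ge0// exprn_ge0// density_ge0.
  by rewrite exprn_ile1 ?density_ge0 ?density_le1.
Qed.

Lemma coalescence_rate_survival t s : 0 < t -> 0 <= s ->
  h (t + s) <= p t ^+ 2 * (r%:R * pmean (2 * r%:R * s) (fun n => renewal n.+1)).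
Proof.
move=> t0 s0.
have rg : exp_growth (fun n => renewal n.+1).
  by apply: unit_growth => n; rewrite renewal_ge0 ?renewal_le1.
have E : r%:R * pmean (2 * r%:R * s) (fun n => renewal n.+1) =
    \sum_(y <- nb o) survival s o y.
  rewrite -pmean_const_mul// /survival -pmean_sum; last by move=> y; exact: escape_growth.
  by congr pmean; apply/funext => n; rewrite renewalE// mulVKf.
rewrite E mulr_sumr /coalescence_rate big_seq [leRHS]big_seq; apply: ler_sum => y yo.
have := off_density_survival o y t0 s0; rewrite /off_density.
by rewrite eq_sym (nb_irr yo) mul1r.
Qed.

(** * The pair density against a truncated Green function *)

Section GreenWeight.
Variables (S N : nat) (G : R).
Hypothesis GH : forall n, \sum_(m < n) pair_diag m <= G.

Let l : R := r%:R * S%:R.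
Let w m : R := pois (2 * l) m.
Let g n t : R := iter n pair_step (off_density t) o o.

Let l0 : 0 <= 2 * l.
Proof. by rewrite mulr_ge0// mulr_ge0. Qed.

Let w0 m : 0 <= w m.
Proof. exact: pois_ge0. Qed.

(* The pair density integrated against a truncated Green function of the pair
   of walks started at [(o, o)], up to time [S]. *)
Definition green_pairs t : R :=
  (2 * r%:R)^-1 * \sum_(m < 2 * N) w m * \sum_(n < m) g n t.

Let g_ge0 n t : 0 <= g n t.
Proof. by apply: (iter_pair_step_ge0 nb_size r_gt0) => x y; exact: off_density_ge0. Qed.

Let g_le n t : 0 <= t -> g n t <= p t ^+ 2.
Proof.
move=> t0; rewrite -[leRHS](iter_pair_step_cst nb_size r_gt0 n (p t ^+ 2) o o).
by apply: iter_pair_step_mono => x y; exact: off_density_le.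
Qed.

Let g0 t : g 0 t = 0.
Proof. by rewrite /g /= /off_density eqxx mul0r. Qed.

Lemma green_pairs_ge0 t : 0 <= green_pairs t.
Proof.
rewrite mulr_ge0 ?invr_ge0 ?mulr_ge0//; apply: sumr_ge0 => m _.
by rewrite mulr_ge0// sumr_ge0.
Qed.

(** The pair makes $2rS$ jumps on average up to time $S$, and $(2r)^{-1}$ is its mean holding
    time. *)
Let first_moment_le c : 0 <= c ->
  (2 * r%:R)^-1 * \sum_(m < 2 * N) w m * (m%:R * c) <= S%:R * c.
Proof.
move=> c0; under eq_bigr do rewrite mulrA.
rewrite -mulr_suml mulrA ler_wpM2r// ler_pdivrMl ?mulr_gt0//.
rewrite (le_trans (pois_first_moment (2 * N) l0))// /l le_eqVlt.
by apply/orP; left; apply/eqP; ring.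
Qed.

Lemma green_pairs_le t : 0 <= t -> green_pairs t <= S%:R * p t ^+ 2.
Proof.
move=> t0; apply: le_trans (first_moment_le (exprn_ge0 2 (density_ge0 t))).
rewrite ler_wpM2l ?invr_ge0 ?mulr_ge0//; apply: ler_sum => m _; rewrite ler_wpM2l//.
apply: (@le_trans _ _ (\sum_(n < m) p t ^+ 2)); first by apply: ler_sum => n _; exact: g_le.
by rewrite sumr_const card_ord mulr_natl.
Qed.

Let q : R := \sum_(k < N) pois l k.

Let D_green t : R :=
  (2 * r%:R)^-1 * \sum_(m < 2 * N) w m * \sum_(n < m) iter n pair_step (d_off t) o o.

Lemma is_derive_green_pairs t : 0 < t -> is_derive t 1 green_pairs (D_green t).
Proof.
move=> t0.
have Dg n : is_derive t 1 (g n) (iter n pair_step (d_off t) o o).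
  by apply: is_derive_pair_step => x y; exact: is_derive_off.
have D1 (m : nat) : is_derive t 1 (fun t => w m * \sum_(n < m) g n t)
    (w m * \sum_(n < m) iter n pair_step (d_off t) o o).
  have D2 : is_derive t 1 (fun t => \sum_(n < m) g n t)
     (\sum_(n < m) iter n pair_step (d_off t) o o) by apply: is_derive_bigsum.
  by apply: is_derive_eq (is_deriveZ (w m) D2) _.
have D3 : is_derive t 1 (fun t => \sum_(m < 2 * N) w m * \sum_(n < m) g n t)
   (\sum_(m < 2 * N) w m * \sum_(n < m) iter n pair_step (d_off t) o o).
  by apply: is_derive_bigsum => m; exact: D1.
by apply: is_derive_eq (is_deriveZ (2 * r%:R)^-1 D3) _.
Qed.

Let iter_d_off t n : iter n pair_step (d_off t) o o =
  2 * r%:R * (g n.+1 t - g n t) - 2 * h t * pair_diag n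
  - iter n pair_step (triple t) o o.
Proof.
have E0 (c : R) (f : V -> V -> R) : iter n pair_step (fun x y => c * f x y) o o =
    c * iter n pair_step f o o.
  have := iter_pair_stepDM nb r_gt0 n (fun _ _ => 0) f c o o.
  rewrite (iter_pair_step_cst nb_size r_gt0) add0r => <-.
  by congr (iter n _ _ o o); apply/funext => x; apply/funext => y; rewrite add0r.
rewrite (_ : d_off t = fun x y => (fun x y => (fun x y => 2 * r%:R *
   (fun x y => pair_step (off_density t) x y + -1 * off_density t x y) x y) x y +
   - (2 * h t) * diag x y) x y + -1 * triple t x y); last first.
  by apply/funext => x; apply/funext => y; rewrite /d_off; ring.
rewrite !iter_pair_stepDM// E0 iter_pair_stepDM//.
rewrite -[iter n pair_step (pair_step (off_density t)) o o]
  /(iter n pair_step (fun x y => pair_step (off_density t) x y) o o).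
rewrite (_ : iter n pair_step (fun x y => pair_step (off_density t) x y) o o = g n.+1 t).
  by rewrite -/(g n t) -/(pair_diag n); ring.
by rewrite /g iterSr.
Qed.

Let iter_triple_le t n c : (forall x y, triple t x y <= c) ->
  iter n pair_step (triple t) o o <= c.
Proof.
move=> H; rewrite -[leRHS](iter_pair_step_cst nb_size r_gt0 n c o o).
exact: iter_pair_step_mono.
Qed.

Let sum_w_le1 : \sum_(m < 2 * N) w m <= 1.
Proof. exact: sum_pois_le1. Qed.

(** The pair function [rho] is [off_density] plus [p] on the diagonal. Truncation leaves mass [q] in
    the main term, while in the subtracted diagonal term the full average is a safe upper bound. *)
Let second_moment t : 0 <= t ->
  q ^+ 2 * p t ^+ 2 - p t * pmean (2 * l) pair_diag <= \sum_(m < 2 * N) w m * g m t.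
Proof.
move=> t0; have ll : 0 <= l by rewrite mulr_ge0.
have f0 x y : 0 <= rho t [:: x; y] by exact: rho_ge0.
have fE : (fun x y => rho t [:: x; y]) = fun x y => off_density t x y + p t * diag x y.
  apply/funext => x; apply/funext => y; rewrite /off_density /diag.
  have [->|xy] := eqVneq x y; last by rewrite mul1r mulr0 addr0.
  rewrite mul0r add0r mulr1 -[p t](rho1_const o nb_size nb_simple nb_trans HX y t0).
  by apply: (rho_eqi HX) => z; rewrite !inE orbb.
have := @poisson_second_moment R V nb r o nb_size r_gt0 N _ l (p t ^+ 2) ll f0 _.
move=> /(_ (fun u : seq (R * V) => rho_second_moment o nb_size nb_simple nb_trans HX u t0)).
rewrite fE => H.
have dg : exp_growth pair_diag.
  exact: pair_diag_growth.
have H2 : \sum_(m < 2 * N) w m * pair_diag m <= pmean (2 * l) pair_diag.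
  by apply: pmean_ge_sum => // n; exact: pair_diag_ge0.
rewrite lerBlDr (le_trans H)//.
under eq_bigr do rewrite iter_pair_stepDM// mulrDr.
rewrite big_split /= lerD//.
rewrite -/pair_diag (le_trans _ (ler_wpM2l (density_ge0 t) H2))// mulr_sumr.
by rewrite le_eqVlt; apply/orP; left; apply/eqP; apply: eq_bigr => m _; rewrite mulrCA.
Qed.

(** Summed over [n < m], the differences [g n.+1 - g n] telescope to [g m], whose Poisson average is
    the second moment. The diagonal terms add up to at most [G] whatever [m] is. [c] stands for
    either bound on [triple]. *)
Let D_green_ge t c : 0 <= t -> 0 <= c -> (forall x y, triple t x y <= 2 * c) ->
  q ^+ 2 * p t ^+ 2 - p t * pmean (2 * l) pair_diag - G / r%:R * h t - 2 * S%:R * c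
  <= D_green t.
Proof.
move=> t0 c0 Hc.
have tel m : \sum_(n < m) (g n.+1 t - g n t) = g m t.
  rewrite -(big_mkord xpredT (fun n => g n.+1 t - g n t)).
  by rewrite (telescope_sumr (fun n => g n t)) // g0 subr0.
have low (m : nat) : 2 * r%:R * g m t - 2 * h t * G - m%:R * (2 * c) <=
    \sum_(n < m) iter n pair_step (d_off t) o o.
  under eq_bigr do rewrite iter_d_off.
  rewrite !sumrB -!mulr_sumr tel; apply: lerB; last first.
    apply: (@le_trans _ _ (\sum_(n < m) 2 * c)).
      by apply: ler_sum => n _; exact: iter_triple_le.
    by rewrite sumr_const card_ord [leRHS]mulr_natl.
  by rewrite lerB// ler_wpM2l// mulr_ge0// coalescence_rate_ge0.
have G0 : 0 <= G by have := GH 0; rewrite big_ord0.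
apply: (@le_trans _ _ ((2 * r%:R)^-1 * \sum_(m < 2 * N) w m *
    (2 * r%:R * g m t - 2 * h t * G - m%:R * (2 * c)))); last first.
  by rewrite ler_wpM2l ?invr_ge0 ?mulr_ge0//; apply: ler_sum => m _; rewrite ler_wpM2l.
under eq_bigr do rewrite !mulrBr.
rewrite !sumrB !mulrBr; apply: lerB; last first.
  by rewrite (le_trans (first_moment_le _)) ?mulr_ge0// le_eqVlt; apply/orP; left; apply/eqP; ring.
apply: lerB; last first.
  rewrite -mulr_suml mulrCA.
  apply: (@le_trans _ _ (1 * ((2 * r%:R)^-1 * (2 * h t * G)))).
    by rewrite ler_wpM2r// mulr_ge0 ?invr_ge0 ?mulr_ge0 ?coalescence_rate_ge0.
  by rewrite le_eqVlt; apply/orP; left; apply/eqP; field.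
rewrite (le_trans (second_moment t0))// mulr_sumr le_eqVlt; apply/orP; left; apply/eqP.
by apply: eq_bigr => m _; field.
Qed.

(** Coarser than the bound with [p t * h t], but linear in $h=-p'$, hence integrable exactly: the
    form suited to proving that the density vanishes. *)
Lemma D_green_ge_rate t : 0 <= t ->
  q ^+ 2 * p t ^+ 2 - p t * pmean (2 * l) pair_diag - G / r%:R * h t - 2 * S%:R * h t
  <= D_green t.
Proof.
move=> t0; apply: D_green_ge => //; first exact: coalescence_rate_ge0.
by move=> x y; exact: triple_le_rate.
Qed.

Lemma D_green_ge_density t : 0 <= t ->
  q ^+ 2 * p t ^+ 2 - p t * pmean (2 * l) pair_diag - G / r%:R * h t
  - 2 * S%:R * (p t * h t) <= D_green t.
Proof.
move=> t0; apply: D_green_ge => //.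
  by rewrite mulr_ge0 ?coalescence_rate_ge0 ?density_ge0.
by move=> x y; exact: triple_le.
Qed.

Lemma green_pairs_inequality : exists2 D : R -> R,
  forall t, 0 < t -> is_derive t 1 green_pairs (D t) &
  forall t, 0 < t ->
   (\sum_(k < N) pois (r%:R * S%:R) k) ^+ 2 * p t ^+ 2
     - p t * pmean (2 * (r%:R * S%:R)) pair_diag - G / r%:R * h t
     - 2 * S%:R * h t <= D t /\
   (\sum_(k < N) pois (r%:R * S%:R) k) ^+ 2 * p t ^+ 2
     - p t * pmean (2 * (r%:R * S%:R)) pair_diag - G / r%:R * h t
     - 2 * S%:R * (p t * h t) <= D t.
Proof.
exists D_green => t t0; first exact: is_derive_green_pairs.
by split; [exact/D_green_ge_rate/ltW|exact/D_green_ge_density/ltW].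
Qed.

End GreenWeight.
End DensityEstimates.

(** * The differential inequalities *)

Section Asymptotics.
Variables (R : realType) (p h : R -> R) (ret : nat -> R) (r alpha : R).
Implicit Types (t s e u : R).
Hypothesis r_gt0 : 0 < r.
Hypothesis alpha_gt0 : 0 < alpha.
Hypothesis p_gt0 : forall t, 0 <= t -> 0 < p t.
Hypothesis p_le1 : forall t, p t <= 1.
Hypothesis dp : forall t : R, 0 < t -> is_derive t 1 p (- h t).
Hypothesis h_ge0 : forall t, 0 <= h t.
Hypothesis h_le : forall t, 0 <= t -> h t <= r * p t ^+ 2.
Hypothesis h_delayed : forall e, 0 < e -> exists2 s, 0 <= s &
  forall t, 0 < t -> h (t + s) <= p t ^+ 2 * (alpha + e).
Hypothesis ret_ge0 : forall n, 0 <= ret n.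
Hypothesis ret_summable : exists C, forall n : nat, \sum_(k < n) ret k <= C.
Hypothesis green : forall (S : nat) e, 0 < e -> exists Psi D : R -> R,
  forall t, 0 < t ->
  [/\ is_derive t 1 Psi (D t), 0 <= Psi t, Psi t <= S%:R * p t ^+ 2,
    (1 - e) * p t ^+ 2 - p t * ret S - alpha^-1 * h t - 2 * S%:R * h t <= D t &
    (1 - e) * p t ^+ 2 - p t * ret S - alpha^-1 * h t - 2 * S%:R * (p t * h t) <= D t].

Let p_noninc t s : 0 < t -> t <= s -> p s <= p t.
Proof.
move=> t0 ts; rewrite -subr_le0 -[leRHS](mul0r (s - t)).
apply: (@is_derive_le R p (fun t => - h t) t s 0 ts) => e /andP[te _].
  by apply: dp; exact: lt_le_trans te.
by rewrite oppr_le0.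
Qed.

Let ret_small e : 0 < e -> exists S, ret S <= e.
Proof.
move=> e0; apply: contrapT => H; have [C HC] := ret_summable.
have lt n : e * n%:R <= C.
  apply: le_trans (HC n); apply: (@le_trans _ _ (\sum_(k < n) e)).
    by rewrite sumr_const card_ord mulr_natr.
  apply: ler_sum => k _; rewrite leNgt; apply/negP => ke; apply: H.
  by exists k; exact: ltW.
have C0 : 0 <= C by have := lt 0%N; rewrite mulr0.
have := lt (Num.truncn (C / e)).+1; rewrite leNgt mulrC -ltr_pdivrMr// => /negP; apply.
by rewrite truncnS_gt.
Qed.

(** Otherwise every term of the block $[n,2n)$ would be at least $e/(2n)$, and the block would
    contribute $e/2$ to a convergent series. *)
Let ret_harmonic e : 0 < e -> exists n1, forall n, (n1 <= n)%N -> (0 < n)%N ->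
  exists S, [/\ (n <= S)%N, (S < 2 * n)%N & S%:R * ret S <= e].
Proof.
move=> e0; have [C HC] := ret_summable.
pose a := series ret.
have anon : nondecreasing_seq a.
  by apply/nondecreasing_seqP => n; rewrite /a /series /= big_nat_recr//= lerDl.
have acvg : cvgn a.
  apply: nondecreasing_is_cvgn => //; exists C => _ [n _ <-].
  by rewrite /a /series /= big_mkord.
have e20 : 0 < e / 2 by rewrite divr_gt0.
have [n1 _ Hn1] := (cvgrPdist_lt _ _).1 acvg _ e20.
exists n1 => n n1n n0; apply: contrapT => H.
have big S : (n <= S < 2 * n)%N -> e / (2 * n%:R) <= ret S.
  move=> /andP[nS Sn]; rewrite ler_pdivrMr ?mulr_gt0 ?ltr0n// leNgt; apply/negP => eS.
  apply: H; exists S; split => //; apply: le_trans (ltW eS).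
  by rewrite mulrC ler_wpM2l// -natrM ler_nat ltnW.
have : a (2 * n)%N - a n < e / 2.
  apply: le_lt_trans (Hn1 n n1n); apply: le_trans (ler_norm _).
  by rewrite lerD2r; exact: nondecreasing_cvgn_le.
rewrite ltNge => /negP; apply.
rewrite sub_series_geq//; last by rewrite leq_pmull.
apply: (@le_trans _ _ (\sum_(n <= k < 2 * n) e / (2 * n%:R))).
  rewrite sumr_const_nat mul2n -addnn addnK -[leRHS]mulr_natr.
  rewrite le_eqVlt; apply/orP; left; apply/eqP.
  have nn : n%:R != 0 :> R by rewrite pnatr_eq0 -lt0n.
  by field.
by apply: ler_sum_nat.
Qed.

(** If [p] stayed above [e], then for an [S] with [ret S <= e / 4] the bounded function
    $\Psi-(1/\alpha+2S)p$ would have derivative at least $e^2/2$ forever: losing a quarter of $p^2$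
    to the error of [green] and a quarter to [ret S] leaves one half. *)
Let p_vanishes e : 0 < e -> exists2 t1, 0 < t1 & forall t, t1 <= t -> p t <= e.
Proof.
move=> e0; apply: contrapT => H.
have pe t : 0 < t -> e < p t.
  move=> t0; rewrite ltNge; apply/negP => pte; apply: H; exists t => // s ts.
  exact: le_trans (p_noninc t0 ts) pte.
have e4 : 0 < e / 4 by rewrite divr_gt0.
have [S HS] := ret_small e4.
have q4 : 0 < 4^-1 :> R by rewrite invr_gt0.
have [Psi [D HD]] := green S q4.
pose c := alpha^-1 + 2 * S%:R.
have c0 : 0 <= c by rewrite addr_ge0 ?invr_ge0 ?(ltW alpha_gt0)// mulr_ge0.
pose F t := Psi t + c * - p t.
have dF t : 0 < t -> is_derive t 1 F (D t + c * - (- h t)).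
  move=> t0; have [D1 _ _ _ _] := HD t t0.
  by apply: is_derive_eq (is_deriveD D1 (is_deriveZ c (is_deriveN (dp t0)))) _.
have F_le t : 1 <= t -> e ^+ 2 / 2 * (t - 1) <= F t - F 1.
  move=> t1; apply: (@is_derive_ge R F (fun t => D t + c * - (- h t)) 1 t _ t1) => s /andP[s1 _].
    by apply: dF; exact: lt_le_trans s1.
  have s0 : 0 < s by exact: lt_le_trans s1.
  have [_ _ _ D1 _] := HD s s0.
  have pes := pe s s0.
  have P1 : p s * ret S <= p s * (p s / 4).
    rewrite ler_wpM2l ?(ltW (p_gt0 (ltW s0)))// (le_trans HS)// ler_wpM2r ?invr_ge0//.
    exact: ltW.
  have P2 : e ^+ 2 <= p s ^+ 2 by rewrite lerXn2r ?nnegrE ?ltW// p_gt0// ltW.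
  rewrite opprK -/c in D1 *; rewrite /c mulrDl; move: D1 P1 P2; rewrite !expr2 mulrA.
  by set x := p s * p s => *; lra.
have bnd t : 1 <= t -> F t - F 1 <= S%:R + c.
  move=> t1; have t0 : 0 < t by exact: lt_le_trans t1.
  have [_ _ P1 _ _] := HD t t0; have [_ P2 _ _ _] := HD 1 ltr01.
  have P3 : S%:R * p t ^+ 2 <= S%:R.
    by rewrite ler_piMr// exprn_ile1// ltW// p_gt0// ltW.
  have P4 : c * p 1 <= c by rewrite ler_piMr.
  have P5 : 0 <= c * p t by rewrite mulr_ge0// ltW// p_gt0// ltW.
  by rewrite /F !mulrN; lra.
pose T := 1 + (S%:R + c + 1) / (e ^+ 2 / 2).
have e2 : 0 < e ^+ 2 / 2 by rewrite divr_gt0// exprn_gt0.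
have T1 : 1 <= T.
  rewrite /T lerDl; apply: divr_ge0; last exact: ltW.
  by have := ler0n R S; lra.
have := le_trans (F_le T T1) (bnd T T1).
rewrite /T addrAC subrr add0r mulrC mulfVK ?gt_eqF//.
by rewrite leNgt ltrDl ltr01.
Qed.

(** [h_delayed] compares [h] with the density a time [s] earlier. As $p'\ge -rp^2$ and [p] tends to
    0, the relative change of [p] during [s] is negligible. *)
Let h_asymp e : 0 < e -> exists2 t1, 0 < t1 &
  forall t, t1 <= t -> h t <= (alpha + e) * p t ^+ 2.
Proof.
move=> e0; have e2 : 0 < e / 2 by rewrite divr_gt0.
have [s s0 Hs] := h_delayed e2.
have ae : 0 < alpha + e by rewrite addr_gt0.
(* [k] below bounds the relative decrease of [p] over the delay, and [k <= k0] gives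
   $(\alpha+e)(1-k)^2\ge\alpha+e/2$. *)
pose k0 := e / (4 * (alpha + e)).
have k00 : 0 < k0 by rewrite divr_gt0 ?mulr_gt0.
have sr0 : 0 < s * r + 1 by rewrite ltr_pwDr// mulr_ge0// ltW.
have d0 : 0 < k0 / (s * r + 1) by rewrite divr_gt0.
have [t1 t10 Ht1] := p_vanishes d0.
exists (t1 + s) => [|t tt]; first by rewrite ltr_pwDl.
have ts1 : t1 <= t - s by rewrite lerBrDr.
have ts0 : 0 < t - s by exact: lt_le_trans ts1.
have := Hs _ ts0; rewrite subrK => /le_trans; apply.
have ps := Ht1 _ ts1; set u := p (t - s) in ps *.
have u0 : 0 < u by rewrite p_gt0// ltW.
have step : - (r * u ^+ 2) * s <= p t - u.
  have -> : - (r * u ^+ 2) * s = - (r * u ^+ 2) * (t - (t - s)) by congr (_ * _); ring.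
  have tst : t - s <= t by rewrite gerBl.
  apply: (@is_derive_ge R p (fun t => - h t) (t - s) t _ tst) => v /andP[v1 _].
    by apply: dp; exact: lt_le_trans v1.
  have v0 : 0 < v by exact: lt_le_trans v1.
  rewrite lerN2 (le_trans (h_le (ltW v0)))// ler_wpM2l ?(ltW r_gt0)//.
  by rewrite lerXn2r ?nnegrE ?p_noninc// ltW// p_gt0// ltW.
pose k := s * r * u.
have kk : k <= k0.
  rewrite /k; have : (s * r + 1) * u <= k0 by rewrite mulrC -ler_pdivlMr.
  by rewrite mulrDl mul1r; lra.
have k_ge0 : 0 <= k by rewrite /k !mulr_ge0 // ltW.
have k1 : k <= 1.
  rewrite (le_trans kk)// /k0 ler_pdivrMr ?mulr_gt0// mul1r.
  by have := alpha_gt0; lra.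
have step' : u * (1 - k) <= p t by rewrite /k; move: step; rewrite expr2; lra.
have sq : (u * (1 - k)) ^+ 2 <= p t ^+ 2.
  by rewrite lerXn2r ?nnegrE ?mulr_ge0 ?subr_ge0 ?(ltW u0)// ltW// p_gt0// (le_trans (ltW ts0))// gerBl.
apply: (@le_trans _ _ ((alpha + e) * (u * (1 - k)) ^+ 2)); last by rewrite ler_wpM2l// ltW.
rewrite exprMn mulrCA ler_wpM2l ?exprn_ge0 ?(ltW u0)//.
have K : 4 * ((alpha + e) * k) <= e.
  have : k * (4 * (alpha + e)) <= e by rewrite -ler_pdivlMr ?mulr_gt0.
  lra.
have K2 : 0 <= (alpha + e) * k ^+ 2 by rewrite mulr_ge0 ?exprn_ge0// ltW.
by rewrite sqrrB expr1n mul1r mulrDr mulrBr mulr1 -mulr_natr; lra.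
Qed.

Let Y t := (p t)^-1.
Let dY t := h t * Y t ^+ 2.

Let Y_gt0 t : 0 <= t -> 0 < Y t.
Proof. by move=> t0; rewrite invr_gt0 p_gt0. Qed.

Let is_derive_Y t : 0 < t -> is_derive t 1 Y (dY t).
Proof.
move=> t0; have pn : p t != 0 by rewrite gt_eqF// p_gt0// ltW.
have D := is_deriveV pn (dp t0).
by apply: is_derive_eq D _; rewrite /dY /Y -exprVn /GRing.scale /=; ring.
Qed.

Let pY t : 0 <= t -> p t * Y t = 1.
Proof. by move=> t0; rewrite mulfV// gt_eqF// p_gt0. Qed.

Let dY_ge0 t : 0 <= dY t.
Proof. by rewrite mulr_ge0// sqr_ge0. Qed.

Let dY_le c t : 0 <= t -> h t <= c * p t ^+ 2 -> dY t <= c.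
Proof.
move=> t0 hc; rewrite /dY -[c]mulr1 -(expr1n _ 2) -(pY t0) exprMn [leRHS]mulrA.
by rewrite ler_wpM2r// sqr_ge0.
Qed.

Let Y_nondec t s : 0 < t -> t <= s -> Y t <= Y s.
Proof.
move=> t0 ts; have s0 := lt_le_trans t0 ts.
by rewrite lef_pV2 ?posrE ?p_gt0 ?p_noninc// ltW.
Qed.

Let Y_growth c t1 t : 0 < t1 -> t1 <= t ->
  (forall s, t1 <= s -> h s <= c * p s ^+ 2) -> Y t - Y t1 <= c * (t - t1).
Proof.
move=> t10 tt Hc; apply: (@is_derive_le R Y dY t1 t c tt) => s /andP[s1 _].
  by apply: is_derive_Y; exact: lt_le_trans s1.
by apply: dY_le; [exact: le_trans (ltW t10) s1|exact: Hc].
Qed.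

(* Psi Y^2 + (1/alpha + O(eta)) Y has derivative at least 1 - O(eta) on a window
   of length Y/r, and its first term, at most S = O(eta Y), is negligible there. *)
Let Y_window e : 0 < e -> exists2 t1, 0 < t1 &
  forall t, t1 <= t -> (alpha - e) * (Y t / r) <= Y (t + Y t / r) - Y t.
Proof.
move=> e0; pose c0 := alpha^-1.
have c00 : 0 < c0 by rewrite invr_gt0.
have K0 : 0 < 3 + 4 * r + 8 * alpha.
  by rewrite !addr_gt0 ?mulr_gt0.
(* The three losses are [3 * eta] in the derivative, [4 * eta * r] from the bound [S] on $\Psi Y^2$
   at the end of the window, and [8 * eta * alpha] from the three-point terms. The slope [alpha - e]
   allows them to total $e/\alpha$. *)
pose eta := e * c0 / (3 + 4 * r + 8 * alpha).
have eta0 : 0 < eta by rewrite divr_gt0 ?mulr_gt0.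
have etaE : eta * (3 + 4 * r + 8 * alpha) = e * c0 by rewrite mulfVK// gt_eqF.
have [n1 Hn1] := ret_harmonic (exprn_gt0 2 eta0).
(* Once [p] is below this level, [eta * Y] exceeds [n1], so [ret_harmonic] applies at that scale. *)
have d0 : 0 < eta / n1.+1%:R by rewrite divr_gt0.
have [t1 t10 Ht1] := p_vanishes d0.
exists t1 => // t0 tt; have t00 := lt_le_trans t10 tt.
set Y0 := Y t0; have Y00 : 0 < Y0 by rewrite Y_gt0// ltW.
have etaY : n1.+1%:R <= eta * Y0.
  rewrite /Y0 /Y ler_pdivlMr ?p_gt0 ?(ltW t00)// mulrC -ler_pdivlMr ?ltr0n//.
  exact: Ht1.
have etaY1 : 1 <= eta * Y0 by apply: le_trans etaY; rewrite ler1n.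
(* With [n] between [eta * Y0] and twice that, [S] lies between [eta * Y0] and [4 * eta * Y0]: small
   against [Y0], yet large enough for [S * ret S <= eta ^ 2] to yield [ret S * Y0 <= eta]. *)
have [n [nl nu]] : exists n : nat, eta * Y0 <= n%:R /\ n%:R <= 2 * (eta * Y0).
  exists (Num.truncn (eta * Y0)).+1; split; first by rewrite ltW// truncnS_gt.
  have : (Num.truncn (eta * Y0))%:R <= eta * Y0 by rewrite truncn_le (le_trans ler01).
  by rewrite -natr1; lra.
have nn1 : (n1.+1 <= n)%N by rewrite -(ler_nat R) (le_trans etaY).
have [S [nS Sn HS]] := Hn1 n (ltnW nn1) (leq_ltn_trans (leq0n _) nn1).
have SY : S%:R <= 4 * eta * Y0.
  apply: (@le_trans _ _ (2 * n%:R)); last lra.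
  by rewrite -natrM ler_nat ltnW.
have SY' : eta * Y0 <= S%:R by apply: le_trans nl _; rewrite ler_nat.
have piS : ret S * Y0 <= eta.
  rewrite -(ler_pM2l eta0) -expr2; apply: le_trans HS.
  by rewrite mulrCA mulrC ler_wpM2r.
have [Psi [D HD]] := green S eta0.
set Del := Y0 / r; have Del0 : 0 < Del by rewrite divr_gt0.
have YD : Y0 = r * Del by rewrite /Del mulrC mulfVK// gt_eqF.
set T := t0 + Del; have tT : t0 <= T by rewrite lerDl ltW.
pose F t := Psi t * Y t ^+ 2 + (c0 + 8 * eta) * Y t.
pose dF t := (D t * Y t ^+ 2 + Psi t * (2 * Y t * dY t)) + (c0 + 8 * eta) * dY t.
have FD t : 0 < t -> is_derive t 1 F (dF t).
  move=> tp; have [D1 _ _ _ _] := HD t tp; have D2 := is_derive_Y tp.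
  have -> : F = (Psi * (Y * Y) + (c0 + 8 * eta) \*: Y)%R.
    by apply/funext => v; rewrite /F expr2.
  have D3 := is_deriveM D1 (is_deriveM D2 D2).
  apply: is_derive_eq (is_deriveD D3 (is_deriveZ (c0 + 8 * eta) D2)) _.
  transitivity (Psi t * (Y t * dY t + Y t * dY t) + Y t * Y t * D t +
    (c0 + 8 * eta) * dY t) => //.
  by rewrite /dF; ring.
have dF_ge t : t0 <= t <= T -> 1 - 3 * eta <= dF t.
  move=> /andP[t0t tTT]; have tp : 0 < t by exact: lt_le_trans t0t.
  have tp' := ltW tp.
  have [_ Psi0 _ _ HDt] := HD t tp.
  have Yt0 := Y_gt0 tp'.
  (* $h\le rp^2$ means $Y'\le r$, so [Y] at most doubles during a time [Y0 / r]. This is the reason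
     for the length of the window. *)
  have YY : Y t <= 2 * Y0.
    have : Y t - Y0 <= r * (t - t0).
      by apply: Y_growth => // s s0; apply: h_le; apply: le_trans s0; exact: ltW.
    have : r * (t - t0) <= r * Del by rewrite ler_wpM2l ?(ltW r_gt0)// lerBlDl.
    by rewrite -YD; lra.
  have Y0Y : Y0 <= Y t by exact: Y_nondec.
  have X1 : ret S * Y t <= 2 * eta.
    by apply: le_trans (ler_wpM2l (ret_ge0 S) YY) _; rewrite mulrCA; lra.
  have X2 : S%:R * p t <= 4 * eta.
    rewrite -(ler_pM2r Yt0) -mulrA (pY tp') mulr1 (le_trans SY)//.
    by rewrite ler_wpM2l// mulr_ge0// ltW.
  have X3 : S%:R * p t * dY t <= 4 * eta * dY t by rewrite ler_wpM2r.
  have X4 : 0 <= Psi t * (2 * Y t * dY t) by rewrite !mulr_ge0// ltW.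
  have := ler_wpM2r (sqr_ge0 (Y t)) HDt.
  have -> : ((1 - eta) * p t ^+ 2 - p t * ret S - alpha^-1 * h t - 2 * S%:R * (p t * h t)) * Y t ^+ 2
    = (1 - eta) * (p t * Y t) ^+ 2 - (p t * Y t) * (ret S * Y t) - c0 * dY t
      - 2 * (S%:R * p t * dY t) by rewrite /dY /c0; ring.
  rewrite (pY tp') expr1n mulr1 mul1r /dF mulrDl; lra.
have := @is_derive_ge R F dF t0 T (1 - 3 * eta) tT _ dF_ge.
have Tt : T - t0 = Del by rewrite /T addrAC subrr add0r.
rewrite Tt => /(_ _) H.
have {}H : (1 - 3 * eta) * Del <= F T - F t0.
  by apply: H => s /andP[s0 _]; apply: FD; exact: lt_le_trans s0.
have Tp : 0 < T by exact: lt_le_trans tT.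
have [_ _ PT _ _] := HD T Tp; have [_ P0 _ _ _] := HD t0 t00.
have B1 : Psi T * Y T ^+ 2 <= S%:R.
  apply: le_trans (ler_wpM2r (sqr_ge0 _) PT) _.
  by rewrite -mulrA -exprMn pY ?(ltW Tp)// expr1n mulr1.
have B2 : 0 <= Psi t0 * Y t0 ^+ 2 by rewrite mulr_ge0// sqr_ge0.
have C0 : 0 < c0 + 8 * eta by apply: addr_gt0 c00 _; exact: mulr_gt0.
rewrite -(ler_pM2l C0).
have B3 : (1 - 3 * eta - 4 * eta * r) * Del <= (c0 + 8 * eta) * (Y T - Y0).
  have E : 4 * eta * r * Del = 4 * eta * Y0 by rewrite YD; ring.
  rewrite mulrBl E; move: H B1 B2 SY; rewrite /F -/Y0.
  clearbody Y0 Del T c0 eta.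
  set a := Psi T * _; set b := Psi t0 * _; lra.
apply: le_trans B3; rewrite mulrA ler_wpM2r ?(ltW Del0)//.
have ac : alpha * c0 = 1 by rewrite mulfV// gt_eqF.
have : 0 <= e * eta by rewrite mulr_ge0// ltW.
have -> : (c0 + 8 * eta) * (alpha - e) =
  alpha * c0 - e * c0 + 8 * eta * alpha - 8 * (e * eta) by ring.
by rewrite ac -etaE; lra.
Qed.

(* Every late time is the right end of a window, by the intermediate value
   theorem for t + Y t / r; hence an induction on the number of windows. *)
Let Y_lower e : 0 < e -> e < alpha -> exists t1, exists2 C, 0 < t1 &
  forall t, t1 <= t -> (alpha - e) * t - C <= Y t.
Proof.
move=> e0 ea; have [t1 t10 Ht1] := Y_window e0.
(* As [Y] is nondecreasing, every window after [t1] has length at least [D0], so finitely many reach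
   [t]. The constant makes the lower bound nonpositive on the initial stretch of length [D0]. *)
set D0 := Y t1 / r; have D00 : 0 < D0 by rewrite divr_gt0// Y_gt0// ltW.
exists t1, ((alpha - e) * (t1 + D0)) => //.
have g0 : 0 <= alpha - e by rewrite subr_ge0 ltW.
have claim (n : nat) t : t1 <= t -> t <= t1 + n%:R * D0 -> (alpha - e) * (t - (t1 + D0)) <= Y t.
  elim: n t => [|n IH] t tt tn.
    have -> : t = t1 by apply/eqP; rewrite eq_le tt -[leRHS]addr0 -(mul0r D0) tn.
    apply: (@le_trans _ _ 0); last by rewrite ltW// Y_gt0// ltW.
    by rewrite mulr_ge0_le0// opprD addrA subrr add0r oppr_le0 ltW.
  have [tD|tD] := leP t (t1 + D0).
    apply: (@le_trans _ _ 0); last by rewrite ltW// Y_gt0// (le_trans (ltW t10)).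
    by rewrite mulr_ge0_le0// subr_le0.
  pose f u := u + r^-1 * Y u.
  have fc : {within `[t1, t], continuous f}.
    apply: derivable_within_continuous => u; rewrite in_itv /= => /andP[u1 _].
    have u0 : 0 < u by exact: lt_le_trans u1.
    have D1 := is_deriveD (is_derive_id u 1) (is_deriveZ r^-1 (is_derive_Y u0)).
    exact: ex_derive.
  have tp := lt_le_trans t10 tt.
  have f1 : f t1 <= t by rewrite /f mulrC ltW.
  have f2 : t <= f t.
    rewrite /f lerDl; apply: mulr_ge0; first by rewrite invr_ge0 ltW.
    exact: ltW (Y_gt0 (ltW tp)).
  have f12 : Num.min (f t1) (f t) <= t <= Num.max (f t1) (f t).
    by rewrite ge_min le_max f1 f2 orbT.
  have [u] := IVT tt fc f12; rewrite in_itv /= => /andP[u1 ut] fu.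
  have uE : t = u + Y u / r by rewrite -fu /f mulrC.
  have YD : D0 <= Y u / r by rewrite ler_wpM2r ?invr_ge0 ?(ltW r_gt0)// Y_nondec.
  have := IH u u1 _; have -> : u <= t1 + n%:R * D0.
    by move: tn; rewrite -natr1 mulrDl mul1r; lra.
  move=> /(_ isT) I1; have := Ht1 u u1; rewrite -uE => I2.
  have : (alpha - e) * (t - (t1 + D0)) = (alpha - e) * (u - (t1 + D0)) + (alpha - e) * (Y u / r).
    by rewrite [in LHS]uE; ring.
  lra.
move=> t tt; rewrite -mulrBr.
apply: (claim (Num.truncn ((t - t1) / D0)).+1) => //.
rewrite -lerBlDl -ler_pdivrMr// ltW//; exact: truncnS_gt.
Qed.

Let Y_upper e : 0 < e -> exists t1, exists2 C, 0 < t1 &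
  forall t, t1 <= t -> Y t <= (alpha + e) * t + C.
Proof.
move=> e0; have [t1 t10 Ht1] := h_asymp e0.
exists t1, (Y t1) => // t tt; have := Y_growth t10 tt Ht1.
have : 0 <= (alpha + e) * t1 by rewrite mulr_ge0 ?addr_ge0 ?ltW.
by rewrite mulrBr; lra.
Qed.

Lemma density_asymptotics : t * p t @[t --> +oo] --> alpha^-1.
Proof.
have YC : Y t / t @[t --> +oo] --> alpha.
  apply/cvgrPdist_le => e e0.
  pose d := Num.min (e / 2) (alpha / 2).
  have d0 : 0 < d by rewrite lt_min !divr_gt0.
  have de : d <= e / 2 by rewrite ge_min lexx.
  have da : d < alpha.
    by apply: (@le_lt_trans _ _ (alpha / 2)); [rewrite ge_min lexx orbT|have := alpha_gt0; lra].
  have [t1 [C1 t10 H1]] := Y_lower d0 da.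
  have [t2 [C2 t20 H2]] := Y_upper d0.
  pose T := Num.max (Num.max t1 t2) (Num.max (C1 / d) (C2 / d)).
  exists T; split; first exact: num_real.
  move=> t; rewrite /T !gt_max => /andP[/andP[tt1 tt2] /andP[tC1 tC2]].
  have t0 : 0 < t by exact: lt_trans tt1.
  have := H1 t (ltW tt1); have := H2 t (ltW tt2).
  move: tC1 tC2; rewrite !ltr_pdivrMr// ler_distl => c1 c2 U L.
  have de' : d * t <= e / 2 * t by rewrite ler_wpM2r// ltW.
  have ub : Y t / t <= alpha + e by rewrite ler_pdivrMr//; lra.
  have lb : alpha - e <= Y t / t by rewrite ler_pdivlMr//; lra.
  by rewrite lerBlDr ub -lerBlDr.
apply: (cvg_trans _ (cvgV (lt0r_neq0 alpha_gt0) YC)); apply: near_eq_cvg.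
near=> t; have t0 : 0 < t by near: t; exact: nbhs_pinfty_gt.
by rewrite /= /Y invfM invrK invrK mulrC.
Unshelve. all: by end_near. Qed.
End Asymptotics.

(** * Conclusion *)

Lemma degree_const (V : countType) (nb : V -> seq V) (o : V) :
  simple_graph nb -> vertex_transitive nb -> forall x, size (nb x) = size (nb o).
Proof.
move=> simple trans x; have [phi [aut <-]] := trans o x.
by rewrite (perm_size (perm_nb_aut simple aut o)) size_map.
Qed.

(** An isolated vertex would be the whole of a connected graph. *)
Lemma degree_gt0 (V : countType) (nb : V -> seq V) (o : V) :
  graph_connected nb -> ~ finite_set [set: V] -> (0 < size (nb o))%N.
Proof.
move=> conn inf; rewrite lt0n size_eq0; apply/eqP => nbo; apply: inf.
apply: (sub_finite_set _ (finite_set1 o)) => x _ /=.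
have [[|y s]] := conn o x; first by move=> /eqP.
by rewrite /= nbo.
Qed.

(** From some [M] on [renewal] is within [e / 2] of its limit, and fewer than [M] jumps in a long
    time are unlikely: pointwise it is at most the limit plus $e/2+2^{M-n}$. *)
Lemma renewal_delayed (R : realType) (V : countType) (nb : V -> seq V) (r : nat) (o : V)
    (nb_size : forall x, size (nb x) = r) (r_gt0 : (0 < r)%N) (e : R) : 0 < e ->
  exists2 s : R, 0 <= s &
    pmean (2 * r%:R * s) (fun n => renewal R nb r o n.+1) <= limn (renewal R nb r o) + e.
Proof.
move=> e0; have rp : 0 < r%:R :> R by rewrite ltr0n.
have e2 : 0 < e / 2 by rewrite divr_gt0.
set b := limn (renewal R nb r o).
have [M _ HM] := (cvgrPdist_lt _ _).1 (renewal_cvg (o := o) nb_size r_gt0) _ e2.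
(* Then $rs=2^{M+1}/e$, and $e^{rs}\ge 1+rs$ makes the tail $2^Me^{-rs}$ at most $e/2$. *)
pose s := 2 ^+ M * 2 / e / r%:R.
have s0 : 0 <= s by rewrite !divr_ge0 ?mulr_ge0 ?exprn_ge0// ltW.
have g := geometric_growth R.
have gM : exp_growth (fun n => 2 ^+ M * 2 ^- n : R).
  have := lin_growth (2 ^+ M) (cst_growth 0) g.
  by under eq_fun do rewrite add0r.
exists s => //.
apply: (@le_trans _ _ (pmean (2 * r%:R * s) (fun n => (b + e / 2) + 2 ^+ M * 2 ^- n))).
  apply: ler_pmean.
  - by apply: mulr_ge0 s0; rewrite mulr_ge0.
  - by apply: unit_growth => n; rewrite renewal_ge0 ?renewal_le1.
  - by have := lin_growth 1 (cst_growth (b + e / 2)) gM; under eq_fun do rewrite mul1r.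
  move=> n; have [nM|Mn] := ltnP n M.
    apply: (@le_trans _ _ (0 + 1)); first by rewrite add0r renewal_le1.
    apply: lerD.
      rewrite addr_ge0 ?(ltW e2)//.
      apply: (limr_ge (cvgP _ (renewal_cvg (o := o) nb_size r_gt0))).
      by apply: nearW => k; exact: renewal_ge0.
    by rewrite ler_pdivlMr ?exprn_gt0// mul1r ler_weXn2l// ?ler1n// ltnW.
  rewrite -[leLHS]addr0; apply: lerD; last by rewrite divr_ge0 ?exprn_ge0.
  have := HM n.+1 (leqW Mn); rewrite /= distrC => /ltW /(le_trans (ler_norm _)).
  by rewrite lerBlDl.
rewrite pmeanD//; last exact: cst_growth.
rewrite pmean_cst pmean_const_mul// pmean_geometric -addrA lerD2l.
rewrite [leRHS](splitr e) lerD2l.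
have -> : 2 * r%:R * s / 2 = r%:R * s :> R by field.
have rs : r%:R * s = 2 ^+ M * 2 / e by rewrite /s; field; rewrite !gt_eqF.
rewrite expRN ler_pdivrMr ?expR_gt0//.
apply: (@le_trans _ _ (e / 2 * (1 + r%:R * s))); last first.
  by rewrite ler_wpM2l ?(ltW e2)// expR_ge1Dx.
have -> : e / 2 * (1 + r%:R * s) = e / 2 + 2 ^+ M.
  by rewrite rs; field; rewrite gt_eqF.
by rewrite lerDr ltW.
Qed.

Theorem theorem1p12 (R : realType) (V : countType) (nb : V -> seq V) (o : V)
  (Hsimple : simple_graph nb) (Hconn : graph_connected nb)
  (Hinf : ~ finite_set [set: V])
  (Htrans : vertex_transitive nb) (Hunim : unimodular nb R)
  (d : measure_display) (Omega : measurableType d) (P : probability Omega R)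
  (X : V -> R -> Omega -> V)
  (HX : coalescing_rw nb (size (nb o)) P X)
  (Htransient : P [set w | exists T : R, forall t, T <= t -> X o t w != o] = 1%E)
  (W1 W2 : R -> Omega -> V)
  (HW : is_ctmc (@indep_moves V nb) ((2 * size (nb o))%:R) P
          [seq [:: o; y] | y <- nb o] (fun t w => [:: W1 t w; W2 t w])) :
  let alpha_inf : R :=
    (size (nb o))%:R * fine (P [set w | forall t, 0 <= t -> W1 t w != W2 t w]) in
  (fun t : R => t * fine (P (\bigcup_(y in [set: V]) [set w | X y t w = o])))
    x @[x --> +oo] --> alpha_inf^-1.
Proof.
have nb_size := degree_const o Hsimple Htrans.
have r0 := degree_gt0 o Hconn Hinf.
set r := size (nb o) in HX HW nb_size r0 * => alpha_inf.
have rp : 0 < r%:R :> R by rewrite ltr0n.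
have rn : r%:R != 0 :> R by rewrite gt_eqF.
pose b := limn (renewal R nb r o).
have bcvg := @renewal_cvg R V nb r o nb_size r0.
have aE : alpha_inf = r%:R * b by rewrite /alpha_inf (prob_never_meet nb_size Hsimple r0 HW).
have [C HC] := sum_pair_diag_bounded nb_size Hsimple r0 HX Htransient.
have [C2 HC2] := sum_heat_diag_bounded nb_size Hsimple r0 HX Htransient.
have [c c0 Hc] := renewal_bound_below nb_size Hsimple Htrans r0 HC.
have b_le n : b <= renewal R nb r o n.
  apply: (limr_le (cvgP _ bcvg)); exists n => // m /= nm.
  exact: renewal_le.
have b0 : 0 < b.
  apply: lt_le_trans c0 _; apply: (limr_ge (cvgP _ bcvg)).
  by apply: nearW => k; exact: Hc.
(* With this bound as [G], the coefficient [G / r] of [green_pairs_inequality] is exactly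
   $1/\alpha$. *)
have G n : \sum_(m < n) pair_diag R nb r o m <= b^-1.
  have := green_bound nb_size Hsimple Htrans r0 n b_le (ltW b0).
  by rewrite -ler_pdivlMl// mulr1.
have occE t : fine (P (\bigcup_(y in [set: V]) [set w | X y t w = o])) = density o P X t.
  rewrite /density /rho; congr (fine (P _)); apply/seteqP; split => w /=.
    by move=> [y _ <-] x; rewrite inE => /eqP ->; exists y.
  by move=> /(_ o (mem_head _ _))[y <-]; exists y.
under eq_fun do rewrite occE.
rewrite aE; apply: (@density_asymptotics R (density o P X) (coalescence_rate nb o P X)
  (fun S : nat => pmean (2 * (r%:R * S%:R)) (pair_diag R nb r o)) r%:R (r%:R * b)).
- exact: rp.
- exact: mulr_gt0.
- exact: density_gt0.
- exact: density_le1 HX.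
- exact: is_derive_density.
- exact: coalescence_rate_ge0.
- exact: coalescence_rate_le.
- move=> e e0; have er : 0 < e / r%:R by rewrite divr_gt0.
  have [s s0 Hs] := renewal_delayed o nb_size r0 er.
  exists s => // t t0.
  apply: le_trans (coalescence_rate_survival o nb_size Hsimple Htrans r0 HX t0 s0) _.
  rewrite ler_wpM2l ?sqr_ge0// (le_trans (ler_wpM2l (ltW rp) Hs))//.
  by rewrite mulrDr mulrCA mulfV// mulr1.
- move=> n; apply: pmean_ge0 => [||m]; [by rewrite !mulr_ge0| |exact: pair_diag_ge0].
  exact: pair_diag_growth.
(* Two walks during time $S$ make as many jumps as one walk during time $2S$, so these are the even
   terms of a series with bounded partial sums. *)
- exists C2 => n; apply: le_trans (HC2 (2 * n)%N).
  pose f (k : nat) : R := pmean (r%:R * k%:R) (pair_diag R nb r o).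
  have f0 k : 0 <= f k.
    apply: pmean_ge0 => [||m]; [by rewrite mulr_ge0| |exact: pair_diag_ge0].
    exact: pair_diag_growth.
  rewrite -[leRHS]/(\sum_(k < 2 * n) f k).
  have E (k : nat) : pmean (2 * (r%:R * k%:R)) (pair_diag R nb r o) = f (2 * k)%N.
    by rewrite /f natrM; congr pmean; ring.
  elim: n => [|n IH]; first by rewrite big_ord0 sumr_ge0.
  rewrite big_ord_recr /= mulnS addnC addn2 !big_ord_recr /= E.
  by rewrite -addrA lerD// lerDl.
move=> S e e0.
have e2 : 0 < e / 2 by rewrite divr_gt0.
have rS : 0 <= r%:R * S%:R :> R by rewrite mulr_ge0.
(* Jump numbers below [N] carry mass at least $1-e/2$, whose square is at least $1-e$. *)
have [N _ HN] := (cvgrPdist_lt _ _).1 (cvg_sum_pois (r%:R * S%:R : R)) _ e2.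
have qe : 1 - e <= (\sum_(k < N) pois (r%:R * S%:R : R) k) ^+ 2.
  have := HN N (leqnn N); set q := \sum_(k < N) _ => /ltW /(le_trans (ler_norm _)) q1.
  have := sqr_ge0 (q - 1); rewrite sqrrB1 -mulr_natr; lra.
have [D dD HD] := @green_pairs_inequality R V nb r o nb_size Hsimple Htrans r0 d Omega P X HX S N _ G.
exists (green_pairs nb r o P X S N), D => t t0.
have [D1 D2] := HD t t0.
have ai : b^-1 / r%:R = (r%:R * b)^-1 by rewrite invfM mulrC.
have qp := ler_wpM2r (sqr_ge0 (density o P X t)) qe.
rewrite -ai; split.
- exact: dD.
- exact: green_pairs_ge0.
- by apply: green_pairs_le => //; exact: ltW.
- by apply: le_trans D1; rewrite !lerB.
- by apply: le_trans D2; rewrite !lerB.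
Qed.
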